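(* Let $G$ be a locally compact group, let $p\in[1,\infty]$ and let $q\in[1,\infty]$ be its dual exponent, $1/p+1/q=1$. Then the K-theory groups of $B^p_r(G)$ and $B^q_r(G)$ are canonically isomorphic, i.e. $K_i(B^p_r(G))\cong K_i(B^q_r(G))$ canonically for $i=0,1$.
   Context: Fix a left Haar measure on $G$. For $f\in C_c(G)$ (compactly supported continuous complex functions) and $p\in[1,\infty]$, $\|f\|_{B(L^p(G))}$ denotes the norm of the left convolution operator $\xi\mapsto f*\xi$, $(f*\xi)(x)=\int_G f(y)\xi(y^{-1}x)\,dy$, on $L^p(G)$. $B^p_r(G)$ is the Banach algebra obtained by completing the convolution algebra $C_c(G)$ with respect to the norm $\|\cdot\|_{B(L^p(G))}$. $K_i$, $i=0,1$, is topological K-theory of Banach algebras. ''Canonically'' refers to the isomorphism induced by the involution $f\mapsto f^*$ of $C_c(G)$, $f^*(g)=\Delta(g^{-1})\overline{f(g^{-1})}$, where $\Delta$ is the modular function of $G$. *)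

(* Defs.v *)
From HB Require Import structures.
From mathcomp Require Import all_boot all_order all_algebra complex.
From mathcomp Require Import all_classical all_reals all_analysis.

Set Implicit Arguments.
Unset Strict Implicit.
Unset Printing Implicit Defensive.

Import Order.TTheory GRing.Theory Num.Theory numFieldNormedType.Exports.

Local Open Scope classical_set_scope.
Local Open Scope ring_scope.
Local Open Scope quotient_scope.

HB.mixin Record isTopologicalGroup G & PointedTopological G & Group G := {
  mulg_continuous : continuous (fun xy : G * G => (xy.1 * xy.2)%g);
  invg_continuous : continuous (fun x : G => (x^-1)%g)
}.

#[short(type="topGroupType")]
HB.structure Definition TopologicalGroup :=
  {G of PointedTopological G & Group G & isTopologicalGroup G}.

Definition locally_compact_group (G : topGroupType) : Prop :=
  hausdorff_space G /\ locally_compact [set: G].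

Definition borel (G : topGroupType) := g_sigma_algebraType (@open G).

Section Haar.
Context {R : realType} {G : topGroupType}.
Variable mu : {measure set (borel G) -> \bar R}.

Record left_haar : Prop := LeftHaar {
  haar_left_invariant : forall (g : G) (A : set (borel G)), measurable A ->
    mu [set x : G | A (g^-1 * x)%g] = mu A;
  haar_compact_finite : forall K : set G, compact K -> (mu K < +oo)%E;
  haar_outer_regular : forall A : set (borel G), measurable A ->
    mu A = ereal_inf [set mu U | U in [set U : set G | open U /\ A `<=` U]];
  haar_inner_regular : forall U : set G, open U ->
    mu U = ereal_sup [set mu K | K in [set K : set G | compact K /\ K `<=` U]];
  haar_nontrivial : mu [set: G] != 0%E
}.

(* [set x | A (x * g^-1)] is the right translate A g, so the convention is
   mu (A g) = modular g * mu A. *)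
Definition modular (g : G) : R :=
  xget 1 [set c : R | 0 < c /\ forall A : set (borel G), measurable A ->
    (mu [set x : G | A (x * g^-1)%g] = c%:E * mu A)%E].

Definition complex_integral (f : G -> R[i]) : R[i] :=
  Complex (\int[mu]_x complex.Re (f x)) (\int[mu]_x complex.Im (f x)).

Definition Cc (f : G -> R[i]) : Prop :=
  continuous (f : G -> R[i]^o) /\ compact (closure [set x | f x != 0]).

Definition convolution (f xi : G -> R[i]) : G -> R[i] :=
  fun x => complex_integral (fun y => f y * xi (y^-1 * x)%g).

Definition involution (f : G -> R[i]) : G -> R[i] :=
  fun g => (modular (g^-1)%g)%:C%C * ((f (g^-1)%g)^*)%C.

Definition LpNorm (p : \bar R) (xi : G -> R[i]) : \bar R :=
  Lnorm mu p (fun x : borel G => (complex.Re `|xi x|)%:E).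

Definition complex_measurable (xi : G -> R[i]) : Prop :=
  measurable_fun [set: borel G] (fun x : borel G => complex.Re (xi x)) /\
  measurable_fun [set: borel G] (fun x : borel G => complex.Im (xi x)).

(* Norm of xi |-> f * xi on L^p(G), as a supremum over (representatives of)
   the unit ball. *)
Definition convolution_norm (p : \bar R) (f : G -> R[i]) : \bar R :=
  ereal_sup [set LpNorm p (convolution f xi) | xi in
    [set xi | complex_measurable xi /\ (LpNorm p xi <= 1)%E]].

End Haar.

HB.mixin Record isBanachAlgebra (K : numFieldType) A
    & CompleteNormedModule K A := {
  bmul : A -> A -> A;
  bmulA : associative bmul;
  bmulDl : left_distributive bmul +%R;
  bmulDr : right_distributive bmul +%R;
  bscalAl : forall (k : K) (x y : A), k *: bmul x y = bmul (k *: x) y;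
  bscalAr : forall (k : K) (x y : A), k *: bmul x y = bmul x (k *: y);
  norm_bmul : forall x y : A, `|bmul x y| <= `|x| * `|y|
}.

#[short(type="banachAlgType")]
HB.structure Definition BanachAlgebra (K : numFieldType) :=
  {A of CompleteNormedModule K A & isBanachAlgebra K A}.

(* The Banach algebra A, together with iota, is a completion of the convolution
   algebra C_c(G) for the operator norm on L^p(G); only the values of iota on
   C_c(G) matter. *)
Record is_Br (R : realType) (G : topGroupType)
    (mu : {measure set (borel G) -> \bar R}) (p : \bar R)
    (A : banachAlgType R[i]) (iota : (G -> R[i]) -> A) : Prop := IsBr {
  iota_linear : forall (c : R[i]) (f g : G -> R[i]), Cc f -> Cc g ->
    iota (fun x => c * f x + g x) = c *: iota f + iota g;
  iota_mul : forall f g : G -> R[i], Cc f -> Cc g ->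
    iota (convolution mu f g) = bmul (iota f) (iota g);
  iota_norm : forall f : G -> R[i], Cc f ->
    (complex.Re `|iota f|)%:E = convolution_norm mu p f;
  iota_dense : dense (iota @` [set f | Cc f])
}.

(* A^+ carries the max norm of A * K; only its topology is used. *)
Definition unitization (K : numFieldType) (A : banachAlgType K) : Type :=
  (A * K^o)%type.

Section Unitization.
Context {K : numFieldType} {A : banachAlgType K}.
Local Notation U := (unitization A).

HB.instance Definition _ := NormedModule.copy U (A * K^o)%type.

Definition unitization_one : U := (0, 1).
Definition unitization_mul (x y : U) : U :=
  (bmul x.1 y.1 + x.2 *: y.1 + y.2 *: x.1, x.2 * y.2).

Lemma bmul0l (x : A) : bmul 0 x = 0.
Proof. by apply: (addrI (bmul 0 x)); rewrite -bmulDl !addr0. Qed.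

Lemma bmul0r (x : A) : bmul x 0 = 0.
Proof. by apply: (addrI (bmul x 0)); rewrite -bmulDr !addr0. Qed.

Let mulA : associative unitization_mul.
Proof.
move=> [a k] [b l] [c m]; rewrite /unitization_mul /=; congr pair; last first.
  exact: mulrA.
rewrite !bmulDl !bmulDr !scalerDr !bmulA -!bscalAl -!bscalAr !scalerA.
rewrite [m * k]mulrC [m * l]mulrC !addrA.
by rewrite [LHS](ACl (1*4*2*5*3*6*7)).
Qed.

Let mul1 : left_id unitization_one unitization_mul.
Proof.
by move=> [a k]; rewrite /unitization_mul /= bmul0l scale1r scaler0 addr0 add0r mul1r.
Qed.

Let mulr1' : right_id unitization_one unitization_mul.
Proof.
by move=> [a k]; rewrite /unitization_mul /= bmul0r scale1r scaler0 !add0r mulr1.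
Qed.

Let mulDl : left_distributive unitization_mul +%R.
Proof.
move=> [a k] [b l] [c m]; rewrite /unitization_mul; congr pair => /=; last first.
  exact: mulrDl.
rewrite bmulDl scalerDl scalerDr !addrA.
by rewrite [LHS](ACl (1*3*5*2*4*6)).
Qed.

Let mulDr : right_distributive unitization_mul +%R.
Proof.
move=> [a k] [b l] [c m]; rewrite /unitization_mul; congr pair => /=; last first.
  exact: mulrDr.
rewrite bmulDr scalerDl scalerDr !addrA.
by rewrite [LHS](ACl (1*3*5*2*4*6)).
Qed.

Let one_neq0 : unitization_one != 0.
Proof. by apply/eqP => -[] /eqP; rewrite oner_eq0. Qed.

HB.instance Definition _ := GRing.Zmodule_isNzRing.Build U
  mulA mul1 mulr1' mulDl mulDr one_neq0.

Definition augmentation (x : U) : K := x.2.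

Let augB : additive augmentation. Proof. by []. Qed.
Let augM : GRing.monoid_morphism augmentation. Proof. by []. Qed.

HB.instance Definition _ := GRing.isAdditive.Build U K augmentation augB.
HB.instance Definition _ := GRing.isMonoidMorphism.Build U K augmentation augM.

End Unitization.

Section Grothendieck.
Variable V : nmodType.

Definition groth_rel (x y : V * V) : bool :=
  `[< exists k : V, x.1 + y.2 + k = y.1 + x.2 + k >].

Let groth_refl : reflexive groth_rel.
Proof. by move=> x; apply/asboolP; exists 0. Qed.

Let groth_sym : symmetric groth_rel.
Proof.
by move=> x y; apply/asboolP/asboolP => -[k e]; exists k; rewrite e.
Qed.

Let groth_trans : transitive groth_rel.
Proof.
move=> [b b'] [a a'] [c c'] /asboolP[k /= e1] /asboolP[l /= e2].
apply/asboolP; exists (b + b' + k + l) => /=.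
have -> : a + c' + (b + b' + k + l) = (a + b' + k) + (b + c' + l).
  by rewrite !addrA [LHS](ACl (1*4*5*3*2*6)).
by rewrite e1 e2 !addrA [LHS](ACl (4*2*1*5*3*6)).
Qed.

Canonical groth_equiv := EquivRel groth_rel groth_refl groth_sym groth_trans.

Definition groth : Type := {eq_quot groth_rel}.
HB.instance Definition _ := Choice.on groth.
HB.instance Definition _ := EqQuotient.on groth.

Definition groth_pi (x : V * V) : groth := \pi_groth x.

Lemma groth_piP (x y : V * V) :
  groth_pi x = groth_pi y <-> exists k : V, x.1 + y.2 + k = y.1 + x.2 + k.
Proof.
rewrite /groth_pi; split => [/eqmodP /asboolP //|h].
by apply/eqmodP/asboolP.
Qed.

Lemma groth_reprK (x : groth) : groth_pi (repr x) = x.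
Proof. exact: reprK. Qed.

Definition groth_add (x y : groth) : groth :=
  groth_pi ((repr x).1 + (repr y).1, (repr x).2 + (repr y).2).
Definition groth_opp (x : groth) : groth := groth_pi ((repr x).2, (repr x).1).
Definition groth_zero : groth := groth_pi (0, 0).

Lemma groth_addE (a b c d : V) :
  groth_add (groth_pi (a, b)) (groth_pi (c, d)) = groth_pi (a + c, b + d).
Proof.
have /groth_piP[k /= e1] := groth_reprK (groth_pi (a, b)).
have /groth_piP[l /= e2] := groth_reprK (groth_pi (c, d)).
apply/groth_piP; exists (k + l) => /=.
set a' := (repr _).1 in e1 *; set b' := (repr (groth_pi (a, b))).2 in e1 *.
set c' := (repr _).1 in e2 *; set d' := (repr (groth_pi (c, d))).2 in e2 *.
have -> : a' + c' + (b + d) + (k + l) = (a' + b + k) + (c' + d + l).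
  by rewrite !addrA [LHS](ACl (1*3*5*2*4*6)).
by rewrite e1 e2 !addrA [LHS](ACl (1*4*2*5*3*6)).
Qed.

Lemma groth_oppE (a b : V) : groth_opp (groth_pi (a, b)) = groth_pi (b, a).
Proof.
have /groth_piP[k /= e1] := groth_reprK (groth_pi (a, b)).
by apply/groth_piP; exists k => /=; rewrite [X in X + k]addrC -e1 addrC [b + _]addrC addrC.
Qed.

Lemma groth_ind (P : groth -> Prop) :
  (forall a b : V, P (groth_pi (a, b))) -> forall x, P x.
Proof. by move=> h x; rewrite -(groth_reprK x); case: (repr x). Qed.

Let groth_addA : associative groth_add.
Proof.
elim/groth_ind => a b; elim/groth_ind => c d; elim/groth_ind => e f.
by rewrite !groth_addE !addrA.
Qed.

Let groth_addC : commutative groth_add.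
Proof.
elim/groth_ind => a b; elim/groth_ind => c d; rewrite !groth_addE.
by rewrite [a + c]addrC [b + d]addrC.
Qed.

Let groth_add0 : left_id groth_zero groth_add.
Proof. by elim/groth_ind => a b; rewrite groth_addE !add0r. Qed.

Let groth_addN : left_inverse groth_zero groth_opp groth_add.
Proof.
elim/groth_ind => a b; rewrite groth_oppE groth_addE.
by apply/groth_piP; exists 0 => /=; rewrite !addr0 add0r addrC.
Qed.

HB.instance Definition _ := GRing.isZmodule.Build groth
  groth_addA groth_addC groth_add0 groth_addN.

Definition groth_in (v : V) : groth := groth_pi (v, 0).

End Grothendieck.

Section GrothendieckMap.
Variables (V W : nmodType) (h : V -> W).

Definition groth_map (x : groth V) : groth W :=
  groth_pi (h (repr x).1, h (repr x).2).

Hypothesis hD : {morph h : x y / x + y}.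

Lemma groth_mapE (a b : V) : groth_map (groth_pi (a, b)) = groth_pi (h a, h b).
Proof.
have /groth_piP[k /= e1] := groth_reprK (groth_pi (a, b)).
by apply/groth_piP; exists (h k); rewrite /= -!hD e1.
Qed.

Lemma groth_mapB : {morph groth_map : x y / x - y}.
Proof.
elim/groth_ind => a b; elim/groth_ind => c d.
rewrite {1}/GRing.opp {1}/GRing.add /= groth_oppE groth_addE !groth_mapE.
by rewrite [RHS]/GRing.add [in RHS]/GRing.opp /= groth_oppE groth_addE !hD.
Qed.

End GrothendieckMap.

Section Idempotents.
Variable R : nzRingType.

(* For idempotents of possibly different sizes; x and y may be rectangular,
   which agrees with the equivalence computed in M_infty(R). *)
Definition idem_equiv m n (e : 'M[R]_m) (f : 'M[R]_n) : Prop :=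
  exists (x : 'M[R]_(m, n)) (y : 'M[R]_(n, m)), x *m y = e /\ y *m x = f.

Lemma idem_equiv_refl n (e : 'M[R]_n) : e *m e = e -> idem_equiv e e.
Proof. by move=> ee; exists e, e. Qed.

Lemma idem_equiv_sym m n (e : 'M[R]_m) (f : 'M[R]_n) :
  idem_equiv e f -> idem_equiv f e.
Proof. by move=> [x [y [xy yx]]]; exists y, x. Qed.

Lemma idem_equiv_trans m n p (e : 'M[R]_m) (f : 'M[R]_n) (g : 'M[R]_p) :
  e *m e = e -> g *m g = g ->
  idem_equiv e f -> idem_equiv f g -> idem_equiv e g.
Proof.
move=> ee gg [x [y [xy yx]]] [z [w [zw wz]]].
exists (x *m z), (w *m y); split.
  rewrite mulmxA -(mulmxA x) zw -yx !mulmxA xy -mulmxA xy; exact: ee.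
by rewrite mulmxA -(mulmxA w) yx -zw !mulmxA wz -mulmxA wz.
Qed.

Definition dsum m n (e : 'M[R]_m) (f : 'M[R]_n) : 'M[R]_(m + n) :=
  block_mx e 0 0 f.

Lemma dsum_idem m n (e : 'M[R]_m) (f : 'M[R]_n) :
  e *m e = e -> f *m f = f -> dsum e f *m dsum e f = dsum e f.
Proof.
by move=> ee ff; rewrite mulmx_block !mulmx0 !mul0mx ee ff !addr0 !add0r.
Qed.

Lemma dsum_equiv m n m' n' (e : 'M[R]_m) (f : 'M[R]_n)
    (e' : 'M[R]_m') (f' : 'M[R]_n') :
  idem_equiv e e' -> idem_equiv f f' -> idem_equiv (dsum e f) (dsum e' f').
Proof.
move=> [x [y [xy yx]]] [z [w [zw wz]]].
exists (block_mx x 0 0 z), (block_mx y 0 0 w).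
by rewrite !mulmx_block !mulmx0 !mul0mx !addr0 !add0r xy yx zw wz.
Qed.

Lemma dsumC m n (e : 'M[R]_m) (f : 'M[R]_n) : e *m e = e -> f *m f = f ->
  idem_equiv (dsum e f) (dsum f e).
Proof.
move=> ee ff; exists (block_mx 0 e f 0), (block_mx 0 f e 0).
by rewrite !mulmx_block !mulmx0 !mul0mx !addr0 !add0r ee ff.
Qed.

Lemma idem_equiv_cast m n (mn : m = n) (e : 'M[R]_m) : e *m e = e ->
  idem_equiv e (castmx (mn, mn) e).
Proof. by case: n / mn => ee; rewrite castmx_id; exact: idem_equiv_refl. Qed.

Lemma dsumA m n p (e : 'M[R]_m) (f : 'M[R]_n) (g : 'M[R]_p) :
  e *m e = e -> f *m f = f -> g *m g = g ->
  idem_equiv (dsum e (dsum f g)) (dsum (dsum e f) g).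
Proof.
move=> ee ff gg.
have := @block_mxA R m n p m n p e 0 0 0 f 0 0 0 g.
rewrite /= !row_mx0 !col_mx0 /dsum => ->; apply: idem_equiv_sym.
by apply: idem_equiv_cast; apply: dsum_idem => //; apply: dsum_idem.
Qed.

Lemma dsum0 n (e : 'M[R]_n) : e *m e = e ->
  idem_equiv (dsum (0 : 'M[R]_0) e) e.
Proof.
move=> ee; exists (col_mx 0 e), (row_mx 0 e); split.
  by rewrite mul_col_row !mulmx0 !mul0mx ee.
by rewrite mul_row_col mulmx0 ee add0r.
Qed.

Definition idem : Type := {n : nat & {e : 'M[R]_n | e *m e == e}}.
HB.instance Definition _ := Choice.on idem.

Definition idem_mx (e : idem) : 'M[R]_(tag e) := val (tagged e).

Lemma idem_mxP (e : idem) : idem_mx e *m idem_mx e = idem_mx e.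
Proof. exact/eqP/(valP (tagged e)). Qed.

Definition mk_idem n (e : 'M[R]_n) (ee : e *m e = e) : idem :=
  existT _ n (exist _ e (introT eqP ee)).

Definition idem_rel (e f : idem) : bool :=
  `[< idem_equiv (idem_mx e) (idem_mx f) >].

Let idem_rel_refl : reflexive idem_rel.
Proof. by move=> e; apply/asboolP/idem_equiv_refl/idem_mxP. Qed.

Let idem_rel_sym : symmetric idem_rel.
Proof. by move=> e f; apply/asboolP/asboolP; exact: idem_equiv_sym. Qed.

Let idem_rel_trans : transitive idem_rel.
Proof.
move=> f e g /asboolP ef /asboolP fg; apply/asboolP.
by apply: idem_equiv_trans ef fg; exact: idem_mxP.
Qed.

Canonical idem_rel_equiv :=
  EquivRel idem_rel idem_rel_refl idem_rel_sym idem_rel_trans.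

Definition Vmon : Type := {eq_quot idem_rel}.
HB.instance Definition _ := Choice.on Vmon.
HB.instance Definition _ := EqQuotient.on Vmon.

Definition Vpi (e : idem) : Vmon := \pi_Vmon e.

Lemma VpiP (e f : idem) :
  Vpi e = Vpi f <-> idem_equiv (idem_mx e) (idem_mx f).
Proof.
rewrite /Vpi; split => [/eqmodP /asboolP //|h].
by apply/eqmodP/asboolP.
Qed.

Lemma Vpi_reprK (x : Vmon) : Vpi (repr x) = x. Proof. exact: reprK. Qed.

Definition idem_add (e f : idem) : idem :=
  mk_idem (dsum_idem (idem_mxP e) (idem_mxP f)).

Definition Vadd (x y : Vmon) : Vmon := Vpi (idem_add (repr x) (repr y)).
Definition Vzero : Vmon := Vpi (mk_idem (mul0mx 0 (0 : 'M[R]_0))).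

Lemma VaddE (e f : idem) : Vadd (Vpi e) (Vpi f) = Vpi (idem_add e f).
Proof.
have /VpiP h1 := Vpi_reprK (Vpi e); have /VpiP h2 := Vpi_reprK (Vpi f).
by apply/VpiP/dsum_equiv.
Qed.

Lemma V_ind (P : Vmon -> Prop) : (forall e, P (Vpi e)) -> forall x, P x.
Proof. by move=> h x; rewrite -(Vpi_reprK x). Qed.

Let VaddA : associative Vadd.
Proof.
elim/V_ind => e; elim/V_ind => f; elim/V_ind => g; rewrite !VaddE.
by apply/VpiP/dsumA; exact: idem_mxP.
Qed.

Let VaddC : commutative Vadd.
Proof.
elim/V_ind => e; elim/V_ind => f; rewrite !VaddE.
by apply/VpiP/dsumC; exact: idem_mxP.
Qed.

Let Vadd0 : left_id Vzero Vadd.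
Proof. by elim/V_ind => e; rewrite !VaddE; apply/VpiP/dsum0/idem_mxP. Qed.

HB.instance Definition _ := GRing.isNmodule.Build Vmon VaddA VaddC Vadd0.

(* Junk value 0 when e is not idempotent. *)
Definition Vclass n (e : 'M[R]_n) : Vmon :=
  if insub e is Some e' then
    Vpi (existT (fun n : nat => {e : 'M[R]_n | e *m e == e}) n e')
  else 0.

Lemma VclassE n (e : 'M[R]_n) (ee : e *m e = e) : Vclass e = Vpi (mk_idem ee).
Proof.
rewrite /Vclass insubT; first exact/eqP.
by move=> ?; congr Vpi; rewrite /mk_idem; congr existT; exact: val_inj.
Qed.

Lemma Vclass_idem (e : idem) : Vclass (idem_mx e) = Vpi e.
Proof. by rewrite (VclassE (idem_mxP e)); apply/VpiP/idem_equiv_refl/idem_mxP. Qed.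

Definition K0ring : Type := groth Vmon.
HB.instance Definition _ := GRing.Zmodule.on K0ring.

Definition K0class n (e : 'M[R]_n) : K0ring := groth_in (Vclass e).

End Idempotents.

Section K0map.
Variables (R S : nzRingType) (f : {rmorphism R -> S}).

Definition Vmap (x : Vmon R) : Vmon S := Vclass (map_mx f (idem_mx (repr x))).

Definition K0map : K0ring R -> K0ring S := groth_map Vmap.

Lemma map_mx_idem n (e : 'M[R]_n) : e *m e = e ->
  map_mx f e *m map_mx f e = map_mx f e.
Proof. by move=> ee; rewrite -map_mxM ee. Qed.

Lemma VmapE n (e : 'M[R]_n) : e *m e = e ->
  Vmap (Vclass e) = Vclass (map_mx f e).
Proof.
move=> ee; rewrite /Vmap (VclassE ee).
have /VpiP[x [y [/= xy yx]]] := Vpi_reprK (Vpi (mk_idem ee)).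
rewrite (VclassE (map_mx_idem ee)) (VclassE (map_mx_idem (idem_mxP _))).
apply/VpiP; exists (map_mx f x), (map_mx f y).
by rewrite -!map_mxM xy yx.
Qed.

Lemma VmapD : {morph Vmap : x y / x + y}.
Proof.
elim/V_ind => e; elim/V_ind => g.
have -> : Vpi e + Vpi g = Vclass (dsum (idem_mx e) (idem_mx g)).
  by rewrite (VclassE (dsum_idem (idem_mxP e) (idem_mxP g))) -VaddE.
rewrite -(Vclass_idem e) -(Vclass_idem g) !(VmapE (idem_mxP _)).
rewrite (VmapE (dsum_idem (idem_mxP e) (idem_mxP g))).
rewrite /dsum map_block_mx !map_mx0.
have he := map_mx_idem (idem_mxP e); have hg := map_mx_idem (idem_mxP g).
rewrite (VclassE he) (VclassE hg) (VclassE (dsum_idem he hg)) [RHS]VaddE.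
by apply/VpiP/idem_equiv_refl/dsum_idem.
Qed.

Lemma K0mapB : {morph K0map : x y / x - y}.
Proof. exact: groth_mapB VmapD. Qed.

Lemma K0map0 : K0map 0 = 0.
Proof. by rewrite -(subrr 0) K0mapB subrr. Qed.

End K0map.

(* K_0(A) is the kernel of K_0(A^+) -> K_0(C). *)

Section K0.
Context {R : realType}.
Variable A : banachAlgType R[i].

Definition K0_pred : {pred K0ring (unitization A)} :=
  [pred x | K0map (@augmentation _ A) x == 0].

Let K0_zmod : zmod_closed K0_pred.
Proof.
split=> [|x y]; rewrite !inE; first by rewrite K0map0.
by move=> /eqP x0 /eqP y0; rewrite K0mapB x0 y0 subrr.
Qed.

HB.instance Definition _ :=
  GRing.isZmodClosed.Build (K0ring (unitization A)) K0_pred K0_zmod.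

Record K0 : Type := MkK0 { K0_val :> K0ring (unitization A);
                           K0_valP : K0_val \in K0_pred }.
HB.instance Definition _ := [isSub for K0_val].
HB.instance Definition _ := [Choice of K0 by <:].
HB.instance Definition _ := [SubChoice_isSubZmodule of K0 by <:].

End K0.

(* K_1(A) is GL_infty(A) / GL_infty(A)_0, as path components. *)

Section MatrixContinuity.

Lemma mx_cvg {T : Type} {U : topologicalType} (F : set_system T) {FF : Filter F}
    m n (f : T -> 'M[U]_(m, n)) (l : 'M[U]_(m, n)) :
  (forall i j, f x i j @[x --> F] --> l i j) -> f @ F --> l.
Proof.
move=> h B [P lP PB]; rewrite nbhs_filterE /=.
have : \forall x \near F, forall i j, P i j (f x i j).
  by apply: filter_forall => i; apply: filter_forall => j; exact: h (lP i j).
by apply: filterS => x Px; exact: PB.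
Qed.

Lemma mx_cvg_coord {T : Type} {U : topologicalType} (F : set_system T)
    {FF : Filter F} m n (f : T -> 'M[U]_(m, n)) (l : 'M[U]_(m, n)) i j :
  f @ F --> l -> f x i j @[x --> F] --> l i j.
Proof.
move=> h B lB; apply: (h [set M | B (M i j)]).
exists (fun i' j' => [set y | i' = i -> j' = j -> B y]) => [i' j'|M hM].
  have [->|ne] := eqVneq i' i; last by apply/nearW => y e; rewrite e eqxx in ne.
  have [->|ne] := eqVneq j' j; last by apply/nearW => y _ e; rewrite e eqxx in ne.
  by apply: filterS lB => y By _ _.
exact: (hM i j erefl erefl).
Qed.

Context {K : numFieldType} {A : banachAlgType K}.
Local Notation U := (unitization A).

Lemma bmulBl (x y z : A) : bmul (x - y) z = bmul x z - bmul y z.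
Proof. by apply/eqP; rewrite eq_sym subr_eq -bmulDl subrK. Qed.

Lemma bmulBr (x y z : A) : bmul x (y - z) = bmul x y - bmul x z.
Proof. by apply/eqP; rewrite eq_sym subr_eq -bmulDr subrK. Qed.

Lemma bmul_continuous : continuous (fun z : A * A => bmul z.1 z.2).
Proof.
move=> [/= k x]; apply/cvgrPdist_lt => _/posnumP[e]; near +oo_K => M.
near=> l z => /=; have M0 : 0 < M by [].
rewrite (@distm_lt_split _ _ (bmul k z)) // -?bmulBl -?bmulBr.
  apply: (le_lt_trans (norm_bmul _ _)).
  rewrite (@le_lt_trans _ _ (M * `|x - z|)) ?ler_wpM2r -?ltr_pdivlMl//.
  by near: z; apply: cvgr_dist_lt; rewrite // mulr_gt0 ?invr_gt0.
apply: (le_lt_trans (norm_bmul _ _)).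
rewrite (@le_lt_trans _ _ (`|k - l| * M)) ?ler_wpM2l -?ltr_pdivlMr//.
  by near: z; near: M; apply: cvg_bounded (@cvg_refl _ _).
by near: l; apply: cvgr_dist_lt; rewrite // divr_gt0.
Unshelve. all: by end_near. Qed.

Lemma unitization_cvgM {T : Type} (F : set_system T) {FF : Filter F}
    (f g : T -> U) (a b : U) :
  f @ F --> a -> g @ F --> b -> f x * g x @[x --> F] --> a * b.
Proof.
move=> fa gb.
have fa1 : (f x).1 @[x --> F] --> a.1.
  exact: (cvg_comp _ _ fa (@cvg_fst _ _ _ _ _)).
have fa2 : (f x).2 @[x --> F] --> a.2.
  exact: (cvg_comp _ _ fa (@cvg_snd _ _ _ _ _)).
have gb1 : (g x).1 @[x --> F] --> b.1.
  exact: (cvg_comp _ _ gb (@cvg_fst _ _ _ _ _)).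
have gb2 : (g x).2 @[x --> F] --> b.2.
  exact: (cvg_comp _ _ gb (@cvg_snd _ _ _ _ _)).
have h1 : bmul (f x).1 (g x).1 + (f x).2 *: (g x).1 + (g x).2 *: (f x).1
    @[x --> F] --> bmul a.1 b.1 + a.2 *: b.1 + b.2 *: a.1.
  apply: cvgD; last exact: cvgZ.
  apply: cvgD; last exact: cvgZ.
  exact: (@continuous2_cvg T A A A F FF _ _ (fun x y : A => bmul x y) _ _
    (@bmul_continuous (a.1, b.1)) fa1 gb1).
have h2 : (f x).2 * (g x).2 @[x --> F] --> a.2 * b.2.
  exact: (@cvgM K T F).
exact: (cvg_pair h1 h2).
Qed.

Lemma mulmx_cvg {T : Type} (F : set_system T) {FF : Filter F} m n p
    (f : T -> 'M[U]_(m, n)) (g : T -> 'M[U]_(n, p))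
    (a : 'M[U]_(m, n)) (b : 'M[U]_(n, p)) :
  f @ F --> a -> g @ F --> b -> f x *m g x @[x --> F] --> a *m b.
Proof.
move=> fa gb; apply: mx_cvg => i j; under eq_cvg do rewrite mxE.
rewrite mxE; apply: (@cvg_big U _ +%R 0 xpredT _ T F) => [|k _].
  move=> z; apply: (@cvgD K U _ (nbhs z) _ fst snd z.1 z.2).
    exact: cvg_fst.
  exact: cvg_snd.
by apply: unitization_cvgM; exact: mx_cvg_coord.
Qed.

End MatrixContinuity.

Section K1.
Context {R : realType}.
Variable A : banachAlgType R[i].
Local Notation U := (unitization A).

Definition inverse_mx n (u v : 'M[U]_n) : Prop :=
  u *m v = 1%:M /\ v *m u = 1%:M.

(* GL_n(A), the invertible matrices over A^+ congruent to 1 modulo M_n(A) *)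
Definition GL n (u : 'M[U]_n) : Prop :=
  (exists v : 'M[U]_n, inverse_mx u v) /\ map_mx (@augmentation _ A) u = 1%:M.

Definition GL_path n (u v : 'M[U]_n) : Prop :=
  exists gamma : R -> 'M[U]_n,
    [/\ {within `[0, 1], continuous gamma},
        forall t : R, t \in `[0, 1] -> GL (gamma t),
        gamma 0 = u & gamma 1 = v].

(* diag(u, 1) of size N, for n <= N *)
Definition extmx N n (u : 'M[U]_n) : 'M[U]_N :=
  \matrix_(i < N, j < N)
    match insub (val i) : option 'I_n, insub (val j) : option 'I_n with
    | Some i', Some j' => u i' j'
    | _, _ => (i == j)%:R
    end.

Lemma GL1 n : GL (1%:M : 'M[U]_n).
Proof.
split; first by exists 1%:M; split; exact: mul1mx.
by rewrite map_mx1.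
Qed.

Lemma GLM n (u v : 'M[U]_n) : GL u -> GL v -> GL (u *m v).
Proof.
move=> [[u' [uu' u'u]] u1] [[v' [vv' v'v]] v1]; split.
  exists (v' *m u'); split.
    by rewrite mulmxA -(mulmxA u) vv' mulmx1.
  by rewrite mulmxA -(mulmxA v') u'u mulmx1.
by rewrite map_mxM u1 v1 mulmx1.
Qed.

Lemma GLV n (u v : 'M[U]_n) : GL u -> inverse_mx u v -> GL v.
Proof.
move=> [_ u1] [uv vu]; split; first by exists u.
by rewrite -[LHS]mul1mx -u1 -map_mxM uv map_mx1.
Qed.

Lemma extmxE m k (u : 'M[U]_m) : extmx (m + k) u = block_mx u 0 0 1%:M.
Proof.
have insubl (i : 'I_m) : insub (val (lshift k i)) = Some i.
  exact: (@valK _ _ 'I_m i).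
have insubr (i : 'I_k) : (insub (val (rshift m i)) : option 'I_m) = None.
  by rewrite insubF //= ltnNge leq_addr.
apply/matrixP => i j; rewrite mxE.
case: (split_ordP i) => i' ->; case: (split_ordP j) => j' ->.
- by rewrite !insubl block_mxEul.
- by rewrite insubl insubr block_mxEur mxE eq_lrshift.
- by rewrite insubl insubr block_mxEdl mxE eq_rlshift.
- by rewrite !insubr block_mxEdr mxE eq_rshift.
Qed.

Lemma extmxM N n (u v : 'M[U]_n) : (n <= N)%N ->
  extmx N (u *m v) = extmx N u *m extmx N v.
Proof.
move=> nN; rewrite -(subnKC nN) !extmxE mulmx_block.
by rewrite !mulmx0 !mul0mx mulmx1 !addr0 !add0r.
Qed.

Lemma extmx1 N n : (n <= N)%N -> extmx N (1%:M : 'M[U]_n) = 1%:M.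
Proof. by move=> nN; rewrite -(subnKC nN) extmxE -scalar_mx_block. Qed.

Lemma extmx_id n (u : 'M[U]_n) : extmx n u = u.
Proof.
by apply/matrixP => i j; rewrite mxE !valK.
Qed.

Lemma extmx_ext N n m (u : 'M[U]_m) : (m <= n)%N -> (n <= N)%N ->
  extmx N (extmx n u) = extmx N u.
Proof.
move=> mn nN; apply/matrixP => i j; rewrite !mxE.
case: (insubP 'I_n (val i)) => [i' _ ii'|]; last first.
  rewrite -leqNgt => ni; rewrite [in RHS]insubF //.
  by apply/negbTE; rewrite -leqNgt (leq_trans mn).
case: (insubP 'I_n (val j)) => [j' _ jj'|]; last first.
  rewrite -leqNgt => nj; case: insubP => // i'' _ _; rewrite [in RHS]insubF //.
  by apply/negbTE; rewrite -leqNgt (leq_trans mn).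
by rewrite mxE ii' jj' -!val_eqE /= -ii' -jj'.
Qed.

Lemma inverse_extmx N n (u v : 'M[U]_n) : (n <= N)%N ->
  inverse_mx u v -> inverse_mx (extmx N u) (extmx N v).
Proof. by move=> nN [uv vu]; split; rewrite -extmxM// ?uv ?vu extmx1. Qed.

Lemma GL_ext N n (u : 'M[U]_n) : (n <= N)%N -> GL u -> GL (extmx N u).
Proof.
move=> nN [[v uv] u1]; split; first by exists (extmx N v); exact: inverse_extmx.
rewrite -(subnKC nN) extmxE map_block_mx u1 !map_mx0 map_mx1.
by rewrite -scalar_mx_block.
Qed.

Lemma GL_path_refl n (u : 'M[U]_n) : GL u -> GL_path u u.
Proof. by move=> gu; exists (fun=> u); split => //; apply: continuous_subspaceT => x; exact: cvg_cst. Qed.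

Lemma GL_path_mul n (u v u' v' : 'M[U]_n) :
  GL_path u v -> GL_path u' v' -> GL_path (u *m u') (v *m v').
Proof.
move=> [f [cf gf f0 f1]] [g [cg gg g0 g1]].
exists (fun t => f t *m g t).
split; [|move=> t t01|by rewrite f0 g0|by rewrite f1 g1].
  move/subspace_continuousP: cf => cf; move/subspace_continuousP: cg => cg.
  apply/subspace_continuousP => x Ax; apply: mulmx_cvg; [exact: cf|exact: cg].
by apply: GLM; [exact: gf|exact: gg].
Qed.

Lemma GL_path_sym n (u v : 'M[U]_n) : GL_path u v -> GL_path v u.
Proof.
move=> [f [cf gf f0 f1]].
have r01 (t : R) : t \in `[0, 1] -> 1 - t \in `[0, 1].
  by rewrite !in_itv /= => /andP[t0 t1]; rewrite subr_ge0 t1 gerBl t0.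
exists (fun t => f (1 - t)).
split; [|by move=> t /r01; exact: gf|by rewrite subr0|by rewrite subrr].
move/subspace_continuousP: cf => cf; apply/subspace_continuousP => x Ax.
apply: (cvg_comp (fun t => 1 - t) f _ (cf (1 - x) (r01 _ Ax))).
move=> B /= [e e0 eB]; exists e => // y /= xy Ay; apply: eB (r01 _ Ay) => /=.
by rewrite /ball_ /= opprB addrC addrA subrK distrC.
Qed.

Lemma GL_path_trans n (u v w : 'M[U]_n) : GL v ->
  GL_path u v -> GL_path v w -> GL_path u w.
Proof.
move=> gv uv vw; have [[v' vv'] _] := gv.
have gv' := GLV gv vv'; case: vv' => vv' v'v.
have := GL_path_mul (GL_path_mul uv (GL_path_refl gv')) vw.
by rewrite -mulmxA v'v mulmx1 vv' mul1mx.
Qed.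

Lemma GL_path_ext N n (u v : 'M[U]_n) : (n <= N)%N ->
  GL_path u v -> GL_path (extmx N u) (extmx N v).
Proof.
move=> nN [f [cf gf f0 f1]].
exists (fun t => extmx N (f t)).
split; [|by move=> t /gf; exact: GL_ext|by rewrite f0|by rewrite f1].
move/subspace_continuousP: cf => cf; apply/subspace_continuousP => x Ax.
apply: mx_cvg => i j; under eq_cvg do rewrite mxE.
rewrite mxE; case: insubP => [i' _ _|_]; last exact: cvg_cst.
case: insubP => [j' _ _|_]; last exact: cvg_cst.
by apply: mx_cvg_coord; exact: cf.
Qed.

Lemma GL_path_inv n (u u' v v' : 'M[U]_n) : GL u -> GL v ->
  inverse_mx u u' -> inverse_mx v v' -> GL_path u v -> GL_path u' v'.
Proof.
move=> gu gv uu' vv' /GL_path_sym vu.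
have gu' := GLV gu uu'; have gv' := GLV gv vv'.
have := GL_path_mul (GL_path_mul (GL_path_refl gu') vu) (GL_path_refl gv').
case: uu' vv' => uu' u'u [vv' v'v].
by rewrite -mulmxA vv' mulmx1 u'u mul1mx.
Qed.

Definition GLelt : Type := {n : nat & {u : 'M[U]_n | `[< GL u >]}}.
HB.instance Definition _ := Choice.on GLelt.

Definition GL_mx (u : GLelt) : 'M[U]_(tag u) := val (tagged u).

Lemma GL_mxP (u : GLelt) : GL (GL_mx u).
Proof. exact/asboolP/(valP (tagged u)). Qed.

Definition mk_GL n (u : 'M[U]_n) (gu : GL u) : GLelt :=
  existT _ n (exist _ u (asboolT gu)).

Definition GL_equiv m n (u : 'M[U]_m) (v : 'M[U]_n) : Prop :=
  exists N : nat, [/\ (m <= N)%N, (n <= N)%N & GL_path (extmx N u) (extmx N v)].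

Lemma GL_equivW m n N (u : 'M[U]_m) (v : 'M[U]_n) : GL u ->
  (m <= N)%N -> (n <= N)%N -> extmx N u = extmx N v -> GL_equiv u v.
Proof.
by move=> gu mN nN e; exists N; split=> //; rewrite -e; exact/GL_path_refl/GL_ext.
Qed.

Lemma GL_equiv_trans m n p (u : 'M[U]_m) (v : 'M[U]_n) (w : 'M[U]_p) :
  GL v -> GL_equiv u v -> GL_equiv v w -> GL_equiv u w.
Proof.
move=> gv [N [mN nN uv]] [N' [nN' pN' vw]].
have NM : (N <= maxn N N')%N := leq_maxl N N'.
have NM' : (N' <= maxn N N')%N := leq_maxr N N'.
exists (maxn N N'); split; [exact: leq_trans NM|exact: leq_trans NM'|].
have := GL_path_ext NM uv; rewrite !extmx_ext// => uv'.
have := GL_path_ext NM' vw; rewrite !extmx_ext// => vw'.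
by apply: GL_path_trans uv' vw'; apply: GL_ext => //; exact: leq_trans NM.
Qed.

Definition GL_rel (u v : GLelt) : bool := `[< GL_equiv (GL_mx u) (GL_mx v) >].

Let GL_rel_refl : reflexive GL_rel.
Proof. by move=> u; apply/asboolP; exact: GL_equivW (GL_mxP u) _ _ _. Qed.

Let GL_rel_sym : symmetric GL_rel.
Proof.
by move=> u v; apply/asboolP/asboolP => -[N [? ? /GL_path_sym ?]]; exists N.
Qed.

Let GL_rel_trans : transitive GL_rel.
Proof.
move=> v u w /asboolP uv /asboolP vw; apply/asboolP.
by apply: GL_equiv_trans uv vw; exact: GL_mxP.
Qed.

Canonical GL_rel_equiv := EquivRel GL_rel GL_rel_refl GL_rel_sym GL_rel_trans.

Definition K1 : Type := {eq_quot GL_rel}.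
HB.instance Definition _ := Choice.on K1.
HB.instance Definition _ := EqQuotient.on K1.

Definition K1pi (u : GLelt) : K1 := \pi_K1 u.

Lemma K1piP (u v : GLelt) : K1pi u = K1pi v <-> GL_equiv (GL_mx u) (GL_mx v).
Proof.
rewrite /K1pi; split => [/eqmodP /asboolP //|h].
by apply/eqmodP/asboolP.
Qed.

Lemma K1pi_reprK (x : K1) : K1pi (repr x) = x. Proof. exact: reprK. Qed.

Lemma K1_ind (P : K1 -> Prop) : (forall u, P (K1pi u)) -> forall x, P x.
Proof. by move=> h x; rewrite -(K1pi_reprK x). Qed.

Definition GL_mul (u v : GLelt) : GLelt :=
  mk_GL (GLM (GL_ext (leq_maxl (tag u) (tag v)) (GL_mxP u))
             (GL_ext (leq_maxr (tag u) (tag v)) (GL_mxP v))).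

Lemma GL_mulE N (u v : GLelt) : (tag u <= N)%N -> (tag v <= N)%N ->
  extmx N (GL_mx (GL_mul u v)) = extmx N (GL_mx u) *m extmx N (GL_mx v).
Proof.
move=> uN vN; have M : (maxn (tag u) (tag v) <= N)%N by rewrite geq_max uN.
rewrite -[GL_mx (GL_mul u v)]/(extmx (maxn (tag u) (tag v)) (GL_mx u) *m
                               extmx (maxn (tag u) (tag v)) (GL_mx v)).
rewrite (extmxM _ _ M) (extmx_ext _ (leq_maxl _ _) M).
by rewrite (extmx_ext _ (leq_maxr _ _) M).
Qed.

Definition invertmx n (u : 'M[U]_n) : 'M[U]_n := xget 1%:M (inverse_mx u).

Lemma invertmxP n (u : 'M[U]_n) : GL u -> inverse_mx u (invertmx u).
Proof. by move=> [[v uv] _]; apply: xgetPex; exists v. Qed.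

Definition GL_inv (u : GLelt) : GLelt :=
  mk_GL (GLV (GL_mxP u) (invertmxP (GL_mxP u))).

Definition GL_one : GLelt := mk_GL (GL1 0).

Definition K1_mul (x y : K1) : K1 := K1pi (GL_mul (repr x) (repr y)).
Definition K1_inv (x : K1) : K1 := K1pi (GL_inv (repr x)).
Definition K1_one : K1 := K1pi GL_one.

Lemma K1_mulE (u v : GLelt) : K1_mul (K1pi u) (K1pi v) = K1pi (GL_mul u v).
Proof.
have /K1piP[N [uN uN' pu]] := K1pi_reprK (K1pi u).
have /K1piP[M [vM vM' pv]] := K1pi_reprK (K1pi v).
have NM : (N <= maxn N M)%N := leq_maxl N M.
have MM : (M <= maxn N M)%N := leq_maxr N M.
apply/K1piP; exists (maxn N M); split.
- by rewrite /= geq_max (leq_trans uN)//= (leq_trans vM).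
- by rewrite /= geq_max (leq_trans uN')//= (leq_trans vM').
rewrite (GL_mulE (leq_trans uN NM) (leq_trans vM MM)).
rewrite (GL_mulE (leq_trans uN' NM) (leq_trans vM' MM)).
apply: GL_path_mul.
  have := GL_path_ext NM pu.
  by rewrite (extmx_ext _ uN NM) (extmx_ext _ uN' NM).
have := GL_path_ext MM pv.
by rewrite (extmx_ext _ vM MM) (extmx_ext _ vM' MM).
Qed.

Lemma K1_invE (u : GLelt) : K1_inv (K1pi u) = K1pi (GL_inv u).
Proof.
have /K1piP[N [uN uN' pu]] := K1pi_reprK (K1pi u).
apply/K1piP; exists N; split => //.
have gr := GL_mxP (repr (K1pi u)); have gu := GL_mxP u.
apply: GL_path_inv pu; [exact: GL_ext|exact: GL_ext| |].
  by apply: inverse_extmx => //; exact: invertmxP.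
by apply: inverse_extmx => //; exact: invertmxP.
Qed.

Let K1_mulA : associative K1_mul.
Proof.
elim/K1_ind => u; elim/K1_ind => v; elim/K1_ind => w; rewrite !K1_mulE.
pose N := maxn (tag u) (maxn (tag v) (tag w)).
have uN : (tag u <= N)%N by rewrite leq_maxl.
have vN : (tag v <= N)%N by rewrite /N maxnCA leq_maxl.
have wN : (tag w <= N)%N by rewrite /N maxnA leq_maxr.
apply/K1piP; apply: (@GL_equivW _ _ N); first exact: GL_mxP.
- by rewrite /= !geq_max uN vN wN.
- by rewrite /= !geq_max uN vN wN.
have uvN : (tag (GL_mul u v) <= N)%N by rewrite /= geq_max uN.
have vwN : (tag (GL_mul v w) <= N)%N by rewrite /= geq_max vN.
rewrite (GL_mulE uN vwN) (GL_mulE vN wN) (GL_mulE uvN wN) (GL_mulE uN vN).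
exact: mulmxA.
Qed.

Let K1_mul1 : left_id K1_one K1_mul.
Proof.
elim/K1_ind => u; rewrite K1_mulE; apply/K1piP.
apply: (@GL_equivW _ _ (tag u)); [exact: GL_mxP|by rewrite /= geq_max /=|by []|].
rewrite (@GL_mulE (tag u) GL_one u (leq0n _) (leqnn _)).
by rewrite (extmx1 (leq0n _)) mul1mx.
Qed.

Let K1_mulr1 : right_id K1_one K1_mul.
Proof.
elim/K1_ind => u; rewrite K1_mulE; apply/K1piP.
apply: (@GL_equivW _ _ (tag u)); [exact: GL_mxP|by rewrite /= geq_max leqnn|by []|].
rewrite (@GL_mulE (tag u) u GL_one (leqnn _) (leq0n _)).
by rewrite (extmx1 (leq0n _)) mulmx1.
Qed.

Let K1_mulV : left_inverse K1_one K1_inv K1_mul.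
Proof.
elim/K1_ind => u; rewrite K1_invE K1_mulE; apply/K1piP.
apply: (@GL_equivW _ _ (tag u)); [exact: GL_mxP|by rewrite /= geq_max leqnn|by []|].
rewrite (@GL_mulE (tag u) (GL_inv u) u (leqnn _) (leqnn _)).
rewrite -(extmxM _ _ (leqnn _)) (extmx1 (leq0n _)).
have [_ e] := invertmxP (GL_mxP u).
by rewrite [X in extmx _ X]e (extmx1 (leqnn _)).
Qed.

Let K1_mulrV : right_inverse K1_one K1_inv K1_mul.
Proof.
elim/K1_ind => u; rewrite K1_invE K1_mulE; apply/K1piP.
apply: (@GL_equivW _ _ (tag u)); [exact: GL_mxP|by rewrite /= geq_max leqnn|by []|].
rewrite (@GL_mulE (tag u) u (GL_inv u) (leqnn _) (leqnn _)).
rewrite -(extmxM _ _ (leqnn _)) (extmx1 (leq0n _)).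
have [e _] := invertmxP (GL_mxP u).
by rewrite [X in extmx _ X]e (extmx1 (leqnn _)).
Qed.

HB.instance Definition _ := isGroup.Build K1
  K1_mulA K1_mul1 K1_mulr1 K1_mulV K1_mulrV.

(* Junk value 1 when u is not in GL_n(A). *)
Definition K1class n (u : 'M[U]_n) : K1 :=
  if insub u is Some u' then
    K1pi (existT (fun n : nat => {u : 'M[U]_n | `[< GL u >]}) n u')
  else 1%g.

End K1.

Section StarMap.
Context {R : realType} {A B : banachAlgType R[i]}.
Variable theta : A -> B.

Definition star_unitization (x : unitization A) : unitization B :=
  (theta x.1, (x.2^*)%C).

(* theta reverses products, hence the transposition. *)
Definition star_mx n (M : 'M[unitization A]_n) : 'M[unitization B]_n :=
  (map_mx star_unitization M)^T.

Definition induces_K0_isomorphism : Prop :=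
  exists phi : {additive K0 A -> K0 B}, bijective phi /\
    forall (m n : nat) (e : 'M[unitization A]_m) (f : 'M[unitization A]_n)
        (x : K0 A), e *m e = e -> f *m f = f ->
      K0_val x = K0class e - K0class f ->
      [/\ star_mx e *m star_mx e = star_mx e,
          star_mx f *m star_mx f = star_mx f &
          K0_val (phi x) = K0class (star_mx e) - K0class (star_mx f)].

Definition induces_K1_isomorphism : Prop :=
  exists phi : K1 A -> K1 B,
    [/\ bijective phi,
        {morph phi : x y / (x * y)%g} &
        forall (n : nat) (u : 'M[unitization A]_n), GL u ->
          GL (star_mx u) /\ phi (K1class u) = K1class (star_mx u)].

End StarMap.

(* Main.v *)
(** For f in C_c(G), eta in L^q(G) and a bounded compactly supported xi, Fubini
    and the substitution dx^-1 = Delta(x^-1) dx give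
      <f^* * eta, xi> = <eta, f * xi>.
    As f^* * eta is continuous, its L^q norm is the supremum of its pairings
    with such xi of L^p norm at most 1, so Hoelder's inequality gives
    ||f^*||_{B(L^q)} <= ||f||_{B(L^p)}, and equality by symmetry. The involution
    reverses convolution products, hence extends to an isometric conjugate-linear
    anti-isomorphism of the completions. Such a map induces isomorphisms in
    K-theory: combined with transposition of matrices it is multiplicative up to
    order on idempotents and on invertible matrices, which is harmless for the
    equivalence of e = xy with yx, and for K_1 because K_1 is commutative.

    Haar measure need not be sigma-finite and the Borel sets of G x G need not
    be generated by rectangles: Fubini is only applied to functions that vanish
    off a product of two compact sets. The modular function and the behaviour of
    Haar measure under inversion come from the uniqueness of Haar measure, in
    the form of an identity between integrals of functions in C_c(G). *)

Require Import Defs.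
From HB Require Import structures.
From mathcomp Require Import all_boot all_order all_algebra complex.
From mathcomp Require Import all_classical all_reals all_analysis.
From mathcomp Require Import measurable_realfun ess_sup_inf.

Import Order.TTheory GRing.Theory Num.Theory numFieldNormedType.Exports Normc.
Set Implicit Arguments.
Unset Strict Implicit.
Unset Printing Implicit Defensive.

Local Open Scope classical_set_scope.
Local Open Scope ring_scope.

(** * Conjugate-linear anti-isomorphisms and K_0 *)

(** The functions xi and eta are only measurable, so two devices keep the argument on compact sets.
    In a convolution the substitution y = x z moves the variable x into the C_c factor; convolving
    with a locally integrable function is then meaningful at every point and gives a continuous
    function. Norms are tested only against bounded, compactly supported functions that carry the
    phase of a continuous h. The sets where |h| lies in a given open interval are open, and
    [left_haar] grants inner regularity exactly for open sets. This treats p = 1 and p = +oo without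
    appeal to density of C_c or reflexivity.

    [modular] is defined by a choice, so even its existence must be derived. One double integral,
    for an arbitrary left invariant nu, does it all: a right translate of mu as nu yields the
    modular function, and nu = mu yields the inversion formula.

    The two completions are arbitrary, so the map between them is the closure of the graph that
    pairs the image of f in the first with the image of its involution in the second. That graph is
    symmetric, and reading it backwards gives the inverse map. *)

Section AntiMorphism.
Variables (R S : nzRingType) (s : R -> S).

(** Rectangular form of [star_mx], because the witnesses x and y of [idem_equiv] may be
    rectangular. *)
Definition anti_mx m n (M : 'M[R]_(m, n)) : 'M[S]_(n, m) := (map_mx s M)^T.

Definition Vanti (x : Vmon R) : Vmon S := Vclass (anti_mx (idem_mx (repr x))).

Definition K0anti : K0ring R -> K0ring S := groth_map Vanti.

Hypotheses (sD : {morph s : x y / x + y})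
  (sM : forall x y, s (x * y) = s y * s x).

Let s0 : s 0 = 0.
Proof. by apply: (addrI (s 0)); rewrite -sD !addr0. Qed.

Lemma anti_mxM m n p (M : 'M[R]_(m, n)) (N : 'M[R]_(n, p)) :
  anti_mx (M *m N) = anti_mx N *m anti_mx M.
Proof.
apply/matrixP => i j; rewrite !mxE (big_morph s sD s0).
by apply: eq_bigr => k _; rewrite !mxE sM.
Qed.

Lemma anti_mx1 n : s 1 = 1 -> anti_mx (1%:M : 'M[R]_n) = 1%:M.
Proof.
move=> s1; apply/matrixP => i j; rewrite !mxE eq_sym.
by case: eqP => _; rewrite ?s1 ?s0.
Qed.

Lemma anti_mx_idem n (e : 'M[R]_n) : e *m e = e ->
  anti_mx e *m anti_mx e = anti_mx e.
Proof. by move=> ee; rewrite -anti_mxM ee. Qed.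

(** Reversal of products turns e = x y into the product of the image of y by that of x, so the two
    witnesses only exchange their roles. *)
Lemma anti_mx_equiv m n (e : 'M[R]_m) (f : 'M[R]_n) :
  idem_equiv e f -> idem_equiv (anti_mx e) (anti_mx f).
Proof.
by move=> [x [y [<- <-]]]; exists (anti_mx y), (anti_mx x); rewrite !anti_mxM.
Qed.

Lemma anti_mx_dsum m n (e : 'M[R]_m) (f : 'M[R]_n) :
  anti_mx (dsum e f) = dsum (anti_mx e) (anti_mx f).
Proof.
have h p q : map_mx s (0 : 'M[R]_(p, q)) = 0.
  by apply/matrixP => i j; rewrite !mxE.
by rewrite /anti_mx /dsum map_block_mx tr_block_mx !h !trmx0.
Qed.

Lemma VantiE n (e : 'M[R]_n) : e *m e = e ->
  Vanti (Vclass e) = Vclass (anti_mx e).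
Proof.
move=> ee; rewrite /Vanti (VclassE ee).
have /VpiP h := Vpi_reprK (Vpi (mk_idem ee)).
rewrite (VclassE (anti_mx_idem ee)) (VclassE (anti_mx_idem (idem_mxP _))).
exact/VpiP/anti_mx_equiv.
Qed.

Lemma VantiD : {morph Vanti : x y / x + y}.
Proof.
elim/V_ind => e; elim/V_ind => g.
have -> : Vpi e + Vpi g = Vclass (dsum (idem_mx e) (idem_mx g)).
  by rewrite (VclassE (dsum_idem (idem_mxP e) (idem_mxP g))) -VaddE.
rewrite -(Vclass_idem e) -(Vclass_idem g) !(VantiE (idem_mxP _)).
rewrite (VantiE (dsum_idem (idem_mxP e) (idem_mxP g))) anti_mx_dsum.
have he := anti_mx_idem (idem_mxP e); have hg := anti_mx_idem (idem_mxP g).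
rewrite (VclassE he) (VclassE hg) (VclassE (dsum_idem he hg)) [RHS]VaddE.
by apply/VpiP/idem_equiv_refl/dsum_idem.
Qed.

Lemma K0antiB : {morph K0anti : x y / x - y}.
Proof. exact: groth_mapB VantiD. Qed.

Lemma K0anti0 : K0anti 0 = 0.
Proof. by rewrite -(subrr 0) K0antiB subrr. Qed.

Lemma groth_map_in (V W : nmodType) (h : V -> W) :
  {morph h : x y / x + y} -> h 0 = 0 ->
  forall v, groth_map h (groth_in v) = groth_in (h v).
Proof. by move=> hD h0 v; rewrite /groth_in groth_mapE// h0. Qed.

Lemma Vclass_0 : Vclass (0 : 'M[R]_0) = 0.
Proof. by rewrite (VclassE (mul0mx 0 (0 : 'M[R]_0))). Qed.

End AntiMorphism.

Section AntiMorphismTheory.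
Variables (R S : nzRingType) (s : R -> S).
Hypotheses (sD : {morph s : x y / x + y})
  (sM : forall x y, s (x * y) = s y * s x).

Lemma Vanti0 : Vanti s 0 = 0.
Proof.
rewrite -(Vclass_0 R) VantiE// ?mul0mx// -(Vclass_0 S); congr Vclass.
by apply/matrixP => -[].
Qed.

Lemma K0anti_class n (e : 'M[R]_n) : e *m e = e ->
  K0anti s (K0class e) = K0class (anti_mx s e).
Proof.
move=> ee; rewrite /K0anti /K0class (groth_map_in (VantiD sD sM) Vanti0).
by rewrite VantiE.
Qed.

(** Reduces an identity between additive maps on [K0ring] to a check on idempotent matrices. *)
Lemma K0ring_ind (P : K0ring R -> Prop) :
  (forall m n (e : 'M[R]_m) (f : 'M[R]_n), e *m e = e -> f *m f = f ->
     P (K0class e - K0class f)) -> forall x, P x.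
Proof.
move=> h; elim/groth_ind; elim/V_ind => e; elim/V_ind => f.
have := h _ _ _ _ (idem_mxP e) (idem_mxP f).
rewrite /K0class !Vclass_idem.
suff -> : groth_in (Vpi e) - groth_in (Vpi f) = groth_pi (Vpi e, Vpi f) by [].
rewrite {1}/GRing.opp {1}/GRing.add /= groth_oppE groth_addE.
by rewrite addr0 add0r.
Qed.

End AntiMorphismTheory.

Lemma K0map_class (R S : nzRingType) (f : {rmorphism R -> S}) n (e : 'M[R]_n) :
  e *m e = e -> K0map f (K0class e) = K0class (map_mx f e).
Proof.
move=> ee; have h0 : Vmap f 0 = 0.
  rewrite -(Vclass_0 R) VmapE// ?mul0mx// -(Vclass_0 S); congr Vclass.
  by apply/matrixP => -[].
by rewrite /K0map /K0class (groth_map_in (VmapD f) h0) VmapE.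
Qed.

(** Both maps are additive, so classes suffice, and there the two transpositions cancel. *)
Lemma K0anti_can (R S : nzRingType) (s : R -> S) (t : S -> R) :
  {morph s : x y / x + y} -> (forall x y, s (x * y) = s y * s x) ->
  {morph t : x y / x + y} -> (forall x y, t (x * y) = t y * t x) ->
  cancel s t -> cancel (K0anti s) (K0anti t).
Proof.
move=> sD sM tD tM st; elim/K0ring_ind => m n e f ee ff.
have key k (g : 'M[R]_k) : anti_mx t (anti_mx s g) = g.
  by apply/matrixP => i j; rewrite !mxE st.
rewrite (K0antiB sD sM) (K0antiB tD tM) !K0anti_class ?key//;
  exact: anti_mx_idem.
Qed.

Section StarIsomorphism.
Context {R : realType}.
Variables (A B : banachAlgType R[i]) (theta : A -> B).
Hypotheses (thetaD : {morph theta : x y / x + y})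
  (thetaZ : forall (c : R[i]) x, theta (c *: x) = (c^*)%C *: theta x)
  (thetaM : forall x y, theta (bmul x y) = bmul (theta y) (theta x)).

Local Notation s := (@star_unitization R A B theta).

Lemma star_unitizationD : {morph s : x y / x + y}.
Proof.
move=> [a k] [b l]; rewrite /star_unitization /=.
by congr pair; [exact: thetaD|exact: rmorphD].
Qed.

Lemma star_unitization1 : s 1 = 1.
Proof.
rewrite /star_unitization /=; congr pair; last by congr Complex; exact: oppr0.
by apply: (addrI (theta 0)); rewrite -thetaD !addr0.
Qed.

Lemma star_unitizationM x y : s (x * y) = s y * s x.
Proof.
case: x => [a k]; case: y => [b l]; rewrite /star_unitization /=.
congr pair; last by rewrite mulrC; exact: rmorphM.
by rewrite !thetaD thetaM !thetaZ /= -!addrA; congr (_ + _); exact: addrC.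
Qed.

(** On the scalar part [star_unitization] is complex conjugation, itself an anti-morphism. The
    commuting square shows that the map on K_0 of the unitization preserves the kernel of the
    augmentation, which is [K0]. *)
Lemma K0star_augmentation (x : K0ring (unitization A)) :
  K0map (@augmentation _ B) (K0anti s x) =
  K0anti (fun z : R[i] => (z^*)%C) (K0map (@augmentation _ A) x).
Proof.
have cD : {morph (fun z : R[i] => (z^*)%C) : x y / x + y} by exact: rmorphD.
have cM (z w : R[i]) : ((z * w)^*)%C = (w^*)%C * (z^*)%C.
  by rewrite mulrC; exact: rmorphM.
have sD := star_unitizationD.
have sM := star_unitizationM.
elim/K0ring_ind : x => m n e f ee ff.
rewrite (K0antiB sD sM) !K0mapB (K0antiB cD cM).
rewrite (K0anti_class sD sM ee) (K0anti_class sD sM ff).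
have see := anti_mx_idem sD sM ee; have sff := anti_mx_idem sD sM ff.
rewrite (K0map_class _ ee) (K0map_class _ ff) (K0map_class _ see).
rewrite (K0map_class _ sff).
rewrite (K0anti_class cD cM (map_mx_idem (@augmentation _ A) ee)).
rewrite (K0anti_class cD cM (map_mx_idem (@augmentation _ A) ff)).
have h k (g : 'M[unitization A]_k) : map_mx (@augmentation _ B) (anti_mx s g) =
    anti_mx (fun z : R[i] => (z^*)%C) (map_mx (@augmentation _ A) g).
  by apply/matrixP => i j; rewrite !mxE.
by rewrite (h m e) (h n f).
Qed.

Lemma K0star_pred (x : K0 A) : K0anti s (K0_val x) \in @K0_pred R B.
Proof.
have cD : {morph (fun z : R[i] => (z^*)%C) : x y / x + y} by exact: rmorphD.
have cM (z w : R[i]) : ((z * w)^*)%C = (w^*)%C * (z^*)%C.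
  by rewrite mulrC; exact: rmorphM.
rewrite inE K0star_augmentation; have /eqP -> := K0_valP x.
by rewrite (K0anti0 cD cM).
Qed.

Definition K0star (x : K0 A) : K0 B := MkK0 (K0star_pred x).

Lemma K0starB : {morph K0star : x y / x - y}.
Proof.
move=> x y; apply: val_inj => /=.
exact: (K0antiB star_unitizationD star_unitizationM).
Qed.

End StarIsomorphism.

Section K0Isomorphism.
Context {R : realType}.
Variables (A B : banachAlgType R[i]) (theta : A -> B) (theta' : B -> A).
Hypotheses (thetaD : {morph theta : x y / x + y})
  (thetaZ : forall (c : R[i]) x, theta (c *: x) = (c^*)%C *: theta x)
  (thetaM : forall x y, theta (bmul x y) = bmul (theta y) (theta x)).
Hypotheses (theta'D : {morph theta' : x y / x + y})
  (theta'Z : forall (c : R[i]) x, theta' (c *: x) = (c^*)%C *: theta' x)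
  (theta'M : forall x y, theta' (bmul x y) = bmul (theta' y) (theta' x)).
Hypotheses (thetaK : cancel theta theta') (theta'K : cancel theta' theta).

Let K0star_can : cancel (K0star thetaD thetaZ thetaM) (K0star theta'D theta'Z theta'M).
Proof.
move=> x; apply: val_inj => /=; apply: K0anti_can.
- exact: star_unitizationD.
- exact: star_unitizationM.
- exact: star_unitizationD.
- exact: star_unitizationM.
- by move=> [a k]; rewrite /star_unitization /= thetaK conjcK.
Qed.

Let K0star_can' : cancel (K0star theta'D theta'Z theta'M) (K0star thetaD thetaZ thetaM).
Proof.
move=> x; apply: val_inj => /=; apply: K0anti_can.
- exact: star_unitizationD.
- exact: star_unitizationM.
- exact: star_unitizationD.
- exact: star_unitizationM.
- by move=> [a k]; rewrite /star_unitization /= theta'K conjcK.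
Qed.

Lemma star_induces_K0 : induces_K0_isomorphism theta.
Proof.
pose phi := K0star thetaD thetaZ thetaM.
pose phia := GRing.isAdditive.Build _ _ phi (K0starB thetaD thetaZ thetaM).
pose phiA : {additive K0 A -> K0 B} := HB.pack phi phia.
exists phiA; split; first by exists (K0star theta'D theta'Z theta'M).
have sD := star_unitizationD thetaD.
have sM := star_unitizationM thetaD thetaZ thetaM.
move=> m n e f x ee ff xE; split; try exact: (anti_mx_idem sD sM).
rewrite /= xE (K0antiB sD sM) (K0anti_class sD sM ee).
by rewrite (K0anti_class sD sM ff).
Qed.

End K0Isomorphism.

(** * Conjugate-linear anti-isomorphisms and K_1 *)

Section ComplexTopology.
Context {R : realType}.
Implicit Types (x : R) (z : R[i]).

Lemma complex_normE z : `|z| = (normc z)%:C%C.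
Proof. by case: z. Qed.

Lemma normc_real x : normc x%:C%C = `|x|.
Proof. by rewrite /= expr0n addr0 sqrtr_sqr. Qed.

Lemma normc_conj z : normc (z^*)%C = normc z.
Proof. by case: z => a b /=; rewrite sqrrN. Qed.

Lemma normc_ge0 z : 0 <= normc z.
Proof. by case: z => a b; exact: sqrtr_ge0. Qed.

Lemma normc_eq0 z : (normc z == 0) = (z == 0).
Proof. by apply/eqP/eqP => [/eq0_normc|->] //; exact: normc0. Qed.

Lemma Re_le_normc z : `|complex.Re z| <= normc z.
Proof. by have := normc_ge_Re z; rewrite complex_normE lecR. Qed.

Lemma Im_le_normc z : `|complex.Im z| <= normc z.
Proof.
by case: z => a b /=; rewrite -sqrtr_sqr ler_wsqrtr// lerDr sqr_ge0.
Qed.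

Lemma normc_le_ReIm z : normc z <= `|complex.Re z| + `|complex.Im z|.
Proof.
case: z => a b /=; rewrite -[leRHS]ger0_norm ?addr_ge0// -sqrtr_sqr.
rewrite ler_wsqrtr// sqrrD !real_normK ?num_real// addrAC lerDl.
by rewrite mulrn_wge0// mulr_ge0.
Qed.

(** The norm of [R[i]] has values in [R[i]], where order is partial. A positive element is real, so
    real tolerances e are enough. *)
Lemma cvg_complexP {T : Type} (F : set_system T) {FF : Filter F}
    (f : T -> R[i]^o) (l : R[i]^o) :
  f @ F --> l <-> forall e : R, 0 < e -> \forall t \near F, normc (l - f t) < e.
Proof.
split=> [/cvgrPdist_lt h e e0|h].
  have /h : 0 < e%:C%C :> R[i] by rewrite ltcR.
  by apply: filterS => t; rewrite complex_normE ltcR.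
apply/cvgrPdist_lt => e e0.
have eE : e = (complex.Re e)%:C%C by rewrite RRe_real ?gtr0_real.
have /h : 0 < complex.Re e by rewrite -ltcR -eE.
by apply: filterS => t; rewrite complex_normE {2}eE ltcR.
Qed.

Lemma cvg_ReIm {T : Type} (F : set_system T) {FF : Filter F}
    (f : T -> R[i]^o) (l : R[i]^o) :
  f @ F --> l <-> (complex.Re (f t) @[t --> F] --> complex.Re l) /\
                  (complex.Im (f t) @[t --> F] --> complex.Im l).
Proof.
rewrite cvg_complexP; split=> [h|[/cvgrPdist_lt h1 /cvgrPdist_lt h2] e e0].
  split; apply/cvgrPdist_lt => e e0; apply: filterS (h e e0) => t;
  apply: le_lt_trans; rewrite -raddfB; [exact: Re_le_normc|exact: Im_le_normc].
have e2 : 0 < e / 2 by rewrite divr_gt0.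
near=> t; apply: le_lt_trans (normc_le_ReIm _) _.
rewrite !raddfB [ltRHS]splitr ltrD//; near: t; [exact: h1|exact: h2].
Unshelve. all: by end_near. Qed.

Lemma cvg_conjc {T : Type} (F : set_system T) {FF : Filter F}
    (f : T -> R[i]^o) (l : R[i]^o) :
  f @ F --> l -> (f t)^*%C @[t --> F] --> (l^*%C : R[i]^o).
Proof.
move=> /cvg_complexP h; apply/cvg_complexP => e /h; apply: filterS => t.
by rewrite -rmorphB normc_conj.
Qed.

Lemma cvg_real_complex {T : Type} (F : set_system T) {FF : Filter F}
    (f : T -> R) (l : R) :
  f @ F --> l -> (f t)%:C%C @[t --> F] --> (l%:C%C : R[i]^o).
Proof.
move=> /cvgrPdist_lt h; apply/cvg_complexP => e /h; apply: filterS => t.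
by rewrite -rmorphB normc_real.
Qed.

End ComplexTopology.

(** * Shear matrices and the rotation that exchanges two blocks *)

Section Shears.
Variables (S : nzRingType) (n : nat).
Implicit Types a : S.

(** Rotations are assembled from shears because the inverse of a shear is the shear by - a: the
    resulting path is polynomial in the parameter and invertible over any ring, without sines and
    cosines. *)
Definition upper_shear a : 'M[S]_(n + n) := block_mx 1%:M a%:M 0 1%:M.
Definition lower_shear a : 'M[S]_(n + n) := block_mx 1%:M 0 a%:M 1%:M.

Lemma upper_shearN a : upper_shear a *m upper_shear (- a) = 1%:M.
Proof.
rewrite /upper_shear mulmx_block !mulmx0 !mul0mx !mulmx1 !mul1mx !addr0 add0r.
by rewrite -raddfD addNr raddf0 -scalar_mx_block.
Qed.

Lemma lower_shearN a : lower_shear a *m lower_shear (- a) = 1%:M.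
Proof.
rewrite /lower_shear mulmx_block !mulmx0 !mul0mx !mulmx1 !mul1mx !addr0 !add0r.
by rewrite -raddfD subrr raddf0 -scalar_mx_block.
Qed.

Lemma shear0 : upper_shear 0 = 1%:M /\ lower_shear 0 = 1%:M.
Proof. by rewrite /upper_shear /lower_shear raddf0 -scalar_mx_block. Qed.

(* rotation_mx 1 is [[0, 1], [-1, 0]]; rotation_mx joins it to the identity. *)
Definition rotation_mx a : 'M[S]_(n + n) :=
  upper_shear a *m lower_shear (- a) *m upper_shear a.

Lemma rotation_mxN a : rotation_mx a *m rotation_mx (- a) = 1%:M.
Proof.
rewrite /rotation_mx !mulmxA -(mulmxA _ (upper_shear a)) upper_shearN mulmx1.
by rewrite -(mulmxA _ (lower_shear (- a))) lower_shearN mulmx1 upper_shearN.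
Qed.

Lemma rotation_mxNV a : rotation_mx (- a) *m rotation_mx a = 1%:M.
Proof. by rewrite -{2}[a]opprK rotation_mxN. Qed.

Lemma rotation_mx0 : rotation_mx 0 = 1%:M.
Proof.
by have [h1 h2] := shear0; rewrite /rotation_mx oppr0 h1 h2 !mul1mx.
Qed.

Lemma rotation_mx1 (v : 'M[S]_n) :
  rotation_mx 1 *m block_mx v 0 0 1%:M *m rotation_mx (- 1) =
  block_mx 1%:M 0 0 v.
Proof.
rewrite /rotation_mx /upper_shear /lower_shear opprK !mulmx_block.
have -> : (- 1)%:M = - 1%:M :> 'M[S]_n by rewrite raddfN.
rewrite ?(mulmx0, mul0mx, mulmx1, mul1mx, addr0, add0r, mulNmx, mulmxN, opprK).
rewrite ?(subrr, addNr, mulmx0, mul0mx, addr0, add0r, oppr0, mulNmx).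
rewrite ?(subrr, addNr, mulmx0, mul0mx, addr0, add0r, oppr0, mulNmx, opprK).
by rewrite mulmxN mulmx1 opprK.
Qed.

Lemma conj_mxM m (W W' D D' : 'M[S]_m) : W *m W' = 1%:M -> W' *m W = 1%:M ->
  D *m D' = 1%:M -> (W *m D *m W') *m (W *m D' *m W') = 1%:M.
Proof.
move=> WW' W'W DD'; rewrite -!mulmxA (mulmxA W') W'W mul1mx.
by rewrite (mulmxA D) DD' mul1mx.
Qed.

End Shears.

(** * Commutativity of K_1 *)

Section K1Commutative.
Context {R : realType}.
Variable A : banachAlgType R[i].
Local Notation U := (unitization A).

Let sc (t : R) : U := (0, t%:C%C).

Let sc_cvg (F : set_system R) {FF : Filter F} (f : R -> R) (l : R) :
  f @ F --> l -> sc (f t) @[t --> F] --> sc l.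
Proof.
move=> fl; have h1 : (0 : A) @[_ --> F] --> (0 : A) by exact: cvg_cst.
exact: (cvg_pair h1 (cvg_real_complex fl)).
Qed.

Let scN t : sc (- t) = - sc t.
Proof. by congr pair; [rewrite oppr0|exact: rmorphN]. Qed.

Variable n : nat.

Let upper_shear_cvg (G : set_system R) {FG : Filter G} (f : R -> R) (l : R) :
  f @ G --> l ->
  upper_shear n (sc (f t)) @[t --> G] --> upper_shear n (sc l).
Proof.
move=> fl; apply: mx_cvg => i j; rewrite /upper_shear.
case: (split_ordP i) => i' ->; case: (split_ordP j) => j' ->.
- under eq_cvg do rewrite block_mxEul; rewrite block_mxEul; exact: cvg_cst.
- under eq_cvg do rewrite block_mxEur mxE; rewrite block_mxEur mxE.
  by case: eqP => _; [exact: sc_cvg|exact: (cvg_cst (0 : U))].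
- under eq_cvg do rewrite block_mxEdl; rewrite block_mxEdl; exact: cvg_cst.
- under eq_cvg do rewrite block_mxEdr; rewrite block_mxEdr; exact: cvg_cst.
Qed.

Let lower_shear_cvg (G : set_system R) {FG : Filter G} (f : R -> R) (l : R) :
  f @ G --> l ->
  lower_shear n (sc (f t)) @[t --> G] --> lower_shear n (sc l).
Proof.
move=> fl; apply: mx_cvg => i j; rewrite /lower_shear.
case: (split_ordP i) => i' ->; case: (split_ordP j) => j' ->.
- under eq_cvg do rewrite block_mxEul; rewrite block_mxEul; exact: cvg_cst.
- under eq_cvg do rewrite block_mxEur; rewrite block_mxEur; exact: cvg_cst.
- under eq_cvg do rewrite block_mxEdl mxE; rewrite block_mxEdl mxE.
  by case: eqP => _; [exact: sc_cvg|exact: (cvg_cst (0 : U))].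
- under eq_cvg do rewrite block_mxEdr; rewrite block_mxEdr; exact: cvg_cst.
Qed.

Let rotation_cvg (G : set_system R) {FG : Filter G} (f : R -> R) (l : R) :
  f @ G --> l ->
  rotation_mx n (sc (f t)) @[t --> G] --> rotation_mx n (sc l).
Proof.
move=> fl; rewrite /rotation_mx -scN; under eq_cvg do rewrite -scN.
apply: mulmx_cvg; last exact: upper_shear_cvg.
apply: mulmx_cvg; first exact: upper_shear_cvg.
by apply: lower_shear_cvg; exact: cvgN.
Qed.

Lemma GL_path_swap (v : 'M[U]_n) : GL v ->
  GL_path (block_mx v 0 0 1%:M : 'M[U]_(n + n)) (block_mx 1%:M 0 0 v).
Proof.
move=> gv; set D : 'M[U]_(n + n) := block_mx v 0 0 1%:M.
have [[D' [DD' D'D]] aD] : GL D.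
  by rewrite /D -extmxE; apply: GL_ext => //; exact: leq_addr.
pose W t := rotation_mx n (sc t); pose W' t := rotation_mx n (- sc t).
have WK t : W t *m W' t = 1%:M by exact: rotation_mxN.
have W'K t : W' t *m W t = 1%:M by exact: rotation_mxNV.
exists (fun t => W t *m D *m W' t); split.
- apply: continuous_subspaceT => t; apply: mulmx_cvg.
    apply: mulmx_cvg; last exact: cvg_cst.
    by apply: rotation_cvg; exact: cvg_id.
  rewrite /W' -scN; under eq_cvg do rewrite -scN.
  by apply: rotation_cvg; apply: cvgN; exact: cvg_id.
- move=> t _; split.
    exists (W t *m D' *m W' t).
    split; [exact: (conj_mxM (WK t) (W'K t) DD')|].
    exact: (conj_mxM (WK t) (W'K t) D'D).
  (* [W t] has scalar entries, so it is in general not congruent to 1 modulo A. Its conjugate of [D]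
     is: [D] augments to 1, and the augmentations of [W t] and [W' t] are inverse to each other. *)
  move: (W t) (W' t) (WK t) => w w' ww'.
  by rewrite map_mxM map_mxM aD mulmx1 -map_mxM ww' map_mx1.
- rewrite /W /W'; have -> : sc 0 = 0 by [].
  by rewrite oppr0 rotation_mx0 mul1mx mulmx1.
- exact: rotation_mx1.
Qed.

End K1Commutative.

(** Doubling the size makes room: diag(b, 1) is joined by a path to diag(1, b), which commutes with
    diag(a, 1). *)
Lemma K1_mulC (R : realType) (A : banachAlgType R[i]) (x y : K1 A) :
  (x * y = y * x)%g.
Proof.
move: x y; elim/(@K1_ind R A) => u; elim/(@K1_ind R A) => v.
rewrite [LHS]K1_mulE [RHS]K1_mulE; apply/K1piP.
pose N := maxn (tag u) (tag v); pose M := (N + N)%N.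
have NM : (N <= M)%N by exact: leq_addr.
have uN : (tag u <= N)%N by exact: leq_maxl.
have vN : (tag v <= N)%N by exact: leq_maxr.
have uM := leq_trans uN NM; have vM := leq_trans vN NM.
exists M; split; rewrite /= ?geq_max ?uM ?vM//.
rewrite (GL_mulE uM vM) (GL_mulE vM uM).
rewrite -(extmx_ext _ uN NM) -(extmx_ext _ vN NM).
have := GL_ext uN (GL_mxP u); have := GL_ext vN (GL_mxP v).
move: (extmx N (GL_mx u)) (extmx N (GL_mx v)) => a b gb ga.
have ga' := GL_ext NM ga; have := GL_path_swap gb; rewrite -extmxE -/M => sb.
have := GL_path_mul (GL_path_refl ga') sb.
have -> : extmx M a *m block_mx 1%:M 0 0 b = block_mx 1%:M 0 0 b *m extmx M a.
  by rewrite extmxE !mulmx_block !mulmx0 !mul0mx !mulmx1 !mul1mx !addr0 !add0r.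
move=> p1; have := GL_path_mul (GL_path_sym sb) (GL_path_refl ga').
apply: GL_path_trans p1; apply: GLM ga'.
(* The middle point of the concatenated path must be in [GL]; its factor diag(1, b) is the value at
   1 of the path [sb]. *)
case: sb => gam [_ + _ <-]; apply.
by rewrite in_itv /= ler01 lexx.
Qed.

(** * The map induced on K_1 *)

Section K1Star.
Context {R : realType}.
Variables (A B : banachAlgType R[i]) (theta : A -> B).
Hypotheses (thetaD : {morph theta : x y / x + y})
  (thetaZ : forall (c : R[i]) x, theta (c *: x) = (c^*)%C *: theta x)
  (thetaM : forall x y, theta (bmul x y) = bmul (theta y) (theta x))
  (theta_continuous : continuous theta).

Local Notation s := (@star_unitization R A B theta).

Lemma GL_star n (u : 'M[unitization A]_n) : GL u -> GL (star_mx theta u).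
Proof.
have sD := star_unitizationD thetaD; have s1 := star_unitization1 thetaD.
have sM := star_unitizationM thetaD thetaZ thetaM.
move=> [[v [uv vu]] au]; split.
  exists (star_mx theta v); split.
    by rewrite -[LHS](anti_mxM sD sM) vu (anti_mx1 sD).
  by rewrite -[LHS](anti_mxM sD sM) uv (anti_mx1 sD).
apply/matrixP => i j; rewrite !mxE /augmentation /star_unitization /=.
have /matrixP/(_ j i) := au; rewrite !mxE /augmentation eq_sym => ->.
by case: (i == j); rewrite ?conjc1 ?conjc0.
Qed.

Lemma star_mx_cvg (T : Type) (F : set_system T) {FF : Filter F} n
    (f : T -> 'M[unitization A]_n) (l : 'M[unitization A]_n) :
  f @ F --> l -> star_mx theta (f t) @[t --> F] --> star_mx theta l.
Proof.
move=> fl; apply: mx_cvg => i j; under eq_cvg do rewrite !mxE.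
rewrite !mxE; have h := mx_cvg_coord (FF := FF) (i := j) (j := i) fl.
have h1 : (f x j i).1 @[x --> F] --> (l j i).1.
  exact: (cvg_comp _ _ h (@cvg_fst _ _ _ _ _)).
have h2 : (f x j i).2 @[x --> F] --> (l j i).2.
  exact: (cvg_comp _ _ h (@cvg_snd _ _ _ _ _)).
have h3 : theta (f x j i).1 @[x --> F] --> theta (l j i).1.
  exact: (cvg_comp _ _ h1 (@theta_continuous _)).
exact: (cvg_pair h3 (cvg_conjc h2)).
Qed.

Lemma GL_path_star n (u v : 'M[unitization A]_n) :
  GL_path u v -> GL_path (star_mx theta u) (star_mx theta v).
Proof.
move=> [f [/subspace_continuousP cf gf <- <-]].
exists (fun t => star_mx theta (f t)); split => //.
  by apply/subspace_continuousP => x /cf; exact: star_mx_cvg.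
by move=> t /gf; exact: GL_star.
Qed.

Lemma extmx_star N n (u : 'M[unitization A]_n) :
  extmx N (star_mx theta u) = star_mx theta (extmx N u).
Proof.
have t0 : theta 0 = 0 by apply: (addrI (theta 0)); rewrite -thetaD !addr0.
apply/matrixP => i j; rewrite !mxE (eq_sym i).
case: insubP => [i' _ _|_]; case: insubP => [j' _ _|_]; rewrite ?mxE //;
  by case: (j == i); rewrite /star_unitization /= t0 oppr0.
Qed.

Definition star_GL (u : GLelt A) : GLelt B := mk_GL (GL_star (GL_mxP u)).

Definition K1star (x : K1 A) : K1 B := K1pi (star_GL (repr x)).

Lemma GL_equiv_star m n (u : 'M[unitization A]_m) (v : 'M[unitization A]_n) :
  GL_equiv u v -> GL_equiv (star_mx theta u) (star_mx theta v).
Proof.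
move=> [N [mN nN p]]; exists N; split => //.
by rewrite !extmx_star; exact: GL_path_star.
Qed.

Lemma K1starE (u : GLelt A) : K1star (K1pi u) = K1pi (star_GL u).
Proof. by apply/K1piP/GL_equiv_star/K1piP; exact: K1pi_reprK. Qed.

Lemma K1classE (C : banachAlgType R[i]) n (u : 'M[unitization C]_n)
  (gu : GL u) : K1class u = K1pi (mk_GL gu).
Proof.
rewrite /K1class insubT; first exact: asboolT.
by move=> ?; congr K1pi; rewrite /mk_GL; congr existT; exact: val_inj.
Qed.

Lemma K1star_class n (u : 'M[unitization A]_n) : GL u ->
  K1star (K1class u) = K1class (star_mx theta u).
Proof.
move=> gu; rewrite (K1classE gu) (K1classE (GL_star gu)) K1starE.
apply/K1piP; exists n; split => //; apply: GL_path_refl; apply: GL_ext => //.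
exact: GL_star.
Qed.

(** [star_mx] exchanges the factors of a product of matrices, and [K1_mulC] puts them back in
    order. *)
Lemma K1starM : {morph K1star : x y / (x * y)%g}.
Proof.
elim/(@K1_ind R A) => u; elim/(@K1_ind R A) => v; rewrite [RHS]K1_mulC.
rewrite [X in K1star X]K1_mulE !K1starE [RHS]K1_mulE; apply/K1piP.
pose N := maxn (tag u) (tag v).
have uN : (tag u <= N)%N by exact: leq_maxl.
have vN : (tag v <= N)%N by exact: leq_maxr.
apply: (@GL_equivW _ _ _ _ N); first exact: GL_mxP.
- by rewrite /= geq_max uN.
- by rewrite /= geq_max uN vN.
rewrite [RHS](GL_mulE (u := star_GL v) (v := star_GL u) vN uN).
rewrite [LHS]extmx_star (GL_mulE uN vN).
rewrite [LHS](anti_mxM (star_unitizationD thetaD) (star_unitizationM thetaD thetaZ thetaM)).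
by congr (_ *m _); symmetry; exact: extmx_star.
Qed.

End K1Star.

Section K1Isomorphism.
Context {R : realType}.
Variables (A B : banachAlgType R[i]) (theta : A -> B) (theta' : B -> A).
Hypotheses (thetaD : {morph theta : x y / x + y})
  (thetaZ : forall (c : R[i]) x, theta (c *: x) = (c^*)%C *: theta x)
  (thetaM : forall x y, theta (bmul x y) = bmul (theta y) (theta x))
  (theta_continuous : continuous theta).
Hypotheses (theta'D : {morph theta' : x y / x + y})
  (theta'Z : forall (c : R[i]) x, theta' (c *: x) = (c^*)%C *: theta' x)
  (theta'M : forall x y, theta' (bmul x y) = bmul (theta' y) (theta' x))
  (theta'_continuous : continuous theta').
Hypotheses (thetaK : cancel theta theta') (theta'K : cancel theta' theta).

Lemma star_induces_K1 : induces_K1_isomorphism theta.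
Proof.
pose f := K1star thetaD thetaZ thetaM; pose g := K1star theta'D theta'Z theta'M.
have starK (u : GLelt A) : star_mx theta' (star_mx theta (GL_mx u)) = GL_mx u.
  apply/matrixP => i j; rewrite !mxE /star_unitization /= thetaK conjcK.
  by case: (GL_mx u i j).
have star'K (u : GLelt B) : star_mx theta (star_mx theta' (GL_mx u)) = GL_mx u.
  apply/matrixP => i j; rewrite !mxE /star_unitization /= theta'K conjcK.
  by case: (GL_mx u i j).
exists f; split.
- exists g.
    elim/(@K1_ind R A) => u; rewrite /f /g (K1starE thetaD thetaZ thetaM)//.
    rewrite (K1starE theta'D theta'Z theta'M)//; apply/K1piP.
    rewrite [X in GL_equiv X]starK; exists (tag u); split => //.
    by apply: GL_path_refl; apply: GL_ext => //; exact: (GL_mxP u).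
  elim/(@K1_ind R B) => u; rewrite /f /g (K1starE theta'D theta'Z theta'M)//.
  rewrite (K1starE thetaD thetaZ thetaM)//; apply/K1piP.
  rewrite [X in GL_equiv X]star'K; exists (tag u); split => //.
  by apply: GL_path_refl; apply: GL_ext => //; exact: (GL_mxP u).
- exact: K1starM.
- by move=> n u gu; split; [exact: GL_star|exact: K1star_class].
Qed.

End K1Isomorphism.

(** * Borel sets and integration on locally compact groups *)

Section FiniteSupportFubini.
Context {d1 d2 : measure_display} {T1 : measurableType d1}
  {T2 : measurableType d2} {R : realType}.
Local Open Scope ereal_scope.

Lemma integral_restr d (T : measurableType d) (m : {measure set T -> \bar R})
    (K : set T) (f : T -> \bar R) : (forall x, ~ K x -> f x = 0) ->
  \int[m]_x f x = \int[m]_(x in K) f x.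
Proof.
move=> fK; rewrite [RHS]integral_mkcond; apply: eq_integral => x _.
by rewrite patchE; case: ifPn => // /negP; rewrite inE => /fK.
Qed.

Lemma integral_mrestr d (T : measurableType d) (m : {measure set T -> \bar R})
    (K : set T) (mK : measurable K) (f : T -> \bar R) :
  (forall x, ~ K x -> f x = 0) -> \int[mrestr m mK]_x f x = \int[m]_x f x.
Proof.
move=> fK; rewrite (integral_restr m fK).
rewrite (integral_restr (mrestr m mK) fK).
by apply: eq_measure_integral => A mA AK; rewrite /= /mrestr setIidl.
Qed.

Lemma mrestr_fin_num d (T : measurableType d) (m : {measure set T -> \bar R})
    (K : set T) (mK : measurable K) : m K < +oo ->
  fin_num_fun (mrestr m mK : set T -> \bar R).
Proof.
move=> mKoo A mA; rewrite ge0_fin_numE//; apply: le_lt_trans mKoo.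
by rewrite /mrestr; apply: le_measure => //; rewrite ?inE//; exact: measurableI.
Qed.

Variables (m1 : {measure set T1 -> \bar R}) (m2 : {measure set T2 -> \bar R}).
Variables (K1 : set T1) (K2 : set T2).
Hypotheses (mK1 : measurable K1) (mK2 : measurable K2).
Hypotheses (K1oo : m1 K1 < +oo) (K2oo : m2 K2 < +oo).

(** Cutting the measures down to [K1] and [K2] makes them finite, so that Fubini applies; iterated
    integrals of a function vanishing off the rectangle do not see the cut. *)
Let n1 : {finite_measure set T1 -> \bar R} :=
  HB.pack (mrestr m1 mK1)
    (Measure_isFinite.Build _ _ _ (mrestr m1 mK1) (mrestr_fin_num mK1 K1oo)).
Let n2 : {finite_measure set T2 -> \bar R} :=
  HB.pack (mrestr m2 mK2)
    (Measure_isFinite.Build _ _ _ (mrestr m2 mK2) (mrestr_fin_num mK2 K2oo)).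

Variable f : T1 * T2 -> \bar R.
Hypothesis mf : measurable_fun setT f.
Hypothesis f_supp : forall x y, ~ (K1 x /\ K2 y) -> f (x, y) = 0.

Let E12 (h : T1 * T2 -> \bar R) : (forall x y, ~ (K1 x /\ K2 y) -> h (x, y) = 0) ->
  \int[n1]_x \int[n2]_y h (x, y) = \int[m1]_x \int[m2]_y h (x, y).
Proof.
move=> hK; have e x : \int[n2]_y h (x, y) = \int[m2]_y h (x, y).
  by apply: integral_mrestr => y nK; apply: hK => -[].
transitivity (\int[n1]_x \int[m2]_y h (x, y)).
  by apply: eq_integral => x _; exact: e.
apply: integral_mrestr => x nK.
by rewrite integral0_eq// => y _; apply: hK => -[].
Qed.

Let E21 (h : T1 * T2 -> \bar R) : (forall x y, ~ (K1 x /\ K2 y) -> h (x, y) = 0) ->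
  \int[n2]_y \int[n1]_x h (x, y) = \int[m2]_y \int[m1]_x h (x, y).
Proof.
move=> hK; have e y : \int[n1]_x h (x, y) = \int[m1]_x h (x, y).
  by apply: integral_mrestr => x nK; apply: hK => -[].
transitivity (\int[n2]_y \int[m1]_x h (x, y)).
  by apply: eq_integral => y _; exact: e.
apply: integral_mrestr => y nK.
by rewrite integral0_eq// => x _; apply: hK => -[].
Qed.

Lemma finite_support_tonelli : (forall z, 0 <= f z) ->
  \int[m1]_x \int[m2]_y f (x, y) = \int[m2]_y \int[m1]_x f (x, y).
Proof. by move=> f0; rewrite -E12// -E21// fubini_tonelli. Qed.

Lemma finite_support_measurable : (forall z, 0 <= f z) ->
  measurable_fun setT (fun x => \int[m2]_y f (x, y)).
Proof.
move=> f0; have := measurable_fun_fubini_tonelli_F (m2 := n2) f mf f0.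
congr measurable_fun; apply/funext => x.
by apply: integral_mrestr => y nK; apply: f_supp => -[].
Qed.

Lemma finite_support_fubini : \int[m1]_x \int[m2]_y `|f (x, y)| < +oo ->
  \int[m1]_x \int[m2]_y f (x, y) = \int[m2]_y \int[m1]_x f (x, y).
Proof.
move=> foo; rewrite -E12// -E21//; apply: Fubini.
apply/integrable12ltyP => //; rewrite (E12 (h := fun z => `|f z|))//.
by move=> x y /f_supp ->; rewrite abse0.
Qed.

End FiniteSupportFubini.

(** * Borel sets of the group and product measurability *)

Section BorelGroup.
Context {R : realType} {G : topGroupType}.
Hypothesis lcG : locally_compact_group G.

Let hG : hausdorff_space G. Proof. by case: lcG. Qed.

Lemma open_borel (U : set G) : open U -> measurable (U : set (borel G)).
Proof. by move=> oU; exact: sub_sigma_algebra. Qed.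

Lemma closed_borel (C : set G) : closed C -> measurable (C : set (borel G)).
Proof.
move=> cC; rewrite -[C]setCK; apply: measurableC.
by apply: open_borel; exact: closed_openC.
Qed.

Lemma compact_borel (K : set G) : compact K -> measurable (K : set (borel G)).
Proof. by move=> cK; apply: closed_borel; exact: compact_closed. Qed.

Lemma continuous_borel (f : G -> R) : continuous f ->
  measurable_fun [set: borel G] (f : borel G -> R).
Proof.
move=> /continuousP cf; apply: (measurability _ (RGenOpens.measurableE R)).
move=> _ [_ [a [b ->] <-]]; rewrite setTI.
by apply: open_borel; apply: cf; exact: interval_open.
Qed.

Lemma continuous_borel_map (f : G -> G) : continuous f ->
  measurable_fun [set: borel G] (f : borel G -> borel G).
Proof.
move=> /continuousP cf; apply: (@measurability _ _ (borel G) (borel G) setT f (@open G)) => //.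
by move=> _ [A oA <-]; rewrite setTI; apply: open_borel; exact: cf.
Qed.

Lemma lcompact_nbhs (x : G) : exists2 K : set G, compact K & nbhs x K.
Proof.
case: lcG => _ /(_ x Logic.I) [U xU [cU _]]; exists U => //.
have {}xU : nbhs x [set y | [set: G] y -> U y] := xU.
by apply: filterS xU => y; apply.
Qed.

(** Finitely many open rectangles inside O cover C, and their union lies in the product
    sigma-algebra even when O does not. *)
Lemma compact_open_borel_rectangles (C O : set (G * G)) :
  compact C -> open O -> C `<=` O ->
  exists W : set (borel G * borel G), [/\ measurable W, C `<=` W & W `<=` O].
Proof.
move=> cC oO CO.
pose good := [set W : set (borel G * borel G) | measurable W /\ W `<=` O].
(* Finite subcovers are replaced by a near-covering: along [F] a set eventually contains any given
   good set, and [F] is a filter because good sets are stable under unions. The same device serves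
   in [compact_neighborhood] and [haar_open_gt0]. *)
pose F := filter_from good (fun W => [set W' : set (G * G) | W `<=` W']).
have FF : Filter F.
  apply: filter_from_filter; first by exists set0; split => //; exact: sub0set.
  move=> W1 W2 [mW1 W1O] [mW2 W2O]; exists (W1 `|` W2).
    by split; [exact: measurableU|move=> z []; [exact: W1O|exact: W2O]].
  by move=> W' W'W; split => z ?; apply: W'W; [left|right].
have [] := (compact_near_coveringP _).1 cC _ F (fun W z => W z) FF.
  move=> [x y] /CO Oxy; have /= : nbhs (x, y) O by exact: open_nbhs_nbhs.
  move=> [[A B] [/= + +] ABO].
  rewrite !nbhsE => -[A' [oA' A'x] A'A] [B' [oB' B'y] B'B].
  exists (A' `*` B', [set W' | A' `*` B' `<=` W']).
    split => /=; first by exists (A', B') => //; split; exact: open_nbhs_nbhs.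
    exists (A' `*` B') => //; split.
      by apply: measurableX; exact: open_borel.
    by apply: subset_trans ABO => -[a b] [/A'A ? /B'B ?].
  by move=> [z W'] /= [A'B'z]; apply.
by move=> W [mW WO] /(_ W (@subset_refl _ W)) CW; exists W.
Qed.

(* The Borel sigma-algebra of [G * G] may be strictly finer than the product
   one; on compact rectangles continuous functions are measurable for the
   latter. *)
Lemma continuous_prod_measurable (F : G * G -> R) (K L : set G) :
  continuous F -> compact K -> compact L ->
  measurable_fun (K `*` L : set (borel G * borel G))
    (F : borel G * borel G -> R).
Proof.
move=> cF cK cL; have cKL := compact_setX cK cL.
have mKL : measurable (K `*` L : set (borel G * borel G)).
  by apply: measurableX; exact: compact_borel.
have oF r : open [set z | r < F z].
  move/continuousP : cF => /(_ [set y | r < y]); apply; exact: open_gt.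
have cFn r : closed [set z | r <= F z].
  by move/continuous_closedP : cF => /(_ [set y | r <= y]); apply; exact: closed_ge.
(* A compact part of the superlevel set, with margin 1/(n+1), is separated from the complement of
   the open set r < F by a product measurable set. On the rectangle, the union of these sets over n
   is exactly the set r < F. *)
have W (r : R) (n : nat) : exists W : set (borel G * borel G), [/\ measurable W,
    (K `*` L) `&` [set z | r + n.+1%:R^-1 <= F z] `<=` W &
    W `<=` [set z | r < F z]].
  apply: compact_open_borel_rectangles => //.
    by apply: compact_closedI.
  by move=> z [_ /=]; apply: lt_le_trans; rewrite ltrDl invr_gt0.
apply: (measurability _ (RGenOInfty.measurableE R)) => _ [_ [r ->] <-].
have /choice[V hV] := W r.
rewrite (_ : _ `&` _ = (K `*` L) `&` \bigcup_n V n).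
  by apply: measurableI => //; apply: bigcupT_measurable => n; have [] := hV n.
apply/seteqP; split => z [KLz /=]; rewrite ?in_itv /= ?andbT => h; split => //.
  have [n hn] := ltr_add_invr h; exists n => //; have [_ + _] := hV n; apply.
  by split => //=; exact: ltW.
by case: h => n _ Vz; have [_ _] := hV n; apply.
Qed.

Lemma continuous_supp_prod_measurable (F : G * G -> R) (K L : set G) :
  continuous F -> compact K -> compact L ->
  (forall x y, ~ (K x /\ L y) -> F (x, y) = 0) ->
  measurable_fun [set: borel G * borel G] (F : borel G * borel G -> R).
Proof.
move=> cF cK cL FKL.
have mKL : measurable (K `*` L : set (borel G * borel G)).
  by apply: measurableX; exact: compact_borel.
have := continuous_prod_measurable cF cK cL.
move/(measurable_restrictT _ mKL); congr measurable_fun.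
apply/funext => -[x y]; rewrite patchE; case: ifPn => // /negP.
by rewrite inE => nKL; rewrite FKL.
Qed.

End BorelGroup.

(* Restated so that the operations appear in the form in which they elaborate
   on a [topGroupType]; the library versions do not match syntactically. *)
Section TopGroupLaws.
Context {G : topGroupType}.
Implicit Types x y z : G.

Lemma tmulgA x y z : (x * (y * z) = x * y * z)%g.
Proof. exact: mulgA. Qed.

Lemma tinvgM x y : ((x * y)^-1 = y^-1 * x^-1)%g.
Proof. exact: invgM. Qed.

Lemma tmulg1 x : (x * 1 = x)%g.
Proof. exact: mulg1. Qed.

End TopGroupLaws.

(** * Urysohn functions and compact sets in a locally compact group *)

Section LocallyCompactGroup.
Context {R : realType} {G : topGroupType}.
Hypothesis lcG : locally_compact_group G.
Local Open Scope group_scope.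
Local Open Scope ring_scope.

Let hG : hausdorff_space G. Proof. by case: lcG. Qed.

Lemma compact_neighborhood (K : set G) : compact K ->
  exists2 L : set G, compact L & forall x, K x -> nbhs x L.
Proof.
move=> cK.
pose F := filter_from [set L : set G | compact L] (fun L => [set L' | L `<=` L']).
have FF : Filter F.
  apply: filter_from_filter; first by exists set0; exact: compact0.
  move=> W1 W2 cW1 cW2; exists (W1 `|` W2); first exact: compactU.
  by move=> W' W'W; split => z ?; apply: W'W; [left|right].
have [] := (compact_near_coveringP _).1 cK _ F (fun L x => nbhs x L) FF.
  move=> x Kx; have [C cC xC] := lcompact_nbhs lcG x.
  exists (interior C, [set L' | C `<=` L']).
    by split => /=; [exact: nbhs_interior|exists C].
  by move=> [z L'] /= [zC CL']; exact: filterS CL' zC.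
by move=> W cW /(_ W (@subset_refl _ W)) CW; exists W.
Qed.

(** The separation takes place in the one-point compactification, which is compact Hausdorff and
    hence normal, whether or not G itself is normal. *)
Lemma urysohn_compact (K U : set G) : compact K -> open U -> K `<=` U ->
  exists phi : G -> R, [/\ continuous phi, forall x, 0 <= phi x <= 1,
    forall x, K x -> phi x = 1, forall x, ~ U x -> phi x = 0 &
    exists2 L : set G, compact L & forall x, phi x != 0 -> L x].
Proof.
move=> cK oU KU; have [L cL KL] := compact_neighborhood cK.
pose opc := one_point_compactification G.
have hO : hausdorff_space opc.
  by apply: one_point_compactification_hausdorff => //; case: lcG.
have nO : normal_space opc.
  by apply: compact_normal => //; exact: one_point_compactification_compact.
(* Intersecting with the interior of the compact neighbourhood L forces the function to vanish off L
   as well as off U. *)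
pose V := U `&` interior L.
have oV : open (Some @` V : set opc).
  apply: one_point_compactification_open_some; apply: openI => //.
  exact: open_interior.
have cKO : closed (Some @` K : set opc).
  apply: compact_closed => //; apply: continuous_compact => //.
  apply: continuous_subspaceT.
  exact: one_point_compactification_some_continuous.
pose B0 : set opc := ~` (Some @` V); pose B1 : set opc := Some @` K.
have B01 : uniform_separator B0 B1.
  apply: ((normal_separatorP (R := R) (T := opc)).1 nO) => //.
    exact: open_closedC.
  apply/seteqP; split => // x [nV [y Ky yx]]; apply: nV; exists y => //.
  by split; [exact: KU|exact: KL].
have [f [cf f01 fV fK]] := (uniform_separatorP (R := R) B0 B1).1 B01.
exists (fun x => f (Some x)); split.
- move=> x; apply: (@continuous_comp G opc R Some f x); last exact: cf.
  exact: one_point_compactification_some_continuous.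
- move=> x; have : `[0, 1]%classic (f (Some x)) by apply: f01; exists (Some x).
  by rewrite /= in_itv.
- by move=> x Kx; apply: fK; exists (Some x) => //; exists x.
- move=> x nUx; apply: fV; exists (Some x) => //.
  by move=> [y [Uy _] [yx]]; apply: nUx; rewrite -yx.
- exists L => // x; apply: contra_neqP => nLx; apply: fV; exists (Some x) => //.
  by move=> [y [_ /interior_subset Ly] [yx]]; apply: nLx; rewrite -yx.
Qed.

Lemma compact_image (f : G -> G) (K : set G) : continuous f -> compact K ->
  compact (f @` K).
Proof. by move=> cf; apply: continuous_compact; exact: continuous_subspaceT. Qed.

Definition setmulg (A B : set G) : set G := [set (a * b)%g | a in A & b in B].

Lemma compact_setmulg (A B : set G) : compact A -> compact B ->
  compact (setmulg A B).
Proof.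
move=> cA cB; have -> : setmulg A B = (fun xy : G * G => (xy.1 * xy.2)%g) @` (A `*` B).
  apply/seteqP; split => [_ [a Aa [b Bb <-]]|_ [[a b] [/= Aa Bb] <-]].
    by exists (a, b).
  by exists a => //; exists b.
apply: continuous_compact; last exact: compact_setX.
by apply: continuous_subspaceT; exact: mulg_continuous.
Qed.

Lemma compact_invg (A : set G) : compact A -> compact [set x : G | A x^-1%g].
Proof.
move=> cA; have -> : [set x : G | A x^-1%g] = (fun x => x^-1%g) @` A.
  apply/seteqP; split => [x Ax|_ [x Ax <-]] /=; last by rewrite invgK.
  by exists x^-1%g => //; rewrite invgK.
by apply: compact_image => //; exact: invg_continuous.
Qed.

Lemma continuous_mulg2 (T : topologicalType) (f g : T -> G) :
  continuous f -> continuous g -> continuous (fun x => f x * g x)%g.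
Proof.
move=> cf cg x; have fg : (f y, g y) @[y --> x] --> (f x, g x).
  by apply: cvg_pair; [exact: cf|exact: cg].
exact: (cvg_comp _ _ fg (@mulg_continuous G (f x, g x))).
Qed.

Lemma continuous_invg2 (T : topologicalType) (f : T -> G) :
  continuous f -> continuous (fun x => (f x)^-1)%g.
Proof.
by move=> cf x; exact: (cvg_comp _ _ (cf x) (@invg_continuous G (f x))).
Qed.

Lemma continuous_mulgl (g : G) : continuous (fun x : G => g * x)%g.
Proof. by apply: continuous_mulg2 => x; [exact: cvg_cst|exact: cvg_id]. Qed.

Lemma continuous_mulgr (g : G) : continuous (fun x : G => x * g)%g.
Proof. by apply: continuous_mulg2 => x; [exact: cvg_id|exact: cvg_cst]. Qed.

(** A tube argument: compactness of L makes continuity at x0 uniform in the second variable. *)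
Lemma near_uniform (F : G * G -> R) (L : set G) (x0 : G) (e : R) :
  continuous F -> compact L -> 0 < e ->
  \forall x \near x0, forall z, L z -> `|F (x0, z) - F (x, z)| < e.
Proof.
move=> cF /compact_near_coveringP cL e0.
apply: (cL G (nbhs x0) (fun x z => `|F (x0, z) - F (x, z)| < e)) => z Lz.
have e2 : 0 < e / 2 by rewrite divr_gt0.
have /cvgrPdist_lt/(_ _ e2) [[A B] /= [Ax Bz] AB] := cF (x0, z).
exists (B, A) => //= -[z' x'] [/= Bz' Ax'].
have h1 := AB (x', z') (conj Ax' Bz').
have h2 := AB (x0, z') (conj (nbhs_singleton Ax) Bz').
by rewrite (@distm_lt_split _ _ (F (x0, z)))// distrC.
Qed.

Lemma continuous_compact_bounded (f : G -> R) (K : set G) : continuous f -> compact K ->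
  exists2 M : R, 0 < M & forall x, K x -> `|f x| <= M.
Proof.
move=> cf cK; have [] := compact_bounded (continuous_compact (continuous_subspaceT cf) cK).
move=> M [_ h]; exists (Num.max 1 (M + 1)); first by rewrite lt_max ltr01.
move=> x Kx; apply: h; last by exists x.
by rewrite lt_max ltrDl ltr01 orbT.
Qed.

End LocallyCompactGroup.

(** * Uniqueness of Haar measure *)

Section InvariantMeasures.
Context {R : realType} {G : topGroupType}.
Hypothesis lcG : locally_compact_group G.

Definition Cc_nonneg (phi : G -> R) : Prop :=
  [/\ continuous phi, forall x, 0 <= phi x &
      exists2 K : set G, compact K & forall x, phi x != 0 -> K x].

Definition left_invariant (nu : {measure set (borel G) -> \bar R}) : Prop :=
  forall (g : G) (A : set (borel G)), measurable A ->
    nu [set x : G | A (g^-1 * x)%g] = nu A.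

Definition compact_finite (nu : {measure set (borel G) -> \bar R}) : Prop :=
  forall K : set G, compact K -> (nu K < +oo)%E.

Local Notation intg nu phi := (\int[nu]_x (phi x)%:E)%E.

Lemma ge0_integral_left_invariant (nu : {measure set (borel G) -> \bar R})
    (g : G) (f : borel G -> \bar R) : left_invariant nu ->
  measurable_fun setT f -> (forall x, 0 <= f x)%E ->
  (\int[nu]_x f (g * x)%g = \int[nu]_x f x)%E.
Proof.
move=> linu mf f0; pose h : borel G -> borel G := fun x : G => (g * x)%g.
have mh : measurable_fun setT h.
  by apply: continuous_borel_map; exact: continuous_mulgl.
have := ge0_integral_pushforward mh nu measurableT mf (fun x _ => f0 x).
rewrite preimage_setT => <-; apply: eq_measure_integral => A mA _.
rewrite -[RHS](linu (g^-1)%g A mA) /= /pushforward; congr (nu _).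
by apply/seteqP; split => x /=; rewrite /h invgK.
Qed.

Lemma continuous_tonelli (m n : {measure set (borel G) -> \bar R})
    (F : G * G -> R) (K L : set G) : compact_finite m -> compact_finite n ->
  continuous F -> (forall z, 0 <= F z) -> compact K -> compact L ->
  (forall x y, F (x, y) != 0 -> K x /\ L y) ->
  (\int[m]_x \int[n]_y (F (x, y))%:E = \int[n]_y \int[m]_x (F (x, y))%:E)%E.
Proof.
move=> mfin nfin cF F0 cK cL FKL.
have F0' x y : ~ (K x /\ L y) -> F (x, y) = 0.
  by move=> nKL; apply/eqP; apply: contrapT => /negP /FKL.
apply: (@finite_support_tonelli _ _ (borel G) (borel G) R m n K L
  (compact_borel lcG cK) (compact_borel lcG cL) (mfin _ cK) (nfin _ cL)
  (fun z => (F z)%:E)).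
- apply/measurable_EFinP.
  exact: (continuous_supp_prod_measurable lcG cF cK cL).
- by move=> x y /F0' ->.
- by move=> z; rewrite lee_fin.
Qed.

Lemma Cc_nonneg_integral_lty (nu : {measure set (borel G) -> \bar R})
    (phi : G -> R) : compact_finite nu -> Cc_nonneg phi ->
  (intg nu phi < +oo)%E.
Proof.
move=> nfin [cphi phi0 [K cK phiK]].
have [M M0 hM] := continuous_compact_bounded cphi cK.
have mK := compact_borel lcG cK.
rewrite (integral_restr nu (K := K)); last first.
  by move=> x nKx; congr EFin; apply/eqP; apply: contrapT => /negP /phiK.
apply: (@le_lt_trans _ _ (\int[nu]_(x in K) (cst M%:E) x)%E).
  apply: ge0_le_integral => //.
  - by move=> x _; rewrite lee_fin.
  - apply/measurable_EFinP; apply: measurable_funTS.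
    exact: continuous_borel.
  - by move=> x Kx; rewrite lee_fin; apply: le_trans (ler_norm _) (hM x Kx).
by rewrite integral_cst// lte_mul_pinfty// ?lee_fin ?ltW//; exact: nfin.
Qed.

(* Integrate phi x * g (y * x) / D x in both orders, translating in between. *)
Lemma haar_key_identity (mu nu : {measure set (borel G) -> \bar R})
    (phi g D : G -> R) : left_invariant mu -> compact_finite mu ->
  left_invariant nu -> compact_finite nu -> Cc_nonneg phi -> Cc_nonneg g ->
  continuous D -> (forall x, 0 < D x) ->
  (forall x, \int[mu]_t (g (t * x)%g)%:E = (D x)%:E)%E ->
  (intg nu phi =
   intg nu g * \int[mu]_y (phi (y^-1)%g / D (y^-1)%g)%:E)%E.
Proof.
move=> limu fmu linu fnu [cphi phi0 [K cK phiK]] [cg g0 [L cL gL]] cD D0 DE.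
have cDV : continuous (fun x => (D x)^-1).
  by move=> x; apply: cvgV; [rewrite gt_eqF|exact: cD].
pose h (z : G * G) := phi z.1 * g (z.2 * z.1)%g / D z.1.
have ch : continuous h.
  have c1 : continuous (fst : G * G -> G) by move=> z; exact: cvg_fst.
  have c2 : continuous (snd : G * G -> G) by move=> z; exact: cvg_snd.
  have c3 := continuous_mulg2 c2 c1.
  move=> z; apply: cvgM; last exact: (cvg_comp _ _ (c1 z) (cDV _)).
  apply: cvgM; first exact: (cvg_comp _ _ (c1 z) (cphi _)).
  exact: (cvg_comp _ _ (c3 z) (cg _)).
have h0 z : 0 <= h z by rewrite /h divr_ge0 ?mulr_ge0// ltW.
(* This is [h] after x is replaced by y^-1 x, which turns g(y x) into g(x). Replacing y by x y
   afterwards leaves a function of x times a function of y. *)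
pose k (z : G * G) := h (z.2^-1 * z.1, z.2)%g.
have ck : continuous k.
  have c1 : continuous (fst : G * G -> G) by move=> z; exact: cvg_fst.
  have c2 : continuous (snd : G * G -> G) by move=> z; exact: cvg_snd.
  have c3 := continuous_mulg2 (continuous_invg2 c2) c1.
  move=> z; have c4 : ((w.2^-1 * w.1)%g, w.2) @[w --> z] --> ((z.2^-1 * z.1)%g, z.2).
    exact: (cvg_pair (c3 z) (c2 z)).
  exact: (cvg_comp _ _ c4 (ch _)).
(* If x lies in K and y x in L, then y = (y x) x^-1 lies in L K^-1. *)
pose LK := setmulg L [set x | K (x^-1)%g].
have cLK : compact LK by apply: compact_setmulg => //; exact: compact_invg.
have mphi := continuous_borel cphi; have mg := continuous_borel cg.
have mEg : measurable_fun setT (EFin \o (g : borel G -> R)).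
  exact/measurable_EFinP.
transitivity (\int[nu]_x \int[mu]_y (h (x, y))%:E)%E.
  apply: eq_integral => x _; rewrite /h /=.
  under eq_integral => y _ do rewrite mulrAC EFinM.
  rewrite ge0_integralZl//.
  - by rewrite DE -EFinM mulfVK// gt_eqF.
  - apply/measurable_EFinP; apply: continuous_borel.
    by move=> y; exact: (cvg_comp _ _ (continuous_mulgr (g := x) (x := y)) (cg _)).
  - by move=> y _; rewrite lee_fin.
  - by rewrite lee_fin divr_ge0// ltW.
rewrite (continuous_tonelli (K := K) (L := LK))//; last first.
  move=> x y; rewrite /h /= !mulf_eq0 !negb_or => /andP[/andP[/phiK Kx /gL Lyx] _].
  split => //; exists (y * x)%g => //; exists (x^-1)%g; rewrite /= ?invgK//.
  by rewrite mulgK.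
transitivity (\int[mu]_y \int[nu]_x (k (x, y))%:E)%E.
  apply: eq_integral => y _.
  rewrite -[LHS](@ge0_integral_left_invariant _ (y^-1)%g)//.
    apply/measurable_EFinP; apply: continuous_borel => x.
    have c : (w, y) @[w --> x] --> (x, y).
      by apply: cvg_pair; [exact: cvg_id|exact: cvg_cst].
    exact: (cvg_comp _ _ c (ch _)).
  by move=> x; rewrite lee_fin.
rewrite -(continuous_tonelli (F := k) (K := L) (L := LK))//; last 2 first.
- by move=> z; exact: h0.
- move=> x y; rewrite /k /h /= !mulf_eq0 !negb_or mulVKg.
  move=> /andP[/andP[/phiK Kx /gL Lx] _]; split => //; exists x => //.
  by exists (x^-1 * y)%g; rewrite /= ?tinvgM ?invgK// mulVKg.
transitivity (\int[nu]_x ((g x)%:E * \int[mu]_y (phi (y^-1)%g / D (y^-1)%g)%:E))%E.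
  apply: eq_integral => x _.
  rewrite -[LHS](@ge0_integral_left_invariant _ x)//; last 2 first.
  - apply/measurable_EFinP; apply: continuous_borel => y.
    have c : (x, w) @[w --> y] --> (x, y).
      by apply: cvg_pair; [exact: cvg_cst|exact: cvg_id].
    exact: (cvg_comp _ _ c (ck _)).
  - by move=> y; rewrite lee_fin; exact: h0.
  rewrite -ge0_integralZl//.
  - apply: eq_integral => y _; rewrite /k /h /= -EFinM tinvgM mulgVK.
    by rewrite mulgK mulrA [phi _ * _]mulrC.
  - apply/measurable_EFinP; apply: continuous_borel => y.
    have c : (w^-1)%g @[w --> y] --> (y^-1)%g by exact: invg_continuous.
    by apply: cvgM; [exact: (cvg_comp _ _ c (cphi _))|exact: (cvg_comp _ _ c (cDV _))].
  - by move=> y _; rewrite lee_fin divr_ge0// ltW.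
  - by rewrite lee_fin.
rewrite ge0_integralZr//.
- by move=> x _; rewrite lee_fin.
- by apply: integral_ge0 => y _; rewrite lee_fin divr_ge0// ltW.
Qed.

(** A point of G need not have a countable base of neighbourhoods, so sequential dominated
    convergence does not apply. Instead [near_uniform] bounds the variation of F on L, and k is only
    required to be integrable there. *)
Lemma param_continuous_at (nu : {measure set (borel G) -> \bar R})
    (F : G * G -> R) (k : borel G -> R) (x0 : G)
    (L : set (borel G)) : compact (L : set G) -> continuous F ->
  (\forall x \near x0, forall z, ~ L z -> F (x, z) = 0) ->
  nu.-integrable L (EFin \o k) ->
  (\int[nu]_z (F (x, z) * k z) @[x --> x0] --> \int[nu]_z (F (x0, z) * k z))%R.
Proof.
move=> cL cF FL ik; have mL := compact_borel lcG cL.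
have cFx x : continuous (fun z => F (x, z)).
  move=> z; have c : (x, w) @[w --> z] --> (x, z).
    by apply: cvg_pair; [exact: cvg_cst|exact: cvg_id].
  exact: (cvg_comp _ _ c (cF _)).
have mk : measurable_fun L k.
  by apply/measurable_EFinP; exact: measurable_int ik.
have iFk (f : G -> R) : continuous f ->
    nu.-integrable L (fun z => (f z * k z)%:E).
  move=> cf; have [M M0 hM] := continuous_compact_bounded cf cL.
  apply: (le_integrable mL _ _ (integrableZl mL M ik)).
    apply/measurable_EFinP; apply: measurable_funM => //.
    by apply: measurable_funTS; exact: continuous_borel.
  move=> z Lz /=; rewrite lee_fin !normrM ler_wpM2r// (le_trans (hM z Lz))//.
  exact: ler_norm.
have restr x : (forall z, ~ L z -> F (x, z) = 0) ->
    \int[nu]_z (F (x, z) * k z) = \int[nu]_(z in L) (F (x, z) * k z).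
  move=> FxL; rewrite /Rintegral (integral_restr nu (K := L))//.
  by move=> z /FxL ->; rewrite mul0r.
have FL0 := nbhs_singleton FL.
rewrite (restr _ FL0); apply/cvgrPdist_le => e e0.
set c := \int[nu]_(z in L) `|k z|.
have c0 : 0 <= c by apply: Rintegral_ge0 => z _.
(* The summand 1 guards against c = 0. *)
have d0 : 0 < e / (c + 1) by rewrite divr_gt0// ltr_wpDl.
have near1 := near_uniform x0 cF cL d0.
near=> x.
have FxL : forall z, ~ L z -> F (x, z) = 0 by near: x.
rewrite (restr _ FxL) -RintegralB//; [|exact: iFk..].
apply: le_trans (le_normr_Rintegral _ _) _ => //.
  under eq_fun do rewrite -mulrBl.
  by apply: (iFk (fun z => F (x0, z) - F (x, z))) => z; apply: cvgB; exact: cFx.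
apply: (@le_trans _ _ (\int[nu]_(z in L) (e / (c + 1) * `|k z|))).
  apply: le_Rintegral => //.
  - rewrite (_ : _ \o _ = fun z => `|(F (x0, z) * k z - F (x, z) * k z)%:E|%E)//.
    apply: integrable_abse.
    under eq_fun do rewrite -mulrBl.
    by apply: (iFk (fun z => F (x0, z) - F (x, z))) => z; apply: cvgB; exact: cFx.
  - rewrite (_ : _ \o _ = fun z => (e / (c + 1))%:E * `|(k z)%:E|)%E//.
    by apply: integrableZl => //; exact: integrable_abse.
  - move=> z Lz; rewrite -mulrBl normrM ler_wpM2r// ltW//.
    by move: z Lz; near: x; exact: near1.
rewrite RintegralZl//; last by exact: (integrable_abse ik).
by rewrite -/c mulrAC ler_pdivrMr ?ltr_wpDl// ler_pM2l// lerDl.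
Unshelve. all: by end_near. Qed.

End InvariantMeasures.

Section ModularFunction.
Context {R : realType} {G : topGroupType}.
Hypothesis lcG : locally_compact_group G.
Variable mu : {measure set (borel G) -> \bar R}.
Hypothesis haar : left_haar mu.

Local Notation intg nu phi := (\int[nu]_x (phi x)%:E)%E.

Let limu : left_invariant mu. Proof. exact: haar_left_invariant. Qed.
Let fmu : compact_finite mu. Proof. exact: haar_compact_finite. Qed.

(** If U were null, so would be all its translates. Finitely many of them cover any compact set, so
    every compact set would be null, and inner regularity of the whole group would give mu = 0. *)
Lemma haar_open_gt0 (U : set G) : open U -> U !=set0 -> (0 < mu U)%E.
Proof.
move=> oU [u Uu]; rewrite lt0e measure_ge0 andbT; apply/eqP => U0.
have /eqP := haar_nontrivial haar; apply.
rewrite (haar_inner_regular haar openT); apply/eqP; rewrite eq_le; apply/andP.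
split; last first.
  by apply: ereal_sup_ubound; exists set0; [split => //; exact: compact0|exact: measure0].
apply: ge_ereal_sup => _ [K [cK _] <-].
pose good := [set W : set (borel G) | measurable W /\ mu W = 0%E].
pose F := filter_from good (fun W => [set W' : set G | W `<=` W']).
have FF : Filter F.
  apply: filter_from_filter; first by exists set0; split => //; exact: measure0.
  move=> W1 W2 [mW1 W10] [mW2 W20]; exists (W1 `|` W2).
    split; first exact: measurableU.
    by rewrite measureU0.
  by move=> W' W'W; split => z ?; apply: W'W; [left|right].
have [] := (compact_near_coveringP _).1 cK _ F (fun W x => W x) FF.
  move=> x Kx; pose g := (x * u^-1)%g.
  have oV : open [set y : G | U (g^-1 * y)%g].
    by move/continuousP : (continuous_mulgl (g := g^-1)%g) => /(_ U); apply.
  exists ([set y : G | U (g^-1 * y)%g], [set W' | [set y : G | U (g^-1 * y)%g] `<=` W']).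
    split => /=.
      by apply: open_nbhs_nbhs; split => //=; rewrite /g tinvgM invgK mulgVK.
    exists [set y : G | U (g^-1 * y)%g] => //; split; first exact: open_borel.
    by rewrite limu//; exact: open_borel.
  by move=> [z W'] /= [Uz]; apply.
move=> W [mW W0] /(_ W (@subset_refl _ W)) KW; rewrite -W0.
by apply: le_measure => //; rewrite inE//; exact: compact_borel.
Qed.

Lemma Cc_nonneg_integral_gt0 (phi : G -> R) (x : G) : Cc_nonneg phi ->
  0 < phi x -> (0 < intg mu phi)%E.
Proof.
move=> [cphi phi0 _] phix; pose U := [set y | phi x / 2 < phi y].
have oU : open U by move/continuousP : cphi => /(_ [set r | phi x / 2 < r]); apply; exact: open_gt.
have mU := open_borel oU.
have muU : (0 < mu U)%E.
  apply: haar_open_gt0 => //; exists x; rewrite /U /= ltr_pdivrMr// ltr_pMr//.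
  by rewrite ltrDl.
(* The case of infinite [mu U] has not been excluded; a finite positive lower bound suffices. *)
have [c c0 cU] : exists2 c : R, 0 < c & (c%:E <= mu U)%E.
  move: muU; case: (mu U) => [r|_|//].
    by rewrite lte_fin => r0; exists r.
  by exists 1 => //; rewrite leey.
apply: (@lt_le_trans _ _ ((phi x / 2)%:E * c%:E)%E).
  by rewrite -EFinM lte_fin mulr_gt0// divr_gt0.
apply: (@le_trans _ _ ((phi x / 2)%:E * mu U)%E).
  by rewrite lee_wpmul2l// lee_fin divr_ge0// ltW.
rewrite -integral_cst//.
apply: (@le_trans _ _ (\int[mu]_(y in U) (phi y)%:E)%E).
  apply: ge0_le_integral => //.
  - by move=> y _; rewrite lee_fin divr_ge0// ltW.
  - by apply/measurable_EFinP; apply: measurable_funTS; exact: continuous_borel.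
  - by move=> y /ltW; rewrite lee_fin.
apply: ge0_subset_integral => //.
  by apply/measurable_EFinP; exact: continuous_borel.
by move=> y _; rewrite lee_fin.
Qed.

Lemma Cc_nonneg_exists : exists2 g : G -> R, Cc_nonneg g & g 1%g = 1.
Proof.
have [|||g [cg g01 g1 _ [L cL gL]]] := @urysohn_compact R _ lcG [set 1%g] setT.
- exact: compact_set1.
- exact: openT.
- by [].
exists g; last exact: g1.
by split => //; [move=> x; have /andP[] := g01 x|exists L].
Qed.

Lemma right_translate_continuous (g : G -> R) (nu : {measure set (borel G) -> \bar R}) :
  compact_finite nu -> Cc_nonneg g ->
  continuous (fun x : G => \int[nu]_t g (t * x)%g).
Proof.
move=> fnu [cg g0 [K cK gK]] x0.
have [W cW x0W] := lcompact_nbhs lcG x0.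
(* For x in W, the condition that t x is in K places t in K W^-1, one compact set for all x near
   x0. *)
pose L : set (borel G) := setmulg K [set x | W (x^-1)%g].
have cL : compact (L : set G).
  by apply: compact_setmulg => //; exact: compact_invg.
pose F (z : G * G) := g (z.2 * z.1)%g.
have cF : continuous F.
  have c1 : continuous (fst : G * G -> G) by move=> z; exact: cvg_fst.
  have c2 : continuous (snd : G * G -> G) by move=> z; exact: cvg_snd.
  have c3 := continuous_mulg2 c2 c1.
  by move=> z; exact: (cvg_comp _ _ (c3 z) (cg _)).
have ik : nu.-integrable L (EFin \o (cst 1 : borel G -> R)).
  apply/integrableP; split; first exact/measurable_EFinP.
  rewrite (_ : (fun _ => _) = cst 1%E); last first.
    by apply/funext => x /=; rewrite normr1.
  by rewrite integral_cst ?mul1e; [exact: fnu|exact: compact_borel].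
rewrite (_ : (fun x => _) = fun x => \int[nu]_z (F (x, z) * cst 1 z)); last first.
  by apply/funext => x; congr Rintegral; apply/funext => z; rewrite /F /= mulr1.
apply: (param_continuous_at lcG cL cF _ ik).
near=> x => z nLz; apply/eqP; apply: contrapT => /negP /gK Kzx.
apply: nLz; exists (z * x)%g => //; exists (x^-1)%g; last by rewrite mulgK.
by rewrite /= invgK; near: x.
Unshelve. all: by end_near. Qed.

Lemma Cc_nonneg_translate (g : G -> R) (x : G) : Cc_nonneg g ->
  Cc_nonneg (fun t => g (t * x)%g).
Proof.
move=> [cg g0 [K cK gK]]; split => //.
  by move=> y; exact: (cvg_comp _ _ (continuous_mulgr (g := x) (x := y)) (cg _)).
exists ((fun t => t * x^-1)%g @` K).
  by apply: compact_image => //; exact: continuous_mulgr.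
by move=> y /gK Ky; exists (y * x)%g => //; rewrite mulgK.
Qed.

Lemma EFin_Cc_nonneg_integral (nu : {measure set (borel G) -> \bar R})
    (g : G -> R) : compact_finite nu -> Cc_nonneg g ->
  intg nu g = (\int[nu]_t g t)%:E.
Proof.
move=> fnu hg; rewrite /Rintegral fineK// ge0_fin_numE.
  exact: Cc_nonneg_integral_lty.
by apply: integral_ge0 => x _; rewrite lee_fin; case: hg.
Qed.

(** The second factor does not involve nu. Applied to two left invariant measures with the same g,
    the formula says that their integrals are proportional on C_c, which is uniqueness of Haar
    measure. The value g(1) = 1 makes every denominator positive, since t = x^-1 contributes to the
    integral of g(t x). *)
Lemma haar_unique_Cc (nu : {measure set (borel G) -> \bar R}) (g phi : G -> R) :
  left_invariant nu -> compact_finite nu -> Cc_nonneg g -> g 1%g = 1 ->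
  Cc_nonneg phi ->
  (intg nu phi = intg nu g * (\int[mu]_y
     (phi (y^-1)%g / (\int[mu]_t g (t * y^-1)%g))%:E))%E.
Proof.
move=> linu fnu hg g1 hphi.
apply: (haar_key_identity (D := fun x => \int[mu]_t g (t * x)%g) lcG limu) => //.
- exact: right_translate_continuous.
- move=> x; rewrite -lte_fin -EFin_Cc_nonneg_integral//.
    apply: (@Cc_nonneg_integral_gt0 _ (x^-1)%g); first exact: Cc_nonneg_translate.
    by rewrite mulVg g1.
  exact: Cc_nonneg_translate.
- by move=> x; rewrite EFin_Cc_nonneg_integral//; exact: Cc_nonneg_translate.
Qed.

(* Urysohn functions recover an inner regular measure from its integrals. *)
Lemma open_measure_le (U : set G) (a : \bar R)
    (nu : {measure set (borel G) -> \bar R}) :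
  open U ->
  nu U = ereal_sup [set nu K | K in [set K : set G | compact K /\ K `<=` U]] ->
  (forall phi : G -> R, Cc_nonneg phi -> (forall x, phi x <= 1) ->
     (forall x, ~ U x -> phi x = 0) -> (intg nu phi <= a)%E) ->
  (nu U <= a)%E.
Proof.
move=> oU -> h; apply: ge_ereal_sup => _ [K [cK KU] <-].
have [phi [cphi phi01 phiK phiU [L cL phiL]]] := urysohn_compact (R := R) lcG cK oU KU.
have hphi : Cc_nonneg phi.
  by split => //; [move=> x; have /andP[] := phi01 x|exists L].
apply: le_trans (h phi hphi _ phiU); last by move=> x; have /andP[] := phi01 x.
have mK := compact_borel lcG cK.
rewrite -(mul1e (nu K)) -integral_cst//.
apply: (@le_trans _ _ (\int[nu]_(y in K) (phi y)%:E)%E).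
  apply: ge0_le_integral => //.
  - by apply/measurable_EFinP; apply: measurable_funTS; exact: continuous_borel.
  - by move=> y Ky; rewrite phiK.
apply: ge0_subset_integral => //.
  by apply/measurable_EFinP; exact: continuous_borel.
by move=> y _; rewrite lee_fin; case: hphi.
Qed.

Lemma integral_le_measure (U : set G) (phi : G -> R)
    (nu : {measure set (borel G) -> \bar R}) : measurable (U : set (borel G)) ->
  Cc_nonneg phi -> (forall x, phi x <= 1) -> (forall x, ~ U x -> phi x = 0) ->
  (intg nu phi <= nu U)%E.
Proof.
move=> mU [cphi phi0 _] phi1 phiU; rewrite (integral_restr nu (K := U)).
  rewrite -[leRHS](mul1e (nu U)) -integral_cst//.
  apply: ge0_le_integral => //.
  - by move=> x _; rewrite lee_fin.
  - by apply/measurable_EFinP; apply: measurable_funTS; exact: continuous_borel.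
  - by move=> x _; rewrite lee_fin.
by move=> x /phiU ->.
Qed.

End ModularFunction.

(** * The modular function *)

Section ModularFunctionTheory.
Context {R : realType} {G : topGroupType}.
Hypothesis lcG : locally_compact_group G.
Variable mu : {measure set (borel G) -> \bar R}.
Hypothesis haar : left_haar mu.

Local Notation intg nu phi := (\int[nu]_x (phi x)%:E)%E.

Let limu : left_invariant mu. Proof. exact: haar_left_invariant. Qed.
Let fmu : compact_finite mu. Proof. exact: haar_compact_finite. Qed.

Section RightTranslate.
Variable s : G.

Let rt : borel G -> borel G := fun x : G => (x * s^-1)%g.

Let mrt : measurable_fun setT rt.
Proof. by apply: continuous_borel_map; exact: continuous_mulgr. Qed.

Let nu : {measure set (borel G) -> \bar R} :=
  measure_function_pushforward__canonical__measure_function_Measure mu mrt.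

Let nuE (A : set (borel G)) : nu A = mu [set x : G | A (x * s^-1)%g].
Proof. by []. Qed.

Let open_rt (U : set G) : open U -> open [set x : G | U (x * s^-1)%g].
Proof.
by move/continuousP : (continuous_mulgr (g := s^-1)%g) => /(_ U); exact.
Qed.

Let linu : left_invariant nu.
Proof.
move=> g A mA; rewrite !nuE -[RHS](limu g); last first.
  by have := mrt measurableT mA; rewrite setTI.
by congr (mu _); apply/seteqP; split => x /=; rewrite tmulgA.
Qed.

Let fnu : compact_finite nu.
Proof.
move=> K cK; rewrite nuE; apply: fmu.
have -> : [set x : G | K (x * s^-1)%g] = (fun x : G => x * s)%g @` K.
  apply/seteqP; split => [x Kx|_ [x Kx <-]] /=; last by rewrite mulgK.
  by exists (x * s^-1)%g => //; rewrite mulgVK.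
by apply: compact_image => //; exact: continuous_mulgr.
Qed.

Let nu_inner (U : set G) : open U ->
  nu U = ereal_sup [set nu K | K in [set K : set G | compact K /\ K `<=` U]].
Proof.
move=> oU; rewrite nuE (haar_inner_regular haar (open_rt oU)); congr ereal_sup.
apply/seteqP; split => _ [K [cK KU] <-].
  exists ((fun x : G => x * s^-1)%g @` K).
    split; last by move=> _ [x Kx <-]; exact: KU.
    by apply: compact_image => //; exact: continuous_mulgr.
  rewrite nuE; congr (mu _); apply/seteqP; split => x /=.
    by move=> [y Ky] /(congr1 (fun z => z * s)%g); rewrite !mulgVK => <-.
  by move=> Kx; exists x.
exists [set x : G | K (x * s^-1)%g]; last by [].
split; last by move=> x /KU.
have -> : [set x : G | K (x * s^-1)%g] = (fun x : G => x * s)%g @` K.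
  apply/seteqP; split => [x Kx|_ [x Kx <-]] /=; last by rewrite mulgK.
  by exists (x * s^-1)%g => //; rewrite mulgVK.
by apply: compact_image => //; exact: continuous_mulgr.
Qed.

(** The right translate [nu] of mu is again left invariant, so [haar_unique_Cc] makes it
    proportional to mu on C_c, with ratio [b / a] read off from one function g. Inner regularity
    carries the identity to open sets, outer regularity from there to Borel sets. *)
Lemma modular_exists : exists c : R, 0 < c /\
  forall A : set (borel G), measurable A ->
    (mu [set x : G | A (x * s^-1)%g] = c%:E * mu A)%E.
Proof.
have [g hg g1] := Cc_nonneg_exists (R := R) lcG.
have gs : Cc_nonneg (fun x => g (x * s^-1)%g) by exact: Cc_nonneg_translate.
have inu (phi : G -> R) : Cc_nonneg phi ->
    intg nu phi = intg mu (fun x => phi (x * s^-1)%g).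
  move=> [cphi phi0 _].
  have mphi : measurable_fun setT (EFin \o (phi : borel G -> R)).
    by apply/measurable_EFinP; exact: continuous_borel.
  have := ge0_integral_pushforward mrt mu measurableT mphi.
  by rewrite preimage_setT; apply => x _; rewrite lee_fin.
have Img := EFin_Cc_nonneg_integral lcG fmu hg.
have Ing := EFin_Cc_nonneg_integral lcG fnu hg.
set a := \int[mu]_t g t in Img; set b := \int[nu]_t g t in Ing.
have a0 : 0 < a.
  rewrite -lte_fin -Img; apply: (@Cc_nonneg_integral_gt0 _ _ lcG _ haar _ 1%g) => //.
  by rewrite g1.
have b0 : 0 < b.
  rewrite -lte_fin -Ing inu//.
  apply: (@Cc_nonneg_integral_gt0 _ _ lcG _ haar _ s) => //.
  by rewrite mulgV g1.
have c0 : 0 < b / a by rewrite divr_gt0.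
have key (phi : G -> R) : Cc_nonneg phi ->
    (intg nu phi = (b / a)%:E * intg mu phi)%E.
  move=> hphi; rewrite (haar_unique_Cc lcG haar linu fnu hg g1 hphi).
  rewrite (haar_unique_Cc lcG haar limu fmu hg g1 hphi) Img Ing muleA -EFinM.
  by rewrite divfK// gt_eqF.
have openE (U : set G) : open U -> (nu U = (b / a)%:E * mu U)%E.
  move=> oU; apply/eqP; rewrite eq_le; apply/andP; split.
    apply: (open_measure_le lcG oU (nu_inner oU)) => phi hphi phi1 phiU.
    rewrite key// lee_wpmul2l ?lee_fin ?(ltW c0)//.
    by apply: integral_le_measure => //; exact: open_borel.
  rewrite -lee_pdivlMl//.
  apply: (open_measure_le lcG oU (haar_inner_regular haar oU)) => phi hphi phi1 phiU.
  rewrite lee_pdivlMl// -key//.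
  by apply: integral_le_measure => //; exact: open_borel.
exists (b / a); split => // A mA; rewrite -nuE.
apply/eqP; rewrite eq_le; apply/andP; split.
  rewrite -lee_pdivrMl// (haar_outer_regular haar mA).
  apply: le_ereal_inf_tmp => _ [U [oU AU] <-].
  rewrite lee_pdivrMl// -openE//; apply: le_measure => //; rewrite inE//.
  exact: open_borel.
have mA' : measurable ([set x : G | A (x * s^-1)%g] : set (borel G)).
  by have := mrt measurableT mA; rewrite setTI.
rewrite nuE (haar_outer_regular haar mA').
apply: le_ereal_inf_tmp => _ [U' [oU' AU'] <-].
(* Outer regularity is given for mu, so an open set U' around the translate of A is moved back to an
   open set U around A, with nu U = mu U'. *)
pose U := [set x : G | U' (x * s)%g].
have oU : open U.
  by move/continuousP : (continuous_mulgr (g := s)) => /(_ U'); exact.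
have -> : mu U' = nu U.
  by rewrite nuE; congr (mu _); apply/seteqP; split => x; rewrite /U /= mulgVK.
rewrite openE// lee_wpmul2l ?lee_fin ?(ltW c0)//.
apply: le_measure => //; rewrite ?inE//; first exact: open_borel.
by move=> x Ax; apply: AU'; rewrite /= mulgK.
Qed.

(** By [modular_exists] the default value 1 in the definition of [modular] is never the reason for
    its properties. *)
Lemma modular_gt0 : 0 < modular mu s.
Proof. by have [] := xgetPex 1 modular_exists. Qed.

Lemma modularP (A : set (borel G)) : measurable A ->
  (mu [set x : G | A (x * s^-1)%g] = (modular mu s)%:E * mu A)%E.
Proof. by have [_] := xgetPex 1 modular_exists; exact. Qed.

Lemma ge0_integral_right_translate (f : borel G -> \bar R) :
  measurable_fun setT f -> (forall x, 0 <= f x)%E ->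
  (\int[mu]_x f (x * s^-1)%g = (modular mu s)%:E * \int[mu]_x f x)%E.
Proof.
move=> mf f0; have := ge0_integral_pushforward mrt mu measurableT mf (fun x _ => f0 x).
rewrite preimage_setT => <-.
have c0 : 0 <= modular mu s by rewrite ltW ?modular_gt0.
rewrite -[(modular mu s)]/(NngNum c0)%:num -ge0_integral_mscale//.
by apply: eq_measure_integral => A mA _; rewrite [LHS]nuE modularP.
Qed.

End RightTranslate.

(** Translating one fixed g by s t at once, or by s and t in succession, multiplies the same finite
    positive integral. *)
Lemma modularM (s t : G) : modular mu (s * t)%g = modular mu s * modular mu t.
Proof.
have [g hg g1] := Cc_nonneg_exists (R := R) lcG.
have mg u : measurable_fun setT (fun x : borel G => (g (x * u)%g)%:E).
  apply/measurable_EFinP; apply: continuous_borel.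
  by have [] := Cc_nonneg_translate u hg.
have g0 x : (0 <= (g x)%:E)%E by rewrite lee_fin; case: hg.
have Img := EFin_Cc_nonneg_integral lcG fmu hg.
have a0 : 0 < \int[mu]_t g t.
  rewrite -lte_fin -Img; apply: (@Cc_nonneg_integral_gt0 _ _ lcG _ haar _ 1%g) => //.
  by rewrite g1.
have mg1 : measurable_fun setT (fun x : borel G => (g x)%:E).
  by apply/measurable_EFinP; apply: continuous_borel; case: hg.
have e1 := ge0_integral_right_translate ((s * t)%g) mg1 g0.
have := ge0_integral_right_translate t (mg (s^-1)%g) (fun x => g0 _).
rewrite (ge0_integral_right_translate s mg1 g0) => e2.
move: e1; rewrite (_ : (fun x => _) = fun x : borel G => (g (x * t^-1 * s^-1)%g)%:E); last first.
  by apply/funext => x; rewrite tinvgM tmulgA.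
rewrite e2 Img -!EFinM => -[h]; apply: (mulIf (lt0r_neq0 a0)).
by rewrite -h mulrCA mulrA.
Qed.

Lemma modular1 : modular mu 1%g = 1.
Proof.
have := modularM 1%g 1%g; rewrite tmulg1 -{1}[modular mu 1%g]mulr1.
by move=> /(mulfI (lt0r_neq0 (modular_gt0 1%g))).
Qed.

Lemma modularV (s : G) : modular mu (s^-1)%g = (modular mu s)^-1.
Proof.
have m0 : modular mu s != 0 by rewrite gt_eqF ?modular_gt0.
by apply: (mulfI m0); rewrite -modularM mulgV modular1 mulfV.
Qed.

Lemma modular_continuous : continuous (modular mu).
Proof.
have [g hg g1] := Cc_nonneg_exists (R := R) lcG.
have Img := EFin_Cc_nonneg_integral lcG fmu hg.
have a0 : 0 < \int[mu]_t g t.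
  rewrite -lte_fin -Img; apply: (@Cc_nonneg_integral_gt0 _ _ lcG _ haar _ 1%g) => //.
  by rewrite g1.
have mg1 : measurable_fun setT (fun x : borel G => (g x)%:E).
  by apply/measurable_EFinP; apply: continuous_borel; case: hg.
have g0 x : (0 <= (g x)%:E)%E by rewrite lee_fin; case: hg.
have -> : modular mu = fun s : G =>
    (\int[mu]_t g (t * s^-1)%g) / \int[mu]_t g t.
  apply/funext => s; have := ge0_integral_right_translate s mg1 g0.
  rewrite (EFin_Cc_nonneg_integral lcG fmu (Cc_nonneg_translate (s^-1)%g hg)) Img.
  by rewrite -EFinM => -[->]; rewrite mulfK// gt_eqF.
move=> s; have c := @invg_continuous G s.
apply: cvgM; last exact: cvg_cst.
have h : continuous _ := right_translate_continuous lcG fmu hg.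
exact: (cvg_comp _ _ c (h _)).
Qed.

(** This is [haar_unique_Cc] with nu = mu: the denominator, the integral of g(t y^-1) in t, equals
    Delta(y) times the integral of g, and that integral cancels. *)
Lemma haar_inversion_Cc (phi : G -> R) : Cc_nonneg phi ->
  (intg mu phi = \int[mu]_y (phi (y^-1)%g * modular mu (y^-1)%g)%:E)%E.
Proof.
move=> hphi; have [g hg g1] := Cc_nonneg_exists (R := R) lcG.
have Img := EFin_Cc_nonneg_integral lcG fmu hg.
set a := \int[mu]_t g t in Img.
have a0 : 0 < a.
  rewrite -lte_fin -Img; apply: (@Cc_nonneg_integral_gt0 _ _ lcG _ haar _ 1%g) => //.
  by rewrite g1.
have mg1 : measurable_fun setT (fun x : borel G => (g x)%:E).
  by apply/measurable_EFinP; apply: continuous_borel; case: hg.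
have g0 x : (0 <= (g x)%:E)%E by rewrite lee_fin; case: hg.
rewrite (haar_unique_Cc lcG haar limu fmu hg g1 hphi) Img -ge0_integralZl//.
- apply: eq_integral => y _; rewrite -EFinM; congr EFin.
  have := ge0_integral_right_translate y mg1 g0.
  rewrite (EFin_Cc_nonneg_integral lcG fmu (Cc_nonneg_translate (y^-1)%g hg)) Img.
  rewrite -EFinM => -[->]; rewrite modularV invfM mulrCA (mulrC a) !mulrA.
  by rewrite -!mulrA mulVf ?mulr1 ?gt_eqF.
- apply/measurable_EFinP; apply: continuous_borel => y.
  have c := @invg_continuous G y; have [cphi _ _] := hphi.
  apply: cvgM; first exact: (cvg_comp _ _ c (cphi _)).
  apply: cvgV; last first.
    have h : continuous _ := right_translate_continuous lcG fmu hg.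
    exact: (cvg_comp _ _ c (h _)).
  rewrite gt_eqF// -lte_fin -(EFin_Cc_nonneg_integral lcG fmu (Cc_nonneg_translate (y^-1)%g hg)).
  apply: (@Cc_nonneg_integral_gt0 _ _ lcG _ haar _ y); first exact: Cc_nonneg_translate.
  by rewrite mulgV g1.
- move=> y _; rewrite lee_fin divr_ge0//; first by case: hphi.
  by apply: Rintegral_ge0 => t _; rewrite -lee_fin.
- by rewrite lee_fin ltW.
Qed.

End ModularFunctionTheory.

(** * Inversion and Haar measure *)

Section WeightedPushforward.
Context {d1 d2 : measure_display} {T1 : measurableType d1}
  {T2 : measurableType d2} {R : realType}.
Variables (m1 : {measure set T1 -> \bar R}) (m2 : {measure set T2 -> \bar R}).
Variables (phi : T1 -> T2) (w : T1 -> R).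
Hypotheses (mphi : measurable_fun setT phi) (mw : measurable_fun setT w).
Hypothesis w0 : forall x, 0 <= w x.
Local Open Scope ereal_scope.

Import HBNNSimple.

Lemma ge0_integral_weighted_pushforward (f : T2 -> \bar R) :
  (forall A, measurable A -> m2 A = \int[m1]_(x in phi @^-1` A) (w x)%:E) ->
  measurable_fun setT f -> (forall y, 0 <= f y) ->
  \int[m2]_y f y = \int[m1]_x (f (phi x) * (w x)%:E).
Proof.
move=> h2 mf f0; pose h := nnsfun_approx measurableT mf.
have mE : measurable_fun setT (fun x => (w x)%:E) by exact/measurable_EFinP.
have -> : \int[m2]_y f y = lim (\int[m2]_y (EFin \o h n) y @[n --> \oo]).
  rewrite -monotone_convergence//.
  - by apply: eq_integral => y _; apply/esym/cvg_lim => //; exact: cvg_nnsfun_approx.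
  - by move=> n; exact/measurable_EFinP.
  - by move=> n y _; rewrite lee_fin.
  - by move=> y _ a b ab; rewrite lee_fin; exact/lefP/nd_nnsfun_approx.
have mh n : measurable_fun setT (fun x => (h n (phi x))%:E).
  by apply/measurable_EFinP; exact: (measurableT_comp (measurable_funPT (h n)) mphi).
have -> : \int[m1]_x (f (phi x) * (w x)%:E) =
    lim (\int[m1]_x ((h n (phi x))%:E * (w x)%:E) @[n --> \oo]).
  rewrite -monotone_convergence//.
  - apply: eq_integral => x _; apply/esym/cvg_lim => //; apply: cvgeZr => //.
    exact: cvg_nnsfun_approx.
  - by move=> n; exact: emeasurable_funM.
  - by move=> n x _; rewrite mule_ge0 ?lee_fin.
  - move=> x _ a b ab; rewrite lee_wpmul2r ?lee_fin//.
    exact/lefP/nd_nnsfun_approx.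
suff e n : \int[m2]_y (EFin \o h n) y =
    \int[m1]_x ((h n (phi x))%:E * (w x)%:E).
  by under eq_fun do rewrite e.
rewrite integralT_nnsfun sintegralE.
transitivity (\int[m1]_x (\sum_(y \in range (h n))
    (y * \1_(h n @^-1` [set y]) (phi x))%:E * (w x)%:E)); last first.
  apply: eq_integral => x _.
  rewrite -ge0_mule_fsuml => [|y]; last exact: nnfun_muleindic_ge0.
  by rewrite fsumEFin// -(fimfunE _ (phi x)).
have mA y : measurable (h n @^-1` [set y]) by [].
have mind y : measurable_fun setT
    (fun x => (y * \1_(h n @^-1` [set y]) (phi x))%:E).
  apply/measurable_EFinP; apply: measurable_funM => //.
  exact: (measurableT_comp (measurable_indic _) mphi).
rewrite ge0_integral_fsum//; last 2 first.
- by move=> y; apply: emeasurable_funM => //; exact: mind.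
- move=> y x _; rewrite mule_ge0 ?lee_fin//.
  exact: nnfun_muleindic_ge0.
apply: eq_fsbigr => y /[!inE] -[t _ <-{y}]; rewrite h2//.
have mP : measurable (phi @^-1` (h n @^-1` [set h n t])).
  by rewrite -[X in measurable X]setTI; exact: mphi.
rewrite -ge0_integralZl//; last 3 first.
- exact: measurable_funTS.
- by move=> x _; rewrite lee_fin.
- by rewrite lee_fin.
rewrite integral_mkcond; apply: eq_integral => x _; rewrite patchE indicE.
case: ifPn => hx; last first.
  rewrite (_ : _ \in _ = false) ?mulr0 ?mul0e//.
  by apply/negbTE; apply: contra hx; rewrite !inE.
by rewrite (_ : _ \in _ = true) ?mulr1.
Qed.

End WeightedPushforward.

Section HaarInversion.
Context {R : realType} {G : topGroupType}.
Hypothesis lcG : locally_compact_group G.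
Variable mu : {measure set (borel G) -> \bar R}.
Hypothesis haar : left_haar mu.

Local Notation intg nu phi := (\int[nu]_x (phi x)%:E)%E.

Let fmu : compact_finite mu. Proof. exact: haar_compact_finite. Qed.

Let w (y : G) : R := modular mu (y^-1)%g.

Let cw : continuous w.
Proof.
move=> y; have c := @invg_continuous G y.
exact: (cvg_comp _ _ c (modular_continuous lcG haar (x := _))).
Qed.

Let w0 y : 0 <= w y. Proof. by rewrite ltW// modular_gt0. Qed.

Let mw : measurable_fun setT (w : borel G -> R).
Proof. exact: continuous_borel. Qed.

Let mEw : measurable_fun setT (fun y : borel G => (w y)%:E).
Proof. exact/measurable_EFinP. Qed.

Let inv : borel G -> borel G := fun y : G => (y^-1)%g.

Let minv : measurable_fun setT inv.
Proof. by apply: continuous_borel_map; exact: invg_continuous. Qed.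

Let open_inv (V : set G) : open V -> open [set y : G | V (y^-1)%g].
Proof. by move/continuousP : (@invg_continuous G) => /(_ V); exact. Qed.

Let mpre (A : set (borel G)) : measurable A -> measurable (inv @^-1` A).
Proof. by move=> mA; rewrite -[X in measurable X]setTI; exact: minv. Qed.

(** Urysohn functions below the indicator of V give one inequality. For the other, V^-1 is exhausted
    up to a small remainder by a compact L, and a Urysohn function for L^-1 inside V equals 1 where
    it is needed. The compact set K keeps measures finite and the density bounded. *)
Lemma haar_inversion_open (V K : set G) : open V -> compact K -> V `<=` K ->
  (mu V = \int[mu]_(y in inv @^-1` V) (w y)%:E)%E.
Proof.
move=> oV cK VK; have mV := open_borel oV; have mVV := mpre mV.
apply/eqP; rewrite eq_le; apply/andP; split.
  apply: (open_measure_le lcG oV (haar_inner_regular haar oV)) => phi hphi phi1 phiV.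
  rewrite (haar_inversion_Cc lcG haar hphi) (integral_restr mu (K := inv @^-1` V)).
    have [cphi phi0 _] := hphi.
    apply: ge0_le_integral => //.
    - by move=> y _; rewrite lee_fin mulr_ge0// w0.
    - apply: measurable_funTS; apply/measurable_EFinP; apply: measurable_funM => //.
      apply: continuous_borel => y; have c := @invg_continuous G y.
      exact: (cvg_comp _ _ c (cphi _)).
    - exact: measurable_funTS.
    - by move=> y _; rewrite lee_fin ler_piMl// w0.
  by move=> y nVy; rewrite phiV ?mul0r.
set W := inv @^-1` V in mVV *.
have oW : open (W : set G) by exact: open_inv.
have cKV : compact [set y : G | K (y^-1)%g] by exact: compact_invg.
have [M M0 hM] := continuous_compact_bounded cw cKV.
have WK : W `<=` [set y : G | K (y^-1)%g] by move=> y /VK.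
have muW : (mu W < +oo)%E.
  apply: le_lt_trans (fmu cKV); apply: le_measure => //; rewrite ?inE//.
  exact: compact_borel.
apply/lee_addgt0Pr => e e0.
(* M bounds the density on K^-1, so a remainder of measure at most e / M has weighted mass at most
   e. *)
have eM : 0 < e / M by rewrite divr_gt0.
have [_ [L [cL LW] <-] hL] : exists2 y, [set mu K | K in [set K : set G | compact K /\ K `<=` W]] y & (mu W - (e / M)%:E < y)%E.
  rewrite (haar_inner_regular haar oW); apply: ub_ereal_sup_adherent => //.
  by rewrite -(haar_inner_regular haar oW) ge0_fin_numE.
have mL := compact_borel lcG cL.
rewrite -(setDUK LW) ge0_integral_setU//; first last.
- by apply/disj_setPS => y [Ly []].
- by move=> y _; rewrite lee_fin.
- exact: measurable_funTS.
- exact: measurableD.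
apply: leeD.
  pose LV := [set y : G | L (y^-1)%g].
  have cLV : compact LV by exact: compact_invg.
  have LVV : LV `<=` V by move=> y /LW; rewrite /W /inv /= invgK.
  have [phi [cphi phi01 phiL phiV [S cS phiS]]] := urysohn_compact (R := R) lcG cLV oV LVV.
  have hphi : Cc_nonneg phi.
    by split => //; [move=> x; have /andP[] := phi01 x|exists S].
  apply: (@le_trans _ _ (intg mu phi)); last first.
    by apply: integral_le_measure => // x; have /andP[] := phi01 x.
  rewrite (haar_inversion_Cc lcG haar hphi).
  have mphiw : measurable_fun setT (fun y : borel G => (phi (y^-1)%g * modular mu (y^-1)%g)%:E).
    apply/measurable_EFinP; apply: measurable_funM => //.
    apply: continuous_borel => y; have c := @invg_continuous G y.
    exact: (cvg_comp _ _ c (cphi _)).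
  apply: (@le_trans _ _ (\int[mu]_(y in L) (phi (y^-1)%g * modular mu (y^-1)%g)%:E)%E).
    apply: ge0_le_integral => //.
    - by move=> y _; rewrite lee_fin.
    - exact: measurable_funTS.
    - exact: measurable_funTS.
    - by move=> y Ly; rewrite phiL ?mul1r// /LV /= invgK.
  apply: ge0_subset_integral => //.
  by move=> y _; rewrite lee_fin mulr_ge0// ?w0//; case: hphi.
apply: (@le_trans _ _ (\int[mu]_(y in W `\` L) (cst M%:E) y)%E).
  apply: ge0_le_integral => //.
  - exact: measurableD.
  - by move=> y _; rewrite lee_fin.
  - exact: measurable_funTS.
  - by move=> y [Wy _]; rewrite lee_fin (le_trans _ (hM y (WK y Wy)))// ler_norm.
rewrite integral_cst; last exact: measurableD.
rewrite measureD// (setIidr LW) -lee_pdivlMl//.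
rewrite leeBlDr; last by rewrite ge0_fin_numE//; exact: fmu.
by rewrite -leeBlDl// -EFinM mulrC; exact: ltW.
Qed.

(** Open sets are stable under intersection and generate the Borel sets, so two finite measures
    equal on them are equal. Finiteness comes from cutting down to a relatively compact open V
    around K. *)
Lemma haar_inversion (f : borel G -> \bar R) (K : set G) : compact K ->
  measurable_fun setT f -> (forall x, 0 <= f x)%E ->
  (forall x, ~ K x -> f x = 0%E) ->
  (\int[mu]_x f x = \int[mu]_y (f (y^-1)%g * (modular mu (y^-1)%g)%:E))%E.
Proof.
move=> cK mf f0 fK; have [L cL KL] := compact_neighborhood lcG cK.
pose V : set (borel G) := interior L; have oV : open (V : set G) by exact: open_interior.
have VL : V `<=` L by exact: interior_subset.
have mV := open_borel oV.
have mW := mpre mV.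
(* The density is cut to V^-1, which corresponds to restricting mu to V on the other side of the
   inversion. *)
pose w' : borel G -> R := w \_ (inv @^-1` V).
have mw' : measurable_fun setT w'.
  by apply/(measurable_restrictT _ mW); exact: measurable_funTS.
have w'0 y : 0 <= w' y by rewrite /w' patchE; case: ifPn.
have w'E (A : set (borel G)) :
    (\int[mu]_(y in inv @^-1` A) (w' y)%:E =
     \int[mu]_(y in inv @^-1` (A `&` V)) (w y)%:E)%E.
  rewrite preimage_setI integral_mkcondr; apply: eq_integral => y _.
  by rewrite /w' !patchE; case: ifPn.
have lam0 : (\int[mu]_(y in set0) (w' y)%:E = 0)%E by exact: integral_set0.
have lam_ge0 A : (0 <= \int[mu]_(y in A) (w' y)%:E)%E.
  by apply: integral_ge0 => y _; rewrite lee_fin.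
have mEw' : measurable_fun setT (fun y : borel G => (w' y)%:E).
  exact/measurable_EFinP.
have w'0E y : (0 <= (w' y)%:E)%E by rewrite lee_fin.
have lam_add := semi_sigma_additive_nng_induced (mu := mu) mEw' w'0E.
pose lam : {measure set (borel G) -> \bar R} :=
  HB.pack (fun A : set (borel G) => \int[mu]_(y in A) (w' y)%:E)%E
   (isMeasure.Build _ _ _ _ lam0 lam_ge0 lam_add).
pose m2 : {measure set (borel G) -> \bar R} :=
  measure_function_pushforward__canonical__measure_function_Measure lam minv.
pose m1 : {measure set (borel G) -> \bar R} := mrestr mu mV.
have m12 (A : set (borel G)) : measurable A -> m1 A = m2 A.
  apply: (@g_sigma_algebra_measure_unique _ R (borel G) (@open G) _ (fun=> setT) _ _ m1 m2).
  - by move=> U oU; exact: open_borel.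
  - by move=> _; exact: openT.
  - by rewrite bigcup_const.
  - by move=> U1 U2; exact: openI.
  - move=> U oU; rewrite /m2 /= /pushforward /lam /= w'E /mrestr.
    by apply: (haar_inversion_open (K := L)) => //; [exact: openI|move=> x [_ /VL]].
  - move=> _; rewrite /= /mrestr setTI; apply: le_lt_trans (fmu cL).
    by apply: le_measure => //; rewrite inE//; exact: compact_borel.
have fV x : ~ V x -> f x = 0%E by move=> nVx; apply: fK => /KL; exact.
rewrite -(integral_mrestr mu mV fV).
rewrite (@ge0_integral_weighted_pushforward _ _ _ _ R mu _ inv w' minv mw' w'0)//.
  apply: eq_integral => y _; rewrite /w' patchE; case: ifPn => // hy.
  rewrite fV ?mul0e//; move/negP : hy; rewrite inE; exact.
Qed.

End HaarInversion.

(** * Complex-valued integrals *)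

Section ComplexFacts.
Context {R : realType}.
Implicit Types z w : R[i].

Lemma complex_ReM z w : complex.Re (z * w) =
  complex.Re z * complex.Re w - complex.Im z * complex.Im w.
Proof. by case: z; case: w. Qed.

Lemma complex_ImM z w : complex.Im (z * w) =
  complex.Re z * complex.Im w + complex.Im z * complex.Re w.
Proof. by case: z; case: w. Qed.

Lemma Re_conjc z : complex.Re (z^*)%C = complex.Re z. Proof. by case: z. Qed.

Lemma Im_conjc z : complex.Im (z^*)%C = - complex.Im z. Proof. by case: z. Qed.

Lemma complex_eqP z w : complex.Re z = complex.Re w ->
  complex.Im z = complex.Im w -> z = w.
Proof. by case: z; case: w => a b c d /= -> ->. Qed.

Lemma conjcM z w : ((z * w)^*)%C = (z^*)%C * (w^*)%C.
Proof. exact: rmorphM. Qed.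

Lemma conjcD z w : ((z + w)^*)%C = (z^*)%C + (w^*)%C.
Proof. exact: rmorphD. Qed.

Lemma mulc_conjc z : z * (z^*)%C = (normc z ^+ 2)%:C%C.
Proof.
case: z => a b; apply: complex_eqP; rewrite ?complex_ReM ?complex_ImM /=.
  by rewrite sqr_sqrtr ?addr_ge0 ?sqr_ge0// mulrN opprK !expr2.
by rewrite mulrN mulrC addNr.
Qed.

(** At z = 0 the value is 0, as the inverse of 0 is 0. Hence [unit_phase_conjc] has no exception,
    while the modulus is 1 only away from 0. *)
Definition unit_phase z : R[i] := z / (normc z)%:C%C.

Lemma normc_unit_phase z : z != 0 -> normc (unit_phase z) = 1.
Proof.
by move=> z0; rewrite normcM normcV normc_real ger0_norm ?normc_ge0// mulfV// normc_eq0.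
Qed.

Lemma unit_phase_conjc z : z * (unit_phase z)^*%C = (normc z)%:C%C.
Proof.
have [->|z0] := eqVneq z 0; first by rewrite mul0r normc0.
have n0 : normc z != 0 by rewrite normc_eq0.
rewrite /unit_phase conjcM conjc_inv conjc_real mulrA mulc_conjc.
by rewrite -fmorphV -rmorphM expr2 mulfK.
Qed.

End ComplexFacts.

Section ComplexMeasurable.
Context {R : realType} {G : topGroupType}.
Implicit Types f g : G -> R[i].

Lemma measurable_complexM d (T : measurableType d) (a b : T -> R[i]) :
  measurable_fun setT (fun x => complex.Re (a x)) ->
  measurable_fun setT (fun x => complex.Im (a x)) ->
  measurable_fun setT (fun x => complex.Re (b x)) ->
  measurable_fun setT (fun x => complex.Im (b x)) ->
  measurable_fun setT (fun x => complex.Re (a x * b x)) /\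
  measurable_fun setT (fun x => complex.Im (a x * b x)).
Proof.
move=> f1 f2 g1 g2; split.
  under eq_fun do rewrite complex_ReM.
  by apply: measurable_funB; exact: measurable_funM.
under eq_fun do rewrite complex_ImM.
by apply: measurable_funD; exact: measurable_funM.
Qed.

Lemma complex_measurableM f g : complex_measurable f -> complex_measurable g ->
  complex_measurable (fun x => f x * g x).
Proof.
by move=> [f1 f2] [g1 g2]; exact: measurable_complexM.
Qed.

Lemma complex_measurable_conj f : complex_measurable f ->
  complex_measurable (fun x => (f x)^*%C).
Proof.
move=> [f1 f2]; split; first by under eq_fun do rewrite Re_conjc.
by under eq_fun do rewrite Im_conjc; exact: measurable_funN.
Qed.

Lemma complex_measurable_real (w : borel G -> R) : measurable_fun setT w ->
  complex_measurable (fun x : G => (w x)%:C%C).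
Proof. by move=> mw; split => //; exact: measurable_cst. Qed.

Lemma complex_measurable_cst (c : R[i]) : complex_measurable (fun _ : G => c).
Proof. by split; exact: measurable_cst. Qed.

Lemma complex_measurable_comp f (phi : G -> G) : continuous phi ->
  complex_measurable f -> complex_measurable (fun x => f (phi x)).
Proof.
move=> /continuous_borel_map mphi [f1 f2]; split.
  exact: (measurableT_comp f1 mphi).
exact: (measurableT_comp f2 mphi).
Qed.

Lemma measurable_normc f : complex_measurable f ->
  measurable_fun setT (fun x : borel G => normc (f x)).
Proof.
move=> [f1 f2].
rewrite (_ : (fun x => _) = (fun x : borel G =>
    Num.sqrt (complex.Re (f x) ^+ 2 + complex.Im (f x) ^+ 2))); last first.
  by apply/funext => x; case: (f x).
apply: (measurableT_comp (continuous_measurable_fun (@sqrt_continuous R))).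
by apply: measurable_funD; exact: measurable_funX.
Qed.

Lemma continuous_ReIm f : continuous (f : G -> R[i]^o) ->
  continuous (fun x => complex.Re (f x)) /\ continuous (fun x => complex.Im (f x)).
Proof. by move=> cf; split => x; have /cvg_ReIm[] := cf x. Qed.

Lemma continuous_complex f : continuous (fun x => complex.Re (f x)) ->
  continuous (fun x => complex.Im (f x)) -> continuous (f : G -> R[i]^o).
Proof. by move=> c1 c2 x; apply/cvg_ReIm; split; [exact: c1|exact: c2]. Qed.

Lemma continuous_normc f : continuous (f : G -> R[i]^o) ->
  continuous (fun x => normc (f x)).
Proof.
move=> cf; rewrite (_ : (fun x => _) = (fun x =>
    Num.sqrt (complex.Re (f x) ^+ 2 + complex.Im (f x) ^+ 2))); last first.
  by apply/funext => x; case: (f x).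
have [c1 c2] := continuous_ReIm cf => x.
have h : complex.Re (f y) ^+ 2 + complex.Im (f y) ^+ 2 @[y --> x] -->
    complex.Re (f x) ^+ 2 + complex.Im (f x) ^+ 2.
  by apply: cvgD; rewrite !expr2; under eq_cvg do rewrite expr2; apply: cvgM;
    [exact: c1|exact: c1|exact: c2|exact: c2].
exact: (cvg_comp _ _ h (@sqrt_continuous R _)).
Qed.

Lemma continuous_complex_measurable f : continuous (f : G -> R[i]^o) ->
  complex_measurable f.
Proof. by move=> /continuous_ReIm[c1 c2]; split; exact: continuous_borel. Qed.

End ComplexMeasurable.

Section ComplexIntegral.
Context {R : realType} {G : topGroupType}.
Variable mu : {measure set (borel G) -> \bar R}.
Implicit Types h : G -> R[i].

Definition complex_integrable h : Prop :=
  complex_measurable h /\ (\int[mu]_x (normc (h x))%:E < +oo)%E.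

Lemma complex_integrable_ReIm h : complex_integrable h ->
  mu.-integrable setT (fun x : borel G => (complex.Re (h x))%:E) /\
  mu.-integrable setT (fun x : borel G => (complex.Im (h x))%:E).
Proof.
move=> [mh hoo]; have mn := measurable_normc mh; have [m1 m2] := mh.
split; apply/integrableP; split; try exact/measurable_EFinP;
  apply: le_lt_trans hoo; apply: ge0_le_integral => //.
- by apply: measurableT_comp => //; exact/measurable_EFinP.
- exact/measurable_EFinP.
- by move=> x _; rewrite lee_fin Re_le_normc.
- by apply: measurableT_comp => //; exact/measurable_EFinP.
- exact/measurable_EFinP.
- by move=> x _; rewrite lee_fin Im_le_normc.
Qed.

Lemma complex_integrable_normc h : complex_integrable h ->
  mu.-integrable setT (fun x : borel G => (normc (h x))%:E).
Proof.
move=> [mh hoo]; apply/integrableP; split.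
  by apply/measurable_EFinP; exact: measurable_normc.
by under eq_integral do rewrite /= ger0_norm ?normc_ge0//.
Qed.

Lemma eq_complex_integral h h' : h =1 h' ->
  complex_integral mu h = complex_integral mu h'.
Proof. by move=> /funext ->. Qed.

Lemma complex_integralZ (c : R[i]) h : complex_integrable h ->
  complex_integral mu (fun x => c * h x) = c * complex_integral mu h.
Proof.
move=> hi; have [h1 h2] := complex_integrable_ReIm hi.
have i1 (r : R) : mu.-integrable setT (fun x : borel G => (r * complex.Re (h x))%:E).
  by under eq_fun do rewrite EFinM; exact: integrableZl.
have i2 (r : R) : mu.-integrable setT (fun x : borel G => (r * complex.Im (h x))%:E).
  by under eq_fun do rewrite EFinM; exact: integrableZl.
have Z1 r : \int[mu]_x (r * complex.Re (h x)) = r * \int[mu]_x complex.Re (h x).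
  exact: RintegralZl.
have Z2 r : \int[mu]_x (r * complex.Im (h x)) = r * \int[mu]_x complex.Im (h x).
  exact: RintegralZl.
apply: complex_eqP => /=.
  under eq_Rintegral do rewrite complex_ReM.
  by rewrite (RintegralB measurableT (i1 _) (i2 _)) Z1 Z2 complex_ReM.
under eq_Rintegral do rewrite complex_ImM.
by rewrite (RintegralD measurableT (i2 _) (i1 _)) Z1 Z2 complex_ImM.
Qed.

Lemma complex_integral_conj h : complex_integrable h ->
  complex_integral mu (fun x => (h x)^*%C) = (complex_integral mu h)^*%C.
Proof.
move=> hi; have [h1 h2] := complex_integrable_ReIm hi.
apply: complex_eqP => /=.
  by apply: eq_Rintegral => x _; rewrite Re_conjc.
rewrite -mulN1r -(RintegralZl _ measurableT h2).
by apply: eq_Rintegral => x _; rewrite Im_conjc mulN1r.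
Qed.

Lemma complex_integrableZ (c : R[i]) h : complex_integrable h ->
  complex_integrable (fun x => c * h x).
Proof.
move=> [mh hoo]; split.
  by apply: complex_measurableM => //; exact: complex_measurable_cst.
under eq_integral do rewrite normcM EFinM.
rewrite ge0_integralZl//; first by rewrite lte_mul_pinfty// lee_fin normc_ge0.
- by apply/measurable_EFinP; exact: measurable_normc.
- by move=> x _; rewrite lee_fin normc_ge0.
- by rewrite lee_fin normc_ge0.
Qed.

(** Multiplying h by the conjugate phase of its integral makes the integral real and nonnegative; it
    is then the integral of a real part, which the modulus of h dominates. *)
Lemma normc_complex_integral h : complex_integrable h ->
  ((normc (complex_integral mu h))%:E <= \int[mu]_x (normc (h x))%:E)%E.
Proof.
move=> hi; set z := complex_integral mu h.
have [z0|z0] := eqVneq z 0.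
  by rewrite z0 normc0; apply: integral_ge0 => x _; rewrite lee_fin normc_ge0.
pose c := (unit_phase z)^*%C.
have chi := complex_integrableZ c hi.
have <- : complex.Re (complex_integral mu (fun x => c * h x)) = normc z.
  by rewrite complex_integralZ// mulrC unit_phase_conjc.
have [r1 _] := complex_integrable_ReIm chi.
have rn := complex_integrable_normc hi.
rewrite /= /Rintegral fineK; last exact: integrable_fin_num.
apply: le_integral => // x _; rewrite lee_fin.
apply: le_trans (ler_norm _) _; apply: le_trans (Re_le_normc _) _.
by rewrite normcM normc_conj normc_unit_phase// mul1r.
Qed.

End ComplexIntegral.

Section HaarComplexIntegral.
Context {R : realType} {G : topGroupType}.
Hypothesis lcG : locally_compact_group G.
Variable mu : {measure set (borel G) -> \bar R}.
Hypothesis haar : left_haar mu.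
Implicit Types h : G -> R[i].

Let limu : left_invariant mu. Proof. exact: haar_left_invariant. Qed.

Lemma integral_left_translate (f : borel G -> \bar R) (g : G) :
  measurable_fun setT f -> (\int[mu]_x f (g * x)%g = \int[mu]_x f x)%E.
Proof.
move=> mf; rewrite [LHS]integralE [RHS]integralE.
have mp := measurable_funepos mf; have mn := measurable_funeneg mf.
rewrite -(ge0_integral_left_invariant g limu mp); last exact: funepos_ge0.
rewrite -(ge0_integral_left_invariant g limu mn); last exact: funeneg_ge0.
by congr (_ - _)%E; apply: eq_integral => x _; rewrite ?funeposE ?funenegE.
Qed.

Lemma complex_integral_left_translate h (g : G) : complex_measurable h ->
  complex_integral mu (fun x => h (g * x)%g) = complex_integral mu h.
Proof.
move=> [h1 h2]; apply: complex_eqP => /=; rewrite /Rintegral; congr fine.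
  by apply: (integral_left_translate (f := fun x => (complex.Re (h x))%:E)); exact/measurable_EFinP.
by apply: (integral_left_translate (f := fun x => (complex.Im (h x))%:E)); exact/measurable_EFinP.
Qed.

Lemma integral_inversion (f : borel G -> R) (K : set G) : compact K ->
  measurable_fun setT f -> (forall x, ~ K x -> f x = 0) ->
  (\int[mu]_x (f x)%:E =
   \int[mu]_y (f (y^-1)%g * modular mu (y^-1)%g)%:E)%E.
Proof.
move=> cK mf fK; have mEf : measurable_fun setT (EFin \o f) by exact/measurable_EFinP.
have d0 y : 0 < modular mu y by exact: modular_gt0.
rewrite [LHS]integralE [RHS]integralE; congr (_ - _)%E.
  rewrite (haar_inversion lcG haar cK)//; last 2 first.
  - exact: measurable_funepos.
  - by move=> x /fK fx; rewrite funeposE /= fx maxxx.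
  apply: eq_integral => y _; rewrite !funeposE /= -!EFin_max -EFinM.
  by congr EFin; rewrite maxr_pMl ?mul0r ?ltW.
rewrite (haar_inversion lcG haar cK)//; last 2 first.
- exact: measurable_funeneg.
- by move=> x /fK fx; rewrite funenegE /= fx oppr0 maxxx.
apply: eq_integral => y _; rewrite !funenegE /= -!EFin_max -EFinM.
by congr EFin; rewrite maxr_pMl ?mul0r ?mulNr ?ltW.
Qed.

Lemma complex_integral_inversion h (K : set G) : compact K ->
  complex_measurable h -> (forall x, ~ K x -> h x = 0) ->
  complex_integral mu h =
  complex_integral mu (fun y => h (y^-1)%g * (modular mu (y^-1)%g)%:C%C).
Proof.
move=> cK [h1 h2] hK; apply: complex_eqP => /=; rewrite /Rintegral.
  rewrite (integral_inversion cK h1); last by move=> x /hK ->.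
  by congr fine; apply: eq_integral => y _; rewrite complex_ReM /= mulr0 subr0.
rewrite (integral_inversion cK h2); last by move=> x /hK ->.
by congr fine; apply: eq_integral => y _; rewrite complex_ImM /= mulr0 add0r.
Qed.

End HaarComplexIntegral.

(** * Local integrability and dependence on a parameter *)

Section Convolution.
Context {R : realType} {G : topGroupType}.
Hypothesis lcG : locally_compact_group G.
Variable mu : {measure set (borel G) -> \bar R}.
Hypothesis haar : left_haar mu.
Implicit Types f k : G -> R[i].

Let hG : hausdorff_space G. Proof. by case: lcG. Qed.
Let limu : left_invariant mu. Proof. exact: haar_left_invariant. Qed.
Let fmu : compact_finite mu. Proof. exact: haar_compact_finite. Qed.

Lemma CcP f : Cc f <-> continuous (f : G -> R[i]^o) /\
  exists2 K : set G, compact K & forall x, ~ K x -> f x = 0.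
Proof.
split=> [[cf cK]|[cf [K cK fK]]]; split => //.
  exists (closure [set x | f x != 0]) => // x nKx; apply/eqP.
  by apply: contrapT => /negP fx; apply: nKx; exact: subset_closure.
apply: (subclosed_compact _ cK); first exact: closed_closure.
have := compact_closed hG cK => /closure_id ->; apply: closureS => x /= fx.
by apply: contrapT => /fK; apply/eqP.
Qed.

(** The common home of L^q functions, for every q at least 1, and of bounded test functions: large
    enough for both, small enough for convolution with a C_c function to converge at every point. *)
Definition loc_integrable k : Prop := complex_measurable k /\
  forall K : set G, compact K ->
    (\int[mu]_(x in (K : set (borel G))) (normc (k x))%:E < +oo)%E.

Lemma mEnormc k : complex_measurable k ->
  measurable_fun setT (fun x : borel G => (normc (k x))%:E).
Proof. by move=> mk; apply/measurable_EFinP; exact: measurable_normc. Qed.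

Lemma continuous_complex_bounded f (K : set G) : continuous (f : G -> R[i]^o) ->
  compact K -> exists2 M : R, 0 < M & forall x, K x -> normc (f x) <= M.
Proof.
move=> /continuous_normc cf cK.
have [M M0 hM] := continuous_compact_bounded cf cK; exists M => // x Kx.
exact: le_trans (ler_norm _) (hM x Kx).
Qed.

Lemma loc_integrable_bounded k (M : R) : complex_measurable k ->
  (forall x, normc (k x) <= M) -> loc_integrable k.
Proof.
move=> mk kM; split => // K cK; have mK := compact_borel lcG cK.
apply: (@le_lt_trans _ _ (\int[mu]_(x in (K : set (borel G))) (cst M%:E) x)%E).
  apply: ge0_le_integral => //.
  - by move=> x _; rewrite lee_fin normc_ge0.
  - by apply: measurable_funTS; exact: mEnormc.
  - by move=> x _; rewrite lee_fin.
rewrite integral_cst// lte_mul_pinfty ?lee_fin//; last exact: fmu.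
exact: le_trans (normc_ge0 _) (kM 1%g).
Qed.

Lemma Cc_bounded f : Cc f -> exists2 M : R, 0 < M & forall x, normc (f x) <= M.
Proof.
move=> /CcP[cf [K cK fK]]; have [M M0 hM] := continuous_complex_bounded cf cK.
exists M => // x; have [/hM//|/fK ->] := pselect (K x).
by rewrite normc0 ltW.
Qed.

Lemma Cc_measurable f : Cc f -> complex_measurable f.
Proof. by move=> [cf _]; exact: continuous_complex_measurable. Qed.

Lemma Cc_loc_integrable f : Cc f -> loc_integrable f.
Proof.
move=> hf; have [M _ hM] := Cc_bounded hf.
by apply: (loc_integrable_bounded _ hM); exact: Cc_measurable.
Qed.

(** Inversion introduces the density Delta(y^-1). On a compact set Delta is at most some M, so this
    density is at least 1/M and can be inserted at the cost of a factor M. *)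
Lemma loc_integrable_inv k : loc_integrable k ->
  loc_integrable (fun z => k (z^-1)%g).
Proof.
move=> [mk kK]; have mkV : complex_measurable (fun z => k (z^-1)%g).
  by apply: complex_measurable_comp => //; exact: invg_continuous.
split => // K cK; have mK := compact_borel lcG cK.
pose KV := [set x : G | K (x^-1)%g]; have cKV : compact KV by exact: compact_invg.
have mKV := compact_borel lcG cKV.
have [M M0 hM] := continuous_compact_bounded (modular_continuous lcG haar) cK.
have d0 y : 0 < modular mu y by exact: modular_gt0.
pose g : borel G -> \bar R := (fun x : borel G => (normc (k x))%:E) \_ KV.
have mg : measurable_fun setT g.
  by apply/(measurable_restrictT _ mKV); apply: measurable_funTS; exact: mEnormc.
have g0 x : (0 <= g x)%E.
  by rewrite /g patchE; case: ifPn => // _; rewrite lee_fin normc_ge0.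
have gK x : ~ KV x -> g x = 0%E.
  by move=> nKx; rewrite /g patchE memNset.
have := haar_inversion lcG haar cKV mg g0 gK.
rewrite /g -integral_mkcond => e.
have fin := kK _ cKV; rewrite e in fin.
apply: (@le_lt_trans _ _ (M%:E * \int[mu]_y
   (g (y^-1)%g * (modular mu (y^-1)%g)%:E))%E); last first.
  by rewrite lte_mul_pinfty// lee_fin ltW.
have mgV : measurable_fun setT (fun y : borel G => (g (y^-1)%g * (modular mu (y^-1)%g)%:E)%E).
  apply: emeasurable_funM.
    apply: (measurableT_comp mg); apply: continuous_borel_map.
    exact: invg_continuous.
  apply/measurable_EFinP; apply: continuous_borel => y.
  have c := @invg_continuous G y.
  exact: (cvg_comp _ _ c (modular_continuous lcG haar (x := _))).
rewrite -ge0_integralZl//; last 2 first.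
- by move=> y _; rewrite mule_ge0// lee_fin ltW.
- by rewrite lee_fin ltW.
rewrite [leLHS]integral_mkcond; apply: ge0_le_integral => //.
- move=> x _; rewrite patchE; case: ifPn => // _.
  by rewrite lee_fin normc_ge0.
- apply/(measurable_restrictT _ mK); apply: measurable_funTS.
  exact: mEnormc.
- exact: emeasurable_funM.
move=> x _; rewrite patchE; case: ifPn => [|_]; last first.
  by rewrite mule_ge0 ?mule_ge0 ?lee_fin// ltW.
rewrite inE => Kx; rewrite /g patchE mem_set; last by rewrite /KV /= invgK.
rewrite -!EFinM lee_fin mulrCA ler_peMr ?normc_ge0//.
rewrite (modularV lcG haar) ler_pdivlMr// mul1r.
exact: le_trans (ler_norm _) (hM x Kx).
Qed.

Lemma complex_integrable_Cc_mul f k (L : set G) :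
  continuous (f : G -> R[i]^o) -> compact L -> (forall x, ~ L x -> f x = 0) ->
  loc_integrable k -> complex_integrable mu (fun z => f z * k z).
Proof.
move=> cf cL fL [mk kL]; have mf := continuous_complex_measurable cf.
have mL := compact_borel lcG cL.
split; first exact: complex_measurableM.
have [M M0 hM] := continuous_complex_bounded cf cL.
rewrite (integral_restr mu (K := L)); last first.
  by move=> x /fL ->; rewrite mul0r normc0.
apply: (@le_lt_trans _ _ (M%:E * \int[mu]_(z in (L : set (borel G))) (normc (k z))%:E)%E);
  last by rewrite lte_mul_pinfty ?lee_fin ?(ltW M0)//; exact: kL.
rewrite -ge0_integralZl//; last 3 first.
- by apply: measurable_funTS; exact: mEnormc.
- by move=> z _; rewrite lee_fin normc_ge0.
- by rewrite lee_fin ltW.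
apply: ge0_le_integral => //.
- by move=> z _; rewrite lee_fin normc_ge0.
- by apply: measurable_funTS; apply: mEnormc; exact: complex_measurableM.
- by apply: emeasurable_funM => //; apply: measurable_funTS; exact: mEnormc.
- by move=> z Lz; rewrite -EFinM lee_fin normcM ler_wpM2r ?normc_ge0// hM.
Qed.

Lemma loc_integrable_ReIm k (L : set (borel G)) : loc_integrable k ->
  compact (L : set G) ->
  mu.-integrable L (EFin \o (fun z => complex.Re (k z))) /\
  mu.-integrable L (EFin \o (fun z => complex.Im (k z))).
Proof.
move=> [mk kL] cL; have mL := compact_borel lcG cL; have [k1 k2] := mk.
have mn : measurable_fun L (fun z : borel G => (normc (k z))%:E).
  by apply: measurable_funTS; exact: mEnormc.
have m1 : measurable_fun L (fun z : borel G => (complex.Re (k z))%:E).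
  by apply: measurable_funTS; exact/measurable_EFinP.
have m2 : measurable_fun L (fun z : borel G => (complex.Im (k z))%:E).
  by apply: measurable_funTS; exact/measurable_EFinP.
split; apply/integrableP; split => //; apply: le_lt_trans (kL L cL);
  apply: ge0_le_integral => //.
- exact: measurableT_comp.
- by move=> x _; rewrite lee_fin Re_le_normc.
- exact: measurableT_comp.
- by move=> x _; rewrite lee_fin Im_le_normc.
Qed.

Lemma param_complex_continuous_at (F : G * G -> R[i]) k (x0 : G)
    (L : set (borel G)) :
  compact (L : set G) -> continuous (F : G * G -> R[i]^o) ->
  (\forall x \near x0, forall z, ~ L z -> F (x, z) = 0) ->
  loc_integrable k ->
  (complex_integral mu (fun z => F (x, z) * k z) : R[i]^o) @[x --> x0] -->
  (complex_integral mu (fun z => F (x0, z) * k z) : R[i]^o).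
Proof.
move=> cL cF FL hk; have mL := compact_borel lcG cL.
have [k1 k2] := loc_integrable_ReIm hk cL.
have cF1 : continuous (fun z => complex.Re (F z)).
  by move=> z; have /cvg_ReIm[] := cF z.
have cF2 : continuous (fun z => complex.Im (F z)).
  by move=> z; have /cvg_ReIm[] := cF z.
have F1 : \forall x \near x0, forall z, ~ L z -> complex.Re (F (x, z)) = 0.
  by apply: filterS FL => x h z /h ->.
have F2 : \forall x \near x0, forall z, ~ L z -> complex.Im (F (x, z)) = 0.
  by apply: filterS FL => x h z /h ->.
have P11 := param_continuous_at lcG cL cF1 F1 k1.
have P12 := param_continuous_at lcG cL cF1 F1 k2.
have P21 := param_continuous_at lcG cL cF2 F2 k1.
have P22 := param_continuous_at lcG cL cF2 F2 k2.
have int (h : G -> R) (j : borel G -> R) : continuous h -> (forall z, ~ L z -> h z = 0) ->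
    mu.-integrable L (EFin \o j) -> mu.-integrable setT (fun z => (h z * j z)%:E).
  move=> ch hL jL; have [M M0 hM] := continuous_compact_bounded ch cL.
  have iL : mu.-integrable L (fun z => (h z * j z)%:E).
    apply: (le_integrable mL _ _ (integrableZl mL M jL)).
      apply/measurable_EFinP; apply: measurable_funM.
        by apply: measurable_funTS; exact: continuous_borel.
      by apply/measurable_EFinP; exact: measurable_int jL.
    move=> z Lz /=; rewrite lee_fin !normrM ler_wpM2r// (le_trans (hM z Lz))//.
    exact: ler_norm.
  have := (integrable_mkcond _ mL).1 iL; congr (mu.-integrable _ _).
  by apply/funext => z; rewrite patchE; case: ifPn => // /negP; rewrite inE => /hL ->; rewrite mul0r.
have cx (h : G * G -> R) x : continuous h -> continuous (fun z => h (x, z)).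
  move=> ch z; have c : (x, w) @[w --> z] --> (x, z).
    by apply: cvg_pair; [exact: cvg_cst|exact: cvg_id].
  exact: (cvg_comp _ _ c (ch _)).
have ReE x : (forall z, ~ L z -> F (x, z) = 0) ->
    complex.Re (complex_integral mu (fun z => F (x, z) * k z)) =
    \int[mu]_z (complex.Re (F (x, z)) * complex.Re (k z)) -
    \int[mu]_z (complex.Im (F (x, z)) * complex.Im (k z)).
  move=> FxL; rewrite /= -RintegralB//.
  - by apply: eq_Rintegral => z _; rewrite complex_ReM.
  - by apply: int => //; [exact: (cx _ _ cF1)|move=> z /FxL ->].
  - by apply: int => //; [exact: (cx _ _ cF2)|move=> z /FxL ->].
have ImE x : (forall z, ~ L z -> F (x, z) = 0) ->
    complex.Im (complex_integral mu (fun z => F (x, z) * k z)) =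
    \int[mu]_z (complex.Re (F (x, z)) * complex.Im (k z)) +
    \int[mu]_z (complex.Im (F (x, z)) * complex.Re (k z)).
  move=> FxL; rewrite /= -RintegralD//.
  - by apply: eq_Rintegral => z _; rewrite complex_ImM.
  - by apply: int => //; [exact: (cx _ _ cF1)|move=> z /FxL ->].
  - by apply: int => //; [exact: (cx _ _ cF2)|move=> z /FxL ->].
have FL0 := nbhs_singleton FL.
apply/cvg_ReIm; rewrite (ReE _ FL0) (ImE _ FL0); split.
  apply: cvg_trans (cvgB P11 P22); apply: near_eq_cvg.
  by apply: filterS FL => x /ReE ->.
apply: cvg_trans (cvgD P12 P21); apply: near_eq_cvg.
by apply: filterS FL => x /ImE ->.
Qed.

End Convolution.

(** * Convolution and involution *)

Section ConvolutionAlgebra.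
Context {R : realType} {G : topGroupType}.
Hypothesis lcG : locally_compact_group G.
Variable mu : {measure set (borel G) -> \bar R}.
Hypothesis haar : left_haar mu.
Implicit Types f g k : G -> R[i].

Let fmu : compact_finite mu. Proof. exact: haar_compact_finite. Qed.

Lemma continuous_prod_fst : continuous (fst : G * G -> G).
Proof. by move=> z; exact: cvg_fst. Qed.

Lemma continuous_prod_snd : continuous (snd : G * G -> G).
Proof. by move=> z; exact: cvg_snd. Qed.

Lemma continuous_prod_mulg f : continuous (f : G -> R[i]^o) ->
  continuous ((fun z : G * G => f (z.1 * z.2)%g) : G * G -> R[i]^o).
Proof.
move=> cf z.
have c3 := continuous_mulg2 continuous_prod_fst continuous_prod_snd.
exact: (cvg_comp _ _ (c3 z) (cf _)).
Qed.

(** After y = x z only the factor f depends on x. The second factor may then be merely measurable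
    while the integral is still continuous in x. *)
Lemma convolutionE f k (x : G) : complex_measurable f -> complex_measurable k ->
  convolution mu f k x =
  complex_integral mu (fun z => f (x * z)%g * k (z^-1)%g).
Proof.
move=> mf mk; rewrite /convolution.
rewrite -(complex_integral_left_translate haar x); last first.
  apply: complex_measurableM => //; apply: complex_measurable_comp => //.
  apply: continuous_mulg2; first exact: invg_continuous.
  by move=> y; exact: cvg_cst.
by apply: eq_complex_integral => z; rewrite tinvgM mulgVK.
Qed.

Lemma convolution_continuous f k : Cc f -> loc_integrable mu k ->
  continuous (convolution mu f k : G -> R[i]^o).
Proof.
move=> hf hk x0; have [cf [K cK fK]] := (CcP lcG f).1 hf.
have mf := Cc_measurable hf; have [mk _] := hk.
have [W cW x0W] := lcompact_nbhs lcG x0.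
(* For x in W, the condition that x z is in K places z in W^-1 K. *)
pose L : set (borel G) := setmulg [set x | W (x^-1)%g] K.
have cL : compact (L : set G).
  by apply: compact_setmulg => //; exact: compact_invg.
have -> : (convolution mu f k : G -> R[i]^o) = fun x =>
    complex_integral mu (fun z => f (x * z)%g * k (z^-1)%g).
  by apply/funext => x; exact: convolutionE.
pose F (z : G * G) := f (z.1 * z.2)%g.
have cF : continuous (F : G * G -> R[i]^o) by exact: continuous_prod_mulg.
have hkV := loc_integrable_inv lcG haar hk.
have FL : \forall x \near x0, forall z, ~ L z -> F (x, z) = 0.
  apply: filterS x0W => x Wx z nLz; apply: fK => Kxz; apply: nLz.
  by exists (x^-1)%g; rewrite /= ?invgK//; exists (x * z)%g => //; rewrite mulKg.
exact: (param_complex_continuous_at lcG cL cF FL hkV).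
Qed.

Lemma convolution_eq0 f g (K L : set G) (x : G) : (forall y, ~ K y -> f y = 0) ->
  (forall y, ~ L y -> g y = 0) -> ~ setmulg K L x -> convolution mu f g x = 0.
Proof.
move=> fK gL nKL; rewrite /convolution (eq_complex_integral mu (h' := fun=> 0)).
  by apply: complex_eqP => /=; rewrite /Rintegral integral0.
move=> y; have [Ky|/fK ->] := pselect (K y); last by rewrite mul0r.
rewrite gL ?mulr0// => Lyx; apply: nKL; exists y => //.
by exists (y^-1 * x)%g => //; rewrite mulVKg.
Qed.

Lemma convolution_Cc f g : Cc f -> Cc g -> Cc (convolution mu f g).
Proof.
move=> hf hg; apply/(CcP lcG); split.
  by apply: convolution_continuous => //; exact: Cc_loc_integrable.
have [_ [K cK fK]] := (CcP lcG f).1 hf; have [_ [L cL gL]] := (CcP lcG g).1 hg.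
exists (setmulg K L); first exact: compact_setmulg.
by move=> x; exact: convolution_eq0.
Qed.

Lemma Cc_linear (c : R[i]) f g : Cc f -> Cc g -> Cc (fun x => c * f x + g x).
Proof.
move=> /(CcP lcG)[cf [K cK fK]] /(CcP lcG)[cg [L cL gL]].
apply/(CcP lcG); split.
  have [f1 f2] := continuous_ReIm cf; have [g1 g2] := continuous_ReIm cg.
  apply: continuous_complex => x.
    rewrite (_ : (fun x => _) = fun x => complex.Re c * complex.Re (f x) -
        complex.Im c * complex.Im (f x) + complex.Re (g x)).
      apply: cvgD; last exact: g1.
      by apply: cvgB; apply: cvgM; (exact: cvg_cst || exact: f1 || exact: f2).
    by apply/funext => y; rewrite raddfD /= complex_ReM.
  rewrite (_ : (fun x => _) = fun x => complex.Re c * complex.Im (f x) +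
      complex.Im c * complex.Re (f x) + complex.Im (g x)).
    apply: cvgD; last exact: g2.
    by apply: cvgD; apply: cvgM; (exact: cvg_cst || exact: f1 || exact: f2).
  by apply/funext => y; rewrite raddfD /= complex_ImM.
exists (K `|` L); first exact: compactU.
move=> x nKL; rewrite fK ?gL ?mulr0 ?addr0// => ?; apply: nKL; [by right|by left].
Qed.

Lemma involution_Cc f : Cc f -> Cc (involution mu f).
Proof.
move=> /(CcP lcG)[cf [K cK fK]]; apply/(CcP lcG); split; last first.
  exists [set x : G | K (x^-1)%g]; first exact: compact_invg.
  by move=> x nKx; rewrite /involution fK// conjc0 mulr0.
have [f1 f2] := continuous_ReIm cf.
have cd : continuous (fun x : G => modular mu (x^-1)%g).
  move=> x; have c := @invg_continuous G x.
  exact: (cvg_comp _ _ c (modular_continuous lcG haar (x := _))).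
have cV (h : G -> R) : continuous h -> continuous (fun x : G => h (x^-1)%g).
  by move=> ch x; have c := @invg_continuous G x; exact: (cvg_comp _ _ c (ch _)).
apply: continuous_complex => x.
  rewrite (_ : (fun x => _) = fun x : G =>
      modular mu (x^-1)%g * complex.Re (f (x^-1)%g)).
    by apply: cvgM; [exact: cd|exact: (cV _ f1)].
  apply/funext => y; rewrite /involution complex_ReM /= mul0r subr0.
  by rewrite Re_conjc.
rewrite (_ : (fun x => _) = fun x : G =>
    modular mu (x^-1)%g * - complex.Im (f (x^-1)%g)).
  by apply: cvgM; [exact: cd|apply: cvgN; exact: (cV _ f2)].
apply/funext => y; rewrite /involution complex_ImM /= mul0r addr0.
by rewrite Im_conjc.
Qed.

Lemma involutionK f : involution mu (involution mu f) = f.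
Proof.
apply/funext => x; rewrite /involution invgK conjcM conjc_real conjcK mulrA.
rewrite -rmorphM (modularV lcG haar) mulVf ?rmorph1 ?mul1r//.
by rewrite gt_eqF// modular_gt0.
Qed.

Lemma involution_linear (c : R[i]) f g :
  involution mu (fun x => c * f x + g x) =
  fun x => (c^*)%C * involution mu f x + involution mu g x.
Proof.
by apply/funext => x; rewrite /involution conjcD conjcM mulrDr mulrCA.
Qed.

(** With [convolutionE] on the right-hand side the integrands agree pointwise, since the two modular
    factors multiply to Delta(x^-1). *)
Lemma involution_convolution f g : Cc f -> Cc g ->
  involution mu (convolution mu f g) =
  convolution mu (involution mu g) (involution mu f).
Proof.
move=> hf hg; have mf := Cc_measurable hf; have mg := Cc_measurable hg.
have hf' := involution_Cc hf; have hg' := involution_Cc hg.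
have mf' := Cc_measurable hf'; have mg' := Cc_measurable hg'.
apply/funext => x; rewrite convolutionE// {1}/involution /convolution.
have gi : complex_integrable mu (fun y => f y * g (y^-1 * x^-1)%g).
  have [cf [K cK fK]] := (CcP lcG f).1 hf.
  apply: (complex_integrable_Cc_mul lcG cf cK fK).
  have [M _ hM] := Cc_bounded lcG hg.
  apply: (loc_integrable_bounded lcG haar (M := M)) => //.
  apply: complex_measurable_comp => //.
  apply: continuous_mulg2; first exact: invg_continuous.
  by move=> y; exact: cvg_cst.
have gi' : complex_integrable mu (fun y => (f y * g (y^-1 * x^-1)%g)^*%C).
  have [[m1 m2] h] := gi; split; first exact: complex_measurable_conj.
  by under eq_integral do rewrite normc_conj.
rewrite -complex_integral_conj// -complex_integralZ//.
apply: eq_complex_integral => z; rewrite /involution conjcM tinvgM !invgK.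
have e : modular mu (z^-1 * x^-1)%g * modular mu z = modular mu (x^-1)%g.
  rewrite (modularM lcG haar) mulrAC -(modularM lcG haar) mulVg.
  by rewrite (modular1 lcG haar) mul1r.
rewrite [RHS]mulrACA -(rmorphM (real_complex R)) e.
by rewrite (mulrC (g _)^*%C).
Qed.

End ConvolutionAlgebra.

(** * The adjoint of convolution under the pairing of functions *)

Section Pairing.
Context {R : realType} {G : topGroupType}.
Hypothesis lcG : locally_compact_group G.
Variable mu : {measure set (borel G) -> \bar R}.
Hypothesis haar : left_haar mu.
Implicit Types f k eta xi : G -> R[i].

Let fmu : compact_finite mu. Proof. exact: haar_compact_finite. Qed.

Lemma complex_fubini (Phi : borel G * borel G -> R[i]) (K L : set G) :
  compact K -> compact L ->
  measurable_fun setT (fun z => complex.Re (Phi z)) ->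
  measurable_fun setT (fun z => complex.Im (Phi z)) ->
  (forall x y, ~ (K x /\ L y) -> Phi (x, y) = 0) ->
  (forall x, complex_integrable mu (fun y => Phi (x, y))) ->
  (forall y, complex_integrable mu (fun x => Phi (x, y))) ->
  (\int[mu]_x \int[mu]_y (normc (Phi (x, y)))%:E < +oo)%E ->
  complex_integral mu (fun x => complex_integral mu (fun y => Phi (x, y))) =
  complex_integral mu (fun y => complex_integral mu (fun x => Phi (x, y))).
Proof.
move=> cK cL m1 m2 PKL i1 i2 Poo.
have mK := compact_borel lcG cK; have mL := compact_borel lcG cL.
have mn : measurable_fun setT (fun z => normc (Phi z)).
  rewrite (_ : (fun x => _) = (fun z =>
      Num.sqrt (complex.Re (Phi z) ^+ 2 + complex.Im (Phi z) ^+ 2))); last first.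
    by apply/funext => z; case: (Phi z).
  apply: (measurableT_comp (continuous_measurable_fun (@sqrt_continuous R))).
  by apply: measurable_funD; exact: measurable_funX.
have key (p : R[i] -> R) : p 0 = 0 -> (forall z, `|p z| <= normc z) ->
    measurable_fun setT (fun z => p (Phi z)) ->
    (forall x, mu.-integrable setT (fun y => (p (Phi (x, y)))%:E)) ->
    (forall y, mu.-integrable setT (fun x => (p (Phi (x, y)))%:E)) ->
    \int[mu]_x \int[mu]_y p (Phi (x, y)) = \int[mu]_y \int[mu]_x p (Phi (x, y)).
  move=> p0 pn mp ip1 ip2; rewrite /Rintegral; congr fine.
  under eq_integral do rewrite fineK ?integrable_fin_num//.
  under [RHS]eq_integral do rewrite fineK ?integrable_fin_num//.
  have mEp : measurable_fun setT (fun z => (p (Phi z))%:E) by exact/measurable_EFinP.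
  apply: (@finite_support_fubini _ _ (borel G) (borel G) R mu mu K L mK mL
    (fmu cK) (fmu cL) (fun z => (p (Phi z))%:E)) => //.
    by move=> x y /PKL ->; rewrite p0.
  apply: le_lt_trans Poo; apply: ge0_le_integral => //.
  - by move=> x _; apply: integral_ge0 => y _; rewrite lee_fin.
  - apply: (@finite_support_measurable _ _ (borel G) (borel G) R mu K L mL
      (fmu cL) (fun z => `|(p (Phi z))%:E|%E)) => //.
      exact: measurableT_comp.
    by move=> x y /PKL ->; rewrite p0 abse0.
  - apply: (@finite_support_measurable _ _ (borel G) (borel G) R mu K L mL
      (fmu cL) (fun z => (normc (Phi z))%:E)) => //.
    + exact/measurable_EFinP.
    + by move=> x y /PKL ->; rewrite normc0.
    + by move=> z; rewrite lee_fin normc_ge0.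
  - move=> x _; apply: ge0_le_integral => //.
    + exact: measurableT_comp (measurable_int _ (ip1 x)).
    + exact: measurable_int (complex_integrable_normc (i1 x)).
    + by move=> y _; rewrite lee_fin.
apply: complex_eqP => /=.
  apply: (key (@complex.Re R)) => //; first exact: Re_le_normc.
    by move=> x; have [] := complex_integrable_ReIm (i1 x).
  by move=> x; have [] := complex_integrable_ReIm (i2 x).
apply: (key (@complex.Im R)) => //; first exact: Im_le_normc.
  by move=> x; have [] := complex_integrable_ReIm (i1 x).
by move=> x; have [] := complex_integrable_ReIm (i2 x).
Qed.

(* The functions against which L^q norms are computed by duality. *)
Definition test_function xi : Prop := [/\ complex_measurable xi,
  exists M : R, forall x, normc (xi x) <= M &
  exists2 K : set G, compact K & forall x, ~ K x -> xi x = 0].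

Lemma test_function_conj xi : test_function xi ->
  test_function (fun x => (xi x)^*%C).
Proof.
move=> [mx [M xM] [K cK xK]]; split; first exact: complex_measurable_conj.
  by exists M => x; rewrite normc_conj.
by exists K => // x /xK ->; rewrite conjc0.
Qed.

Lemma test_function_loc_integrable xi : test_function xi -> loc_integrable mu xi.
Proof.
by move=> [mx [M xM] _]; exact: (loc_integrable_bounded lcG haar mx xM).
Qed.

Lemma convolution_pairing f eta xi : Cc f -> loc_integrable mu eta ->
  test_function xi ->
  complex_integral mu
    (fun x => convolution mu (involution mu f) eta x * (xi x)^*%C) =
  complex_integral mu (fun z => eta z * (convolution mu f xi z)^*%C).
Proof.
move=> hf heta hxi; have [meta _] := heta; have mf := Cc_measurable hf.
have [mxi [Mx xM] [K cK xK]] := hxi.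
have lxi' := test_function_loc_integrable (test_function_conj hxi).
pose f' := involution mu f; have hf' : Cc f' by exact: involution_Cc.
have mf' := Cc_measurable hf'.
have [cf' [K' cK' f'K]] := (CcP lcG f').1 hf'.
have [Mf Mf0 fM] := Cc_bounded lcG hf'.
have hetaV := loc_integrable_inv lcG haar heta.
have [metaV etaV] := hetaV.
(* If x lies in the support K of xi and x z in the support K' of f', then z lies in K^-1 K'. So the
   double integrand vanishes off K times L. *)
pose L := setmulg [set x | K (x^-1)%g] K'.
have cL : compact L by apply: compact_setmulg => //; exact: compact_invg.
have mK := compact_borel lcG cK; have mL := compact_borel lcG cL.
have KL x z : K x -> f' (x * z)%g != 0 -> L z.
  move=> Kx fxz; exists (x^-1)%g; rewrite /= ?invgK//.
  exists (x * z)%g; last by rewrite mulKg.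
  by apply: contrapT => /f'K; apply/eqP.
pose F (z : G * G) := f' (z.1 * z.2)%g.
have cF : continuous (F : G * G -> R[i]^o) by exact: continuous_prod_mulg.
pose Phi (z : borel G * borel G) : R[i] :=
  F z * (eta (z.2^-1)%g * (xi z.1)^*%C).
have PKL x y : ~ (K x /\ L y) -> Phi (x, y) = 0.
  move=> nKL; rewrite /Phi /F /=; have [Kx|/xK ->] := pselect (K x); last first.
    by rewrite conjc0 !mulr0.
  have [->|fxy] := eqVneq (f' (x * y)%g) 0; first by rewrite mul0r.
  by exfalso; apply: nKL; split => //; exact: KL fxy.
have mPhi : measurable_fun setT (fun z => complex.Re (Phi z)) /\
            measurable_fun setT (fun z => complex.Im (Phi z)).
  have mKL : measurable (K `*` L : set (borel G * borel G)) by exact: measurableX.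
  (* F is continuous on the product group but perhaps not product measurable there. Cut to the
     compact rectangle it is, and the cut does not change [Phi]. *)
  pose FKL (z : borel G * borel G) := if z \in K `*` L then F z else 0.
  have e : Phi = fun z => FKL z * (eta (z.2^-1)%g * (xi z.1)^*%C).
    apply/funext => -[x y]; rewrite /FKL; case: ifPn => // /negP; rewrite inE => nKL.
    by rewrite PKL// mul0r.
  have Fr (p : R[i] -> R) : p 0 = 0 -> continuous (fun z => p (F z)) ->
      measurable_fun setT (fun z : borel G * borel G => p (FKL z)).
    move=> p0 cpF; have := continuous_prod_measurable lcG cpF cK cL.
    move/(measurable_restrictT _ mKL); congr measurable_fun.
    by apply/funext => z; rewrite patchE /FKL; case: ifPn.
  have cF1 : continuous (fun z => complex.Re (F z)).
    by move=> z; have /cvg_ReIm[] := cF z.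
  have cF2 : continuous (fun z => complex.Im (F z)).
    by move=> z; have /cvg_ReIm[] := cF z.
  have [a1 a2] := metaV; have [b1 b2] := complex_measurable_conj mxi.
  have [c1 c2] := measurable_complexM
    (measurableT_comp a1 (measurable_snd : measurable_fun setT (snd : borel G * borel G -> borel G)))
    (measurableT_comp a2 (measurable_snd : measurable_fun setT (snd : borel G * borel G -> borel G)))
    (measurableT_comp b1 (measurable_fst : measurable_fun setT (fst : borel G * borel G -> borel G)))
    (measurableT_comp b2 (measurable_fst : measurable_fun setT (fst : borel G * borel G -> borel G))).
  rewrite e; apply: measurable_complexM; [exact: (Fr (@complex.Re R))|exact: (Fr (@complex.Im R))|exact: c1|exact: c2].
have iz x : complex_integrable mu (fun z => f' (x * z)%g * eta (z^-1)%g).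
  apply: (complex_integrable_Cc_mul lcG (L := (fun z => x^-1 * z)%g @` K')).
  - by move=> z; exact: (cvg_comp _ _ (continuous_mulgl (g := x) (x := z)) (cf' _)).
  - by apply: compact_image => //; exact: continuous_mulgl.
  - move=> z nz; apply: f'K => Kxz; apply: nz.
    by exists (x * z)%g => //; rewrite mulKg.
  - exact: hetaV.
have ix z : complex_integrable mu (fun x => f' (x * z)%g * (xi x)^*%C).
  apply: (complex_integrable_Cc_mul lcG (L := (fun x => x * z^-1)%g @` K')).
  - by move=> x; exact: (cvg_comp _ _ (continuous_mulgr (g := z) (x := x)) (cf' _)).
  - by apply: compact_image => //; exact: continuous_mulgr.
  - move=> x nx; apply: f'K => Kxz; apply: nx.
    by exists (x * z)%g => //; rewrite mulgK.
  - exact: lxi'.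
have i1 x : complex_integrable mu (fun z => Phi (x, z)).
  have := complex_integrableZ (xi x)^*%C (iz x); congr complex_integrable.
  by apply/funext => z; rewrite /Phi /F /= mulrC mulrA.
have i2 z : complex_integrable mu (fun x => Phi (x, z)).
  have := complex_integrableZ (eta (z^-1)%g) (ix z); congr complex_integrable.
  by apply/funext => x; rewrite /Phi /F /= mulrCA.
pose c := (\int[mu]_(z in (L : set (borel G))) (normc (eta (z^-1)%g))%:E)%E.
have coo : (c < +oo)%E by exact: etaV.
have c0 : (0 <= c)%E by apply: integral_ge0 => z _; rewrite lee_fin normc_ge0.
have Poo : (\int[mu]_x \int[mu]_y (normc (Phi (x, y)))%:E < +oo)%E.
  have Mx0 : 0 <= Mx by apply: le_trans (xM 1%g); exact: normc_ge0.
  have inner x : (\int[mu]_y (normc (Phi (x, y)))%:E <= (Mf * Mx)%:E * c)%E.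
    rewrite (integral_restr mu (K := L)); last first.
      by move=> y nLy; rewrite PKL ?normc0// => -[].
    have mn : measurable_fun setT (fun z : borel G => (normc (eta (z^-1)%g))%:E).
      by apply: mEnormc.
    rewrite /c -ge0_integralZl//; last 3 first.
    - exact: measurable_funTS.
    - by move=> y _; rewrite lee_fin normc_ge0.
    - by rewrite lee_fin mulr_ge0// ltW.
    apply: ge0_le_integral => //.
    - by move=> y _; rewrite lee_fin normc_ge0.
    - apply: measurable_funTS; apply: mEnormc; by have [] := i1 x.
    - by apply: emeasurable_funM => //; exact: measurable_funTS.
    - move=> y _; rewrite -EFinM lee_fin /Phi (normcM (F _)) (normcM (eta _)) normc_conj.
      rewrite mulrCA.
      rewrite [leRHS]mulrC ler_wpM2l ?normc_ge0//.
      by apply: ler_pM; [exact: normc_ge0|exact: normc_ge0|exact: fM|exact: xM].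
  have innerK x : ~ K x -> (\int[mu]_y (normc (Phi (x, y)))%:E = 0)%E.
    by move=> nKx; apply: integral0_eq => y _; rewrite PKL ?normc0// => -[].
  rewrite (integral_restr mu innerK).
  apply: (@le_lt_trans _ _ (\int[mu]_(x in (K : set (borel G))) (cst ((Mf * Mx)%:E * c)%E) x)%E).
    apply: ge0_le_integral => //.
    - by move=> x _; apply: integral_ge0 => y _; rewrite lee_fin normc_ge0.
    - apply: measurable_funTS.
      apply: (@finite_support_measurable _ _ (borel G) (borel G) R mu K L mL
        (fmu cL) (fun z => (normc (Phi z))%:E)).
      + apply/measurable_EFinP; have [m1 m2] := mPhi.
        rewrite (_ : (fun x => _) = (fun z =>
            Num.sqrt (complex.Re (Phi z) ^+ 2 + complex.Im (Phi z) ^+ 2))); last first.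
          by apply/funext => z; case: (Phi z).
        apply: (measurableT_comp (continuous_measurable_fun (@sqrt_continuous R))).
        by apply: measurable_funD; exact: measurable_funX.
      + by move=> x y /PKL ->; rewrite normc0.
      + by move=> z; rewrite lee_fin normc_ge0.
  have cE : c = (fine c)%:E by rewrite fineK// ge0_fin_numE.
  rewrite cE -EFinM integral_cst//.
  apply: lte_mul_pinfty => //; last exact: fmu.
  by rewrite lee_fin !mulr_ge0 ?fine_ge0// ltW.
(* Continuity of [A] supplies the measurability in z that the coming inversion of the outer integral
   requires. *)
pose A z := complex_integral mu (fun x => f' (x * z)%g * (xi x)^*%C).
have cA : continuous (A : G -> R[i]^o).
  move=> z0; have [W cW z0W] := lcompact_nbhs lcG z0.
  pose S : set (borel G) := setmulg K' [set x | W (x^-1)%g].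
  have cS : compact (S : set G) by apply: compact_setmulg => //; exact: compact_invg.
  pose F' (z : G * G) := f' (z.2 * z.1)%g.
  have cF'' : continuous (F' : G * G -> R[i]^o).
    move=> z; have c3 := continuous_mulg2 (@continuous_prod_snd G) (@continuous_prod_fst G).
    exact: (cvg_comp _ _ (c3 z) (cf' _)).
  have F'L : \forall x \near z0, forall z, ~ S z -> F' (x, z) = 0.
    apply: filterS z0W => z Wz x nSx; apply: f'K => Kxz; apply: nSx.
    by exists (x * z)%g => //; exists (z^-1)%g; rewrite /= ?invgK ?mulgK.
  exact: (param_complex_continuous_at lcG cS cF'' F'L lxi').
transitivity (complex_integral mu (fun x => complex_integral mu (fun z => Phi (x, z)))).
  apply: eq_complex_integral => x; rewrite convolutionE// mulrC -complex_integralZ//.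
  by apply: eq_complex_integral => z; rewrite /Phi /F /= mulrC mulrA.
rewrite (complex_fubini cK cL mPhi.1 mPhi.2 PKL i1 i2 Poo).
have AE z : complex_integral mu (fun x => Phi (x, z)) = eta (z^-1)%g * A z.
  rewrite /A -complex_integralZ//.
  by apply: eq_complex_integral => x; rewrite /Phi /F /= mulrCA.
under eq_complex_integral do rewrite AE.
rewrite (complex_integral_inversion lcG haar cL); last 2 first.
- by apply: complex_measurableM => //; exact: continuous_complex_measurable.
- move=> z nLz; rewrite -AE (eq_complex_integral mu (h' := fun=> 0)).
    by apply: complex_eqP => /=; rewrite /Rintegral integral0.
  by move=> x; rewrite PKL// => -[].
apply: eq_complex_integral => z; rewrite invgK -mulrA; congr (_ * _).
have ih : complex_integrable mu (fun y => f (z * y)%g * xi (y^-1)%g).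
  have [cf [Kf cKf fK]] := (CcP lcG f).1 hf.
  apply: (complex_integrable_Cc_mul lcG (L := (fun y => z^-1 * y)%g @` Kf)).
  - by move=> y; exact: (cvg_comp _ _ (continuous_mulgl (g := z) (x := y)) (cf _)).
  - by apply: compact_image => //; exact: continuous_mulgl.
  - move=> y ny; apply: fK => Kxz; apply: ny.
    by exists (z * y)%g => //; rewrite mulKg.
  - by apply: loc_integrable_inv => //; exact: test_function_loc_integrable.
rewrite convolutionE// -complex_integral_conj//.
(* A second inversion, y = x^-1, now inside the convolution. The modular factors of the two
   inversions and of the involution combine through Delta(z^-1) Delta(z x^-1) = Delta(x^-1). *)
rewrite [RHS](complex_integral_inversion lcG haar (K := [set x : G | K (x^-1)%g])); last 3 first.
- exact: compact_invg.
- by apply: complex_measurable_conj; have [] := ih.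
- by move=> y nK; rewrite xK// mulr0 conjc0.
rewrite mulrC /A -complex_integralZ//; apply: eq_complex_integral => x.
have e : modular mu (z^-1)%g * modular mu (z * x^-1)%g = modular mu (x^-1)%g.
  by rewrite -(modularM lcG haar) mulKg.
rewrite /f' /involution tinvgM !invgK conjcM -e rmorphM.
by rewrite [RHS]mulrC !mulrA.
Qed.

End Pairing.

(** * Duality of L^p norms *)

(** Since the inverse of +oo is 0, an exponent equal to 1 forces the other to be infinite; two
    finite conjugate exponents therefore both exceed 1. *)
Lemma conjugate_exponentsP (R : realType) (p q : \bar R) :
  (1 <= p)%E -> (1 <= q)%E -> (p^-1 + q^-1 = 1)%E ->
  [\/ p = 1%E /\ q = +oo%E, p = +oo%E /\ q = 1%E |
      exists r s : R, [/\ p = r%:E, q = s%:E, 1 < r, 1 < s & r^-1 + s^-1 = 1]].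
Proof.
case: p => [r| |]; case: q => [s| |] //= r1 s1; last first.
- by rewrite invey add0e => /esym/eqP; rewrite onee_eq0.
- by rewrite invey add0e => /eqP; rewrite inve_eq1 => /eqP ->; constructor 2.
- by rewrite invey adde0 => /eqP; rewrite inve_eq1 => /eqP ->; constructor 1.
rewrite !lee_fin in r1 s1.
have r0 : 0 < r by exact: lt_le_trans ltr01 r1.
have s0 : 0 < s by exact: lt_le_trans ltr01 s1.
rewrite !inver !gt_eqF// -EFinD => -[e]; constructor 3; exists r, s.
have rV0 : r^-1 != 0 by rewrite invr_eq0 gt_eqF.
have sV0 : s^-1 != 0 by rewrite invr_eq0 gt_eqF.
split => //; rewrite lt_neqAle ?r1 ?s1 andbT; apply/eqP => e1; move: e.
  by rewrite -e1 invr1 -[RHS]addr0 => /addrI/eqP; exact/negP.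
by rewrite -e1 invr1 -[RHS]add0r => /addIr/eqP; exact/negP.
Qed.

Section LpDuality.
Context {R : realType} {G : topGroupType}.
Hypothesis lcG : locally_compact_group G.
Variable mu : {measure set (borel G) -> \bar R}.
Hypothesis haar : left_haar mu.
Implicit Types f h k eta xi : G -> R[i].

Let fmu : compact_finite mu. Proof. exact: haar_compact_finite. Qed.

Lemma LpNormE (p : \bar R) xi :
  LpNorm mu p xi = Lnorm mu p (fun x : borel G => (normc (xi x))%:E).
Proof. by apply: eq_Lnorm => x; rewrite complex_normE. Qed.

Lemma LpNorm_real (r : R) xi :
  LpNorm mu r%:E xi = ((\int[mu]_x ((normc (xi x)) `^ r)%:E) `^ r^-1)%E.
Proof.
rewrite LpNormE unlock; congr poweR; apply: eq_integral => x _.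
by rewrite gee0_abs ?lee_fin ?normc_ge0.
Qed.

Lemma LpNorm1 xi : LpNorm mu 1%E xi = (\int[mu]_x (normc (xi x))%:E)%E.
Proof.
rewrite LpNorm_real invr1 poweRe1; last first.
  by apply: integral_ge0 => x _; rewrite lee_fin powR_ge0.
by apply: eq_integral => x _; rewrite powRr1 ?normc_ge0.
Qed.

Lemma LpNorm_real_le (r C : R) xi : 0 < r -> 0 <= C ->
  (LpNorm mu r%:E xi <= C%:E)%E <->
  (\int[mu]_x ((normc (xi x)) `^ r)%:E <= (C `^ r)%:E)%E.
Proof.
move=> r0 C0; rewrite LpNorm_real.
have i0 : (0 <= \int[mu]_x ((normc (xi x)) `^ r)%:E)%E.
  by apply: integral_ge0 => x _; rewrite lee_fin powR_ge0.
split=> [le|le].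
  have -> : (\int[mu]_x ((normc (xi x)) `^ r)%:E =
      ((\int[mu]_x ((normc (xi x)) `^ r)%:E) `^ r^-1) `^ r)%E.
    by rewrite -poweRrM mulVf ?gt_eqF// poweRe1.
  rewrite -poweR_EFin; apply: gt0_ler_poweR => //; first exact: ltW.
  - by rewrite in_itv /= leey andbT poweR_ge0.
  - by rewrite in_itv /= leey andbT lee_fin.
have -> : C%:E = ((C `^ r)%:E `^ r^-1)%E.
  by rewrite poweR_EFin -powRrM mulfV ?gt_eqF// powRr1.
apply: gt0_ler_poweR => //; first by rewrite invr_ge0 ltW.
- by rewrite in_itv /= leey andbT.
- by rewrite in_itv /= leey andbT lee_fin powR_ge0.
Qed.

Lemma LpNorm_infty xi :
  LpNorm mu +oo xi = ess_sup mu (fun x : borel G => (normc (xi x))%:E).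
Proof.
rewrite LpNormE unlock ifT; last first.
  by rewrite lt0e measure_ge0 andbT; exact: haar_nontrivial.
congr ess_sup; apply/funext => x.
by rewrite /comp gee0_abs ?lee_fin ?normc_ge0.
Qed.

(** A compact set has finite measure, so for a finite exponent r the bound t <= 1 + t^r suffices
    there. *)
Lemma LpNorm_loc_integrable (q : \bar R) eta : (1 <= q)%E ->
  complex_measurable eta -> (LpNorm mu q eta <= 1)%E -> loc_integrable mu eta.
Proof.
move=> q1 meta H; split => // K cK; have mK := compact_borel lcG cK.
have mn : measurable_fun (K : set (borel G)) (fun x : borel G => (normc (eta x))%:E).
  by apply: measurable_funTS; exact: mEnormc.
case: q q1 H => [r| |] // r1.
  rewrite lee_fin in r1; have r0 : 0 < r by exact: lt_le_trans ltr01 r1.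
  move=> /(LpNorm_real_le _ r0 ler01); rewrite powR1 => le1.
  have mp : measurable_fun setT (fun x : borel G => ((normc (eta x)) `^ r)%:E).
    apply/measurable_EFinP; apply: (measurableT_comp (measurable_powR r)).
    exact: measurable_normc.
  apply: (@le_lt_trans _ _ (\int[mu]_(x in (K : set (borel G)))
      (cst 1%E x + ((normc (eta x)) `^ r)%:E))%E).
    apply: ge0_le_integral => //.
    - by move=> x _; rewrite lee_fin normc_ge0.
    - by apply: emeasurable_funD => //; exact: measurable_funTS.
    - move=> x _; rewrite -EFinD lee_fin.
      have [n1|n1] := leP (normc (eta x)) 1.
        by apply: le_trans n1 _; rewrite lerDl powR_ge0.
      apply: (@le_trans _ _ (normc (eta x) `^ r)); last by rewrite lerDr.
      by apply: le1r_powR => //; exact: ltW.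
  rewrite ge0_integralD//; last 2 first.
  - by move=> x _; rewrite lee_fin powR_ge0.
  - exact: measurable_funTS.
  rewrite integral_cst// mul1e lte_add_pinfty//; first exact: fmu.
  apply: (@le_lt_trans _ _ 1%E); last exact: ltry.
  apply: le_trans le1; apply: ge0_subset_integral => //.
  by move=> x _; rewrite lee_fin powR_ge0.
rewrite LpNorm_infty => /ess_supP le1.
apply: (@le_lt_trans _ _ (\int[mu]_(x in (K : set (borel G))) (cst 1%E x))%E).
  apply: ae_ge0_le_integral => //.
  - by move=> x _; rewrite lee_fin normc_ge0.
  - by apply: filterS le1 => x + _.
by rewrite integral_cst// mul1e; exact: fmu.
Qed.

Lemma hoelder_infty eta k : complex_measurable eta -> complex_measurable k ->
  (\int[mu]_x ((normc (eta x))%:E * (normc (k x))%:E) <=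
   LpNorm mu 1 eta * LpNorm mu +oo k)%E.
Proof.
move=> meta mk; rewrite LpNorm1 LpNorm_infty.
have S0 : (0 <= ess_sup mu (fun x : borel G => (normc (k x))%:E))%E.
  by rewrite -LpNorm_infty; exact: Lnorm_ge0.
rewrite -ge0_integralZr//; [|exact: mEnormc|by move=> x _; rewrite lee_fin normc_ge0].
apply: ae_ge0_le_integral => //.
- by move=> x _; rewrite mule_ge0// lee_fin normc_ge0.
- by apply: emeasurable_funM; exact: mEnormc.
- by move=> x _; rewrite mule_ge0// lee_fin normc_ge0.
- by apply: emeasurable_funM => //; exact: mEnormc.
apply: filterS (ess_sup_ge mu (fun x : borel G => (normc (k x))%:E)) => x le _.
by rewrite lee_wpmul2l// lee_fin normc_ge0.
Qed.

Lemma LpNorm_hoelder (p q : \bar R) eta k :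
  (1 <= p)%E -> (1 <= q)%E -> (p^-1 + q^-1 = 1)%E ->
  complex_measurable eta -> complex_measurable k ->
  (\int[mu]_x ((normc (eta x))%:E * (normc (k x))%:E) <=
   LpNorm mu q eta * LpNorm mu p k)%E.
Proof.
move=> p1 q1 pq meta mk.
have [[-> ->]|[-> ->]|[r [s [-> -> r1 s1 rs]]]] := conjugate_exponentsP p1 q1 pq.
- rewrite muleC; under eq_integral do rewrite muleC; exact: hoelder_infty.
- exact: hoelder_infty.
have r0 : 0 < r by exact: lt_trans ltr01 r1.
have s0 : 0 < s by exact: lt_trans ltr01 s1.
have := @hoelder _ (borel G) R mu (fun x => normc (eta x)) (fun x => normc (k x)) s r
  (measurable_normc meta) (measurable_normc mk) s0 r0.
rewrite addrC => /(_ rs); rewrite Lnorm1.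
rewrite !LpNormE; apply: le_trans; rewrite le_eqVlt; apply/orP; left; apply/eqP.
apply: eq_integral => x _ /=.
by rewrite ger0_norm ?EFinM// mulr_ge0// normc_ge0.
Qed.


(** The set where v > 0 is not known beforehand to be sigma-finite. Continuity makes each [W n]
    open; v is bounded below on it, so the bound on compact sets and inner regularity give it finite
    measure. As v is also bounded above there, a compact subset carries almost all of the integral,
    and monotone convergence over n finishes. *)
Lemma powR_integral_le_compact (v : G -> R) (s B : R) : continuous v ->
  (forall x, 0 <= v x) -> 0 < s ->
  (forall K : set G, compact K ->
     (\int[mu]_(x in (K : set (borel G))) (v x `^ s)%:E <= B%:E)%E) ->
  (\int[mu]_x (v x `^ s)%:E <= B%:E)%E.
Proof.
move=> cv v0 s0 vK.
have mv : measurable_fun setT (fun x : borel G => (v x `^ s)%:E).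
  apply/measurable_EFinP; apply: (measurableT_comp (measurable_powR s)).
  exact: continuous_borel.
have vs0 (x : borel G) : (0 <= (v x `^ s)%:E)%E by rewrite lee_fin powR_ge0.
have B0 : 0 <= B.
  have := vK _ (@compact0 G); rewrite integral_set0 lee_fin; exact.
pose W (n : nat) : set (borel G) := [set x | n.+1%:R^-1 < v x] `&` [set x | v x < n.+1%:R].
have oW n : open (W n : set G).
  have o1 : open [set x | n.+1%:R^-1 < v x].
    move/continuousP : cv => /(_ [set r : R | n.+1%:R^-1 < r]); apply; exact: open_gt.
  have o2 : open [set x | v x < n.+1%:R].
    move/continuousP : cv => /(_ [set r : R | r < n.+1%:R]); apply; exact: open_lt.
  exact: openI.
have mW n : measurable (W n) by exact: open_borel.
have Wle n : (\int[mu]_(x in W n) (v x `^ s)%:E <= B%:E)%E.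
  have n0 : 0 < n.+1%:R :> R by [].
  pose c : R := n.+1%:R^-1 `^ s; pose M : R := n.+1%:R `^ s.
  have c0 : 0 < c by rewrite powR_gt0 ?invr_gt0.
  have M0 : 0 < M by rewrite powR_gt0.
  have Wfin : (mu (W n) <= (c^-1 * B)%:E)%E.
    rewrite (haar_inner_regular haar (oW n)).
    apply: ge_ereal_sup => _ [K [cK KW] <-]; have mK := compact_borel lcG cK.
    rewrite EFinM -lee_pdivrMl ?invr_gt0// invrK; apply: le_trans (vK K cK).
    rewrite -integral_cst//; apply: ge0_le_integral => //.
    - by move=> x _; rewrite lee_fin ltW.
    - exact: measurable_funTS.
    - move=> x /KW[/ltW lx _]; rewrite lee_fin.
      by apply: ge0_ler_powR => //; [exact: ltW|rewrite nnegrE invr_ge0|rewrite nnegrE].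
  have fW : mu (W n) \is a fin_num.
    by rewrite ge0_fin_numE//; apply: le_lt_trans Wfin _; exact: ltry.
  apply/lee_addgt0Pr => e e0.
  (* On [W n] the integrand is at most M, so leaving out measure e / M loses at most e. *)
  have [_ [K [cK KW] <-]] := @ub_ereal_sup_adherent R
    [set mu K | K in [set K : set G | compact K /\ K `<=` W n]] (e / M)
    (divr_gt0 e0 M0) ltac:(by rewrite -(haar_inner_regular haar (oW n))).
  rewrite -(haar_inner_regular haar (oW n)) => ltK.
  have mK := compact_borel lcG cK; have fK := fmu cK.
  have WKE : W n = (K : set (borel G)) `|` (W n `\` K) by rewrite setDUK.
  rewrite [in leLHS]WKE ge0_integral_setU//; last 3 first.
  - exact: measurableD.
  - exact: measurable_funTS.
  - by rewrite disj_set2E setDIK.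
  apply: leeD; first exact: vK.
  apply: (@le_trans _ _ (\int[mu]_(x in W n `\` K) (cst M%:E) x)%E).
    apply: ge0_le_integral => //.
    - exact: measurableD.
    - exact: measurable_funTS.
    - move=> x [[_ /ltW xM] _]; rewrite lee_fin.
      by apply: ge0_ler_powR => //; [exact: ltW|rewrite nnegrE|rewrite nnegrE].
  rewrite integral_cst; last exact: measurableD.
  rewrite -lee_pdivlMl// -EFinM mulrC measureD//; last by rewrite ltey_eq fW.
  rewrite (setIidr KW) leeBlDr; last by rewrite ge0_fin_numE.
  by rewrite addeC -leeBlDr// ltW.
have ndW : nondecreasing_seq W.
  move=> m n mn; apply/subsetPset => x [xm xM]; split => /=.
    by apply: le_lt_trans xm; rewrite lef_pV2 ?posrE// ler_nat.
  by apply: lt_le_trans xM _; rewrite ler_nat.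
rewrite (integral_restr mu (K := \bigcup_n W n)); last first.
  move=> x nW; have [xpos|] := ltP 0 (v x); last first.
    move=> x0; have -> : v x = 0 by apply/eqP; rewrite eq_le x0 v0.
    by rewrite powR0// gt_eqF.
  exfalso; apply: nW.
  (* Exceeding the sum of v x and its inverse makes n + 1 exceed each of them, which is membership
     in [W n]. *)
  pose n := Num.truncn (v x + (v x)^-1).
  have ltn : v x + (v x)^-1 < n.+1%:R by exact: truncnS_gt.
  exists n => //; split => /=.
    rewrite -[v x]invrK ltf_pV2 ?posrE ?invr_gt0//.
    by apply: le_lt_trans ltn; rewrite lerDr.
  by apply: le_lt_trans ltn; rewrite lerDl invr_ge0.
have := ge0_nondecreasing_set_cvg_integral (mu := mu) ndW mW
  (fun i => measurable_funTS mv) (fun i x _ => vs0 x).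
move=> cv'; rewrite -(cvg_lim _ cv')//.
apply: lime_le; first by apply/cvg_ex; eexists; exact: cv'.
exact: nearW.
Qed.


Lemma complex_measurable_unit_phase h : complex_measurable h ->
  complex_measurable (fun x => unit_phase (h x)).
Proof.
move=> mh; apply: complex_measurableM => //.
rewrite (_ : (fun x => _) = fun x => (normc (h x) `^ (-1))%:C%C); last first.
  by apply/funext => x; rewrite powR_inv1 ?normc_ge0// fmorphV.
apply: complex_measurable_real; apply: (measurableT_comp (measurable_powR (-1))).
exact: measurable_normc.
Qed.

(** Giving xi the phase of h turns the pairing into the integral of w |h|, so no cancellation is
    lost. The three duality cases differ only in the choice of the weight w. *)
Lemma weighted_phase_test h (w : G -> R) (K : set G) (M : R) :
  continuous (h : G -> R[i]^o) -> compact K ->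
  measurable_fun setT (w : borel G -> R) -> (forall x, 0 <= w x <= M) ->
  (forall x, ~ K x -> w x = 0) ->
  let xi := fun x => (w x)%:C%C * unit_phase (h x) in
  [/\ test_function xi, forall x, normc (xi x) <= w x &
     ((normc (complex_integral mu (fun x => h x * (xi x)^*%C)))%:E =
     \int[mu]_x (w x * normc (h x))%:E)%E].
Proof.
move=> ch cK mw wM wK xi; have mh := continuous_complex_measurable ch.
have w0 x : 0 <= w x by have /andP[] := wM x.
have M0 : 0 <= M by have /andP[a b] := wM 1%g; exact: le_trans a b.
have mK := compact_borel lcG cK.
have xiw x : normc (xi x) <= w x.
  rewrite /xi normcM normc_real ger0_norm//.
  have [->|h0] := eqVneq (h x) 0.
    by rewrite /unit_phase mul0r normc0 mulr0.
  by rewrite normc_unit_phase// mulr1.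
split => //.
  split; last by exists K => // x /wK wx; rewrite /xi wx mul0r.
    apply: complex_measurableM; first exact: complex_measurable_real.
    exact: complex_measurable_unit_phase.
  by exists M => x; apply: le_trans (xiw x) _; have /andP[] := wM x.
have i0 : (0 <= \int[mu]_x (w x * normc (h x))%:E)%E.
  by apply: integral_ge0 => x _; rewrite lee_fin mulr_ge0// normc_ge0.
have ifin : (\int[mu]_x (w x * normc (h x))%:E \is a fin_num)%E.
  rewrite ge0_fin_numE//.
  have [N N0 hN] := continuous_complex_bounded ch cK.
  rewrite (integral_restr mu (K := K)); last by move=> x /wK ->; rewrite mul0r.
  apply: (@le_lt_trans _ _ (\int[mu]_(x in (K : set (borel G))) (cst (M * N)%:E) x)%E).
    apply: ge0_le_integral => //.
    - by move=> x _; rewrite lee_fin mulr_ge0// normc_ge0.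
    - apply: measurable_funTS; apply/measurable_EFinP; apply: measurable_funM => //.
      exact: measurable_normc.
    - move=> x Kx; rewrite lee_fin; apply: ler_pM => //; first exact: normc_ge0.
        by have /andP[] := wM x.
      exact: hN.
  rewrite integral_cst// lte_mul_pinfty//; last exact: fmu.
  by rewrite lee_fin mulr_ge0// ltW.
have -> : complex_integral mu (fun x => h x * (xi x)^*%C) =
    (fine (\int[mu]_x (w x * normc (h x))%:E))%:C%C.
  rewrite (eq_complex_integral mu (h' := fun x => (w x * normc (h x))%:C%C)).
    by apply: complex_eqP => //=; rewrite /Rintegral integral0.
  by move=> x; rewrite /xi conjcM conjc_real mulrCA unit_phase_conjc rmorphM.
by rewrite normc_real ger0_norm ?fine_ge0// fineK.
Qed.

(** * Norms of continuous functions from bounds on pairings *)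

Section Dual.
Variables (h : G -> R[i]) (C : R).
Hypothesis ch : continuous (h : G -> R[i]^o).
Hypothesis C0 : 0 <= C.

Let mh : complex_measurable h. Proof. exact: continuous_complex_measurable. Qed.
Let mnh : measurable_fun setT (fun x : borel G => normc (h x)).
Proof. exact: measurable_normc. Qed.

Definition dual_bound (p : \bar R) := forall xi, test_function xi ->
  (LpNorm mu p xi <= 1)%E ->
  normc (complex_integral mu (fun x => h x * (xi x)^*%C)) <= C.

Let indicK (K : set G) : compact K -> measurable_fun setT (\1_K : borel G -> R).
Proof. by move=> cK; apply: measurable_indic; exact: compact_borel. Qed.

Lemma dual_bound_infty : dual_bound +oo -> (LpNorm mu 1 h <= C%:E)%E.
Proof.
move=> hC; rewrite LpNorm1.
(* The modulus is written as a power with exponent 1 so that [powR_integral_le_compact] applies; on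
   each compact K the weight is the indicator of K. *)
have e1 x : normc (h x) = normc (h x) `^ 1 by rewrite powRr1 ?normc_ge0.
under eq_integral do rewrite e1.
apply: powR_integral_le_compact => //.
- exact: continuous_normc.
- by move=> x; exact: normc_ge0.
move=> K cK; have mK := compact_borel lcG cK.
have ind01 x : 0 <= (\1_K x : R) <= 1 by rewrite indicE; case: (_ \in _) => /=; rewrite ?lexx ?ler01.
have indK x : ~ K x -> (\1_K x : R) = 0 by move=> nK; rewrite indicE memNset.
have [tx xw xE] := weighted_phase_test ch cK (indicK cK) ind01 indK.
set xi := (fun x => _) in tx xw xE.
have xi1 : (LpNorm mu +oo xi <= 1)%E.
  rewrite LpNorm_infty; apply/ess_supP; apply: nearW => x; rewrite lee_fin.
  by apply: le_trans (xw x) _; have /andP[] := ind01 x.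
have := hC xi tx xi1; rewrite -lee_fin xE; apply: le_trans.
rewrite [leRHS](integral_restr mu (K := K)); last by move=> x /indK ->; rewrite mul0r.
rewrite le_eqVlt; apply/orP; left; apply/eqP; apply: eq_integral => x.
by rewrite inE => Kx; rewrite indicE mem_set// mul1r -e1.
Qed.

(** A point where |h| exceeds C would have an open neighbourhood, of positive measure, on which this
    persists. The normalised indicator of a compact subset of positive measure then violates the
    bound. So C bounds |h| at every point, not just almost everywhere. *)
Lemma dual_bound_one : dual_bound 1 -> (LpNorm mu +oo h <= C%:E)%E.
Proof.
move=> hC; rewrite LpNorm_infty; apply/ess_supP; apply: nearW => x0; rewrite lee_fin.
rewrite leNgt; apply/negP => Clt.
(* The midpoint leaves a gap above C, so the inequality is still strict after averaging over K. *)
pose D := (C + normc (h x0)) / 2; have CD : C < D by rewrite midf_lt.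
have Dx : D < normc (h x0) by rewrite midf_lt.
pose U := [set x | D < normc (h x)].
have oU : open U.
  have /continuousP := continuous_normc ch.
  by move=> /(_ [set r : R | D < r]); apply; exact: open_gt.
have U0 : (0 < mu U)%E by apply: (haar_open_gt0 lcG haar oU); exists x0.
have [_ [K [cK KU] <-] K0] : exists2 m, [set mu K | K in [set K : set G | compact K /\ K `<=` U]] m & (0 < m)%E.
  by apply: ereal_sup_gt; rewrite -(haar_inner_regular haar oU).
have mK := compact_borel lcG cK.
have fK : mu K \is a fin_num by rewrite ge0_fin_numE//; exact: fmu.
pose m := fine (mu K); have m0 : 0 < m by rewrite fine_gt0// K0 ltey_eq fK.
pose w x : R := m^-1 * \1_K x.
have w0 x : 0 <= w x <= m^-1.
  rewrite /w indicE; case: (_ \in _) => /=.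
    by rewrite mulr1 lexx andbT invr_ge0 ltW.
  by rewrite mulr0 lexx invr_ge0 ltW.
have wK x : ~ K x -> w x = 0 by move=> nK; rewrite /w indicE memNset// mulr0.
have mw : measurable_fun setT (w : borel G -> R).
  by apply: measurable_funM => //; exact: indicK.
have [tx xw xE] := weighted_phase_test ch cK mw w0 wK.
set xi := (fun x => _) in tx xw xE.
have [mxi _ _] := tx.
have xi1 : (LpNorm mu 1 xi <= 1)%E.
  rewrite LpNorm1; apply: (@le_trans _ _ (\int[mu]_x (w x)%:E)%E).
    apply: ge0_le_integral => //.
    - by move=> x _; rewrite lee_fin normc_ge0.
    - exact: mEnormc.
    - exact/measurable_EFinP.
    - by move=> x _; rewrite lee_fin; exact: xw.
  rewrite (integral_restr mu (K := K)); last by move=> x /wK ->.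
  rewrite (eq_integral (cst (m^-1)%:E)); last first.
    by move=> x; rewrite inE => Kx; rewrite /w indicE mem_set// mulr1.
  by rewrite integral_cst// -(fineK fK) -EFinM mulVf// gt_eqF.
have := hC xi tx xi1; rewrite -lee_fin xE; apply/negP; rewrite -ltNge.
apply: (@lt_le_trans _ _ D%:E); first by rewrite lte_fin.
rewrite [leRHS](integral_restr mu (K := K)); last by move=> x /wK ->; rewrite mul0r.
apply: (@le_trans _ _ (\int[mu]_(x in (K : set (borel G))) (cst (m^-1 * D)%:E) x)%E).
  by rewrite integral_cst// -(fineK fK) -EFinM mulrAC mulVf ?mul1r// gt_eqF.
apply: ge0_le_integral => //.
- by move=> x _; rewrite lee_fin mulr_ge0 ?invr_ge0 ?(ltW m0)// (le_trans C0)// ltW.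
- apply: measurable_funTS; apply/measurable_EFinP.
  exact: measurable_funM.
- move=> x Kx; rewrite lee_fin /w indicE mem_set// mulr1 ler_pM2l ?invr_gt0//.
  by apply: ltW; exact: KU.
Qed.

(** The weight is the extremal one in the inequality of Hoelder, |h|^(s-1) on a compact K; the
    relation (s - 1) r = s makes its r-th power |h|^s. *)
Lemma dual_bound_real (r s : R) : 1 < r -> 1 < s -> r^-1 + s^-1 = 1 ->
  dual_bound r%:E -> (LpNorm mu s%:E h <= C%:E)%E.
Proof.
move=> r1 s1 rs hC.
have r0 : 0 < r by exact: lt_trans ltr01 r1.
have s0 : 0 < s by exact: lt_trans ltr01 s1.
apply/LpNorm_real_le => //.
apply: powR_integral_le_compact => //.
- exact: continuous_normc.
- by move=> x; exact: normc_ge0.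
move=> K cK; have mK := compact_borel lcG cK.
have [N N0 hN] := continuous_complex_bounded ch cK.
have mhs (t : R) : measurable_fun setT (fun x : borel G => normc (h x) `^ t).
  by apply: (measurableT_comp (measurable_powR t)).
pose E := (\int[mu]_(x in (K : set (borel G))) (normc (h x) `^ s)%:E)%E.
have E0 : (0 <= E)%E by apply: integral_ge0 => x _; rewrite lee_fin powR_ge0.
have fE : E \is a fin_num.
  rewrite ge0_fin_numE//.
  apply: (@le_lt_trans _ _ (\int[mu]_(x in (K : set (borel G))) (cst (N `^ s)%:E) x)%E).
    apply: ge0_le_integral => //.
    - by move=> x _; rewrite lee_fin powR_ge0.
    - by apply: measurable_funTS; exact/measurable_EFinP.
    - move=> x Kx; rewrite lee_fin; apply: ge0_ler_powR; rewrite ?nnegrE ?(ltW s0) ?normc_ge0 ?(ltW N0)//.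
      exact: hN.
  by rewrite integral_cst// lte_mul_pinfty ?lee_fin ?powR_ge0//; exact: fmu.
pose I := fine E; have EI : E = I%:E by rewrite fineK.
rewrite -/E EI lee_fin.
have [I0|I0] := leP I 0; first by apply: le_trans I0 _; exact: powR_ge0.
(* With I the integral of |h|^s over K, the factor I^(-1/r) bounds the L^r norm of the test function
   by 1, and the pairing becomes a I = I^(1/s). *)
pose a := I `^ (- r^-1).
have a0 : 0 < a by exact: powR_gt0.
pose w x : R := a * normc (h x) `^ (s - 1) * \1_K x.
have w0 x : 0 <= w x <= a * N `^ (s - 1).
  have h0 := normc_ge0 (h x).
  rewrite /w indicE; case: (boolP (_ \in _)); rewrite ?inE => Kx /=; last first.
    by rewrite mulr0 lexx mulr_ge0 ?powR_ge0// ltW.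
  rewrite mulr1 mulr_ge0 ?powR_ge0 ?(ltW a0)//= ler_pM2l//.
  by apply: ge0_ler_powR; rewrite ?nnegrE ?subr_ge0 ?(ltW s1) ?(ltW N0)//; exact: hN.
have wK x : ~ K x -> w x = 0 by move=> nK; rewrite /w indicE memNset// mulr0.
have mw : measurable_fun setT (w : borel G -> R).
  apply: measurable_funM; last exact: indicK.
  by apply: measurable_funM => //; exact: mhs.
have [tx xw xE] := weighted_phase_test ch cK mw w0 wK.
set xi := (fun x => _) in tx xw xE.
have [mxi _ _] := tx.
have sr : (s - 1) * r = s.
  have : (r^-1 + s^-1) * (r * s) = r * s by rewrite rs mul1r.
  rewrite mulrDl mulKf ?gt_eqF// mulrCA mulVf ?gt_eqF// mulr1 => e.
  by rewrite mulrBl mul1r mulrC -e addrK.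
have xi1 : (LpNorm mu r%:E xi <= 1)%E.
  apply/LpNorm_real_le => //; rewrite powR1.
  apply: (@le_trans _ _ (\int[mu]_x (w x `^ r)%:E)%E).
    apply: ge0_le_integral => //.
    - by move=> x _; rewrite lee_fin powR_ge0.
    - apply/measurable_EFinP; apply: (measurableT_comp (measurable_powR r)).
      exact: measurable_normc.
    - apply/measurable_EFinP.
      exact: (measurableT_comp (measurable_powR r) mw).
    - move=> x _; rewrite lee_fin; apply: ge0_ler_powR; [exact: ltW| | |exact: xw].
        by rewrite nnegrE normc_ge0.
      by rewrite nnegrE; have /andP[] := w0 x.
  rewrite (integral_restr mu (K := K)); last by move=> x /wK ->; rewrite powR0// gt_eqF.
  rewrite (eq_integral (fun x : borel G => (a `^ r)%:E * (normc (h x) `^ s)%:E)%E); last first.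
    move=> x; rewrite inE => Kx; rewrite /w indicE mem_set// mulr1.
    by rewrite powRM ?powR_ge0 ?(ltW a0)// -powRrM sr EFinM.
  rewrite ge0_integralZl//; last 3 first.
  - by apply: measurable_funTS; exact/measurable_EFinP.
  - by move=> x _; rewrite lee_fin powR_ge0.
  - by rewrite lee_fin powR_ge0.
  rewrite -/E EI -EFinM /a -powRrM mulNr mulVf ?gt_eqF// powR_inv1 ?(ltW I0)//.
  by rewrite mulVf// gt_eqF.
have : (\int[mu]_x (w x * normc (h x))%:E <= C%:E)%E.
  by rewrite -xE lee_fin; exact: hC tx xi1.
rewrite (integral_restr mu (K := K)); last by move=> x /wK ->; rewrite mul0r.
rewrite (eq_integral (fun x : borel G => a%:E * (normc (h x) `^ s)%:E)%E); last first.
  move=> x; rewrite inE => Kx; rewrite /w indicE mem_set// mulr1 -EFinM -mulrA.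
  by rewrite [_ `^ _ * _]mulrC mulr_powRB1 ?normc_ge0.
rewrite ge0_integralZl//; last 3 first.
- by apply: measurable_funTS; exact/measurable_EFinP.
- by move=> x _; rewrite lee_fin powR_ge0.
- by rewrite lee_fin ltW.
rewrite -/E EI -EFinM lee_fin.
have -> : a * I = I `^ s^-1.
  rewrite -{1}(powRr1 (ltW I0)) /a -powRD; last by rewrite (gt_eqF I0) implybT.
  by rewrite -rs addKr.
move=> le; have -> : I = (I `^ s^-1) `^ s by rewrite -powRrM mulVf ?gt_eqF// powRr1// ltW.
by apply: ge0_ler_powR => //; rewrite ?nnegrE ?powR_ge0 ?(ltW s0).
Qed.

Lemma LpNorm_dual_bound (p q : \bar R) :
  (1 <= p)%E -> (1 <= q)%E -> (p^-1 + q^-1 = 1)%E ->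
  dual_bound p -> (LpNorm mu q h <= C%:E)%E.
Proof.
move=> p1 q1 pq.
have [[-> ->]|[-> ->]|[r [s [-> -> r1 s1 rs]]]] := conjugate_exponentsP p1 q1 pq.
- exact: dual_bound_one.
- exact: dual_bound_infty.
exact: dual_bound_real.
Qed.

End Dual.

(** A real bound N takes the place of a comparison in the extended reals, because the duality lemmas
    need a finite constant; in the theorem N is the norm of an element of a completion. *)
Lemma convolution_norm_involution_le (p q : \bar R) f (N : R) :
  (1 <= p)%E -> (1 <= q)%E -> (p^-1 + q^-1 = 1)%E -> Cc f -> 0 <= N ->
  (convolution_norm mu p f <= N%:E)%E ->
  (convolution_norm mu q (involution mu f) <= N%:E)%E.
Proof.
move=> p1 q1 pq hf N0 fN; apply: ge_ereal_sup => _ [eta [meta eta1] <-].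
have leta := LpNorm_loc_integrable q1 meta eta1.
have hf' : Cc (involution mu f) by exact: involution_Cc.
have ch := convolution_continuous lcG haar hf' leta.
apply: (LpNorm_dual_bound ch N0 p1 q1 pq) => xi txi xi1.
have lxi := test_function_loc_integrable lcG haar txi.
rewrite (convolution_pairing lcG haar hf leta txi).
set k := convolution mu f xi.
have ck : continuous (k : G -> R[i]^o) by exact: convolution_continuous.
have mk := continuous_complex_measurable ck.
have ik : complex_integrable mu (fun z => eta z * (k z)^*%C).
  have [_ [K cK fK]] := (CcP lcG f).1 hf; have [_ _ [L cL xiL]] := txi.
  have ckc : continuous ((fun z => (k z)^*%C) : G -> R[i]^o).
    by move=> z; exact: (cvg_conjc (ck z)).
  have := complex_integrable_Cc_mul lcG ckc (compact_setmulg cK cL) _ leta.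
  rewrite (_ : (fun z => _) = fun z => eta z * (k z)^*%C); last first.
    by apply/funext => z; rewrite mulrC.
  by apply=> z nz; rewrite /k (convolution_eq0 mu fK xiL nz) conjc0.
rewrite -lee_fin; apply: le_trans (normc_complex_integral ik) _.
under eq_integral do rewrite normcM normc_conj EFinM.
apply: le_trans (LpNorm_hoelder p1 q1 pq meta mk) _.
rewrite -[leRHS]mul1e; apply: lee_pmul => //; try exact: Lnorm_ge0.
apply: le_trans fN; apply: ereal_sup_ubound; exists xi => //.
by split => //; case: txi.
Qed.

End LpDuality.

(** * Extension to the completions *)

Section SequentialGraph.
Context {R : realType} {A B : banachAlgType R[i]} {T : Type}.
Variables (D : set T) (u : T -> A) (v : T -> B).

(** The sequential closure of the set of pairs (u f, v f). It is symmetric in u and v, so one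
    construction yields both the map and its inverse. *)
Definition seq_graph (a : A) (b : B) : Prop := exists f : nat -> T,
  [/\ forall n, D (f n), u (f n) @[n --> \oo] --> a & v (f n) @[n --> \oo] --> b].

Lemma seq_graph_in f : D f -> seq_graph (u f) (v f).
Proof. by move=> Df; exists (fun=> f); split => //; exact: cvg_cst. Qed.

Lemma seq_graph_scaleD (c c' : R[i]) (a a' : A) (b b' : B) :
  (forall f g, D f -> D g -> exists2 h, D h &
     u h = c *: u f + u g /\ v h = c' *: v f + v g) ->
  seq_graph a b -> seq_graph a' b' -> seq_graph (c *: a + a') (c' *: b + b').
Proof.
move=> closed [f [Df ua vb]] [g [Dg ua' vb']].
have /choice[h hE] n : exists h, D h /\
    (u h = c *: u (f n) + u (g n) /\ v h = c' *: v (f n) + v (g n)).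
  by have [h Dh hE] := closed _ _ (Df n) (Dg n); exists h.
exists h; split => [n||]; first by have [] := hE n.
  under eq_fun do rewrite (hE _).2.1.
  by apply: cvgD => //; apply: cvgZ => //; exact: cvg_cst.
under eq_fun do rewrite (hE _).2.2.
by apply: cvgD => //; apply: cvgZ => //; exact: cvg_cst.
Qed.

Lemma seq_graph_bmul (a a' : A) (b b' : B) :
  (forall f g, D f -> D g -> exists2 h, D h &
     u h = bmul (u f) (u g) /\ v h = bmul (v g) (v f)) ->
  seq_graph a b -> seq_graph a' b' -> seq_graph (bmul a a') (bmul b' b).
Proof.
move=> closed [f [Df ua vb]] [g [Dg ua' vb']].
have /choice[h hE] n : exists h, D h /\
    (u h = bmul (u (f n)) (u (g n)) /\ v h = bmul (v (g n)) (v (f n))).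
  by have [h Dh hE] := closed _ _ (Df n) (Dg n); exists h.
exists h; split => [n||]; first by have [] := hE n.
  under eq_fun do rewrite (hE _).2.1.
  exact: (@continuous2_cvg _ A A A _ _ _ _ (fun x y : A => bmul x y) _ _
    (@bmul_continuous _ A (a, a')) ua ua').
under eq_fun do rewrite (hE _).2.2.
exact: (@continuous2_cvg _ B B B _ _ _ _ (fun x y : B => bmul x y) _ _
  (@bmul_continuous _ B (b', b)) vb' vb).
Qed.

Hypothesis isom : forall f g, D f -> D g -> `|v f - v g| = `|u f - u g|.

(** Distances pass to the limit. For a = a' this says that the closed graph is single-valued; in
    general it makes the resulting map an isometry. *)
Lemma seq_graph_dist (a a' : A) (b b' : B) :
  seq_graph a b -> seq_graph a' b' -> `|b - b'| = `|a - a'|.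
Proof.
move=> [f [Df ua vb]] [g [Dg ua' vb']].
have h1 : `|u (f n) - u (g n)| @[n --> \oo] --> (`|a - a'| : R[i]^o).
  by apply: cvg_norm; exact: cvgB.
have h2 : `|v (f n) - v (g n)| @[n --> \oo] --> (`|b - b'| : R[i]^o).
  by apply: cvg_norm; exact: cvgB.
have hR : hausdorff_space R[i]^o by exact: norm_hausdorff.
have e : (fun n => `|v (f n) - v (g n)|) = (fun n => `|u (f n) - u (g n)|).
  by apply/funext => n; exact: isom.
by rewrite e in h2; exact: (cvg_unique hR h2 h1).
Qed.

(** A sequence approximating a is Cauchy, hence by isometry so is its companion in B, which is
    complete. *)
Lemma seq_graph_total (a : A) : dense (u @` D) -> exists b, seq_graph a b.
Proof.
move=> du.
have /choice[f fE] n : exists f, D f /\ `|a - u f| < (n.+1%:R^-1)%:C%C.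
  have n0 : 0 < (n.+1%:R^-1)%:C%C :> R[i] by rewrite ltcR invr_gt0.
  have [|x [/interior_subset aB [f Df fx]]] := du (ball a (n.+1%:R^-1)%:C%C)^° _ (@open_interior _ _).
    by exists a; apply: nbhsx_ballx.
  by exists f; split => //; move: aB; rewrite -ball_normE /= fx.
have ua : u (f n) @[n --> \oo] --> a.
  apply/cvgrPdist_lt => e e0.
  have eE : e = (complex.Re e)%:C%C by rewrite RRe_real ?gtr0_real.
  have r0 : 0 < complex.Re e by rewrite -ltcR -eE.
  have := near_infty_natSinv_lt (PosNum r0); apply: filterS => n /= ne.
  by apply: lt_trans (fE n).2 _; rewrite eE ltcR.
have cv : cvg (v (f n) @[n --> \oo]).
  apply/cauchy_cvgP/cauchyP => e e0.
  have e20 : 0 < e / 2 by rewrite divr_gt0.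
  have /cvgrPdist_lt/(_ _ e20)[N _ NE] := ua.
  exists (v (f N)); exists N => // n /= Nn; rewrite -ball_normE /=.
  rewrite isom; [|exact: (fE _).1|exact: (fE _).1].
  rewrite -(subrKA a) (splitr e); apply: le_lt_trans (ler_normD _ _) _.
  apply: ltrD; first by rewrite distrC; apply: NE => /=.
  exact: NE.
exists (lim (v (f n) @[n --> \oo])), f; by split => // n; exact: (fE n).1.
Qed.

End SequentialGraph.

Lemma seq_graphC (R : realType) (A B : banachAlgType R[i]) (T : Type) (D : set T)
    (u : T -> A) (v : T -> B) a b : seq_graph D u v a b -> seq_graph D v u b a.
Proof. by move=> [f [Df ua vb]]; exists f. Qed.

Lemma isometry_continuous (K : numFieldType) (V W : normedModType K) (f : V -> W) :
  (forall x y, `|f x - f y| = `|x - y|) -> continuous f.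
Proof.
move=> fi x; apply/cvgrPdist_lt => e e0.
near=> y; rewrite fi; near: y.
by apply: cvgr_dist_lt.
Unshelve. all: by end_near. Qed.

(** * The conjugate-linear anti-isomorphism defined by a closed graph *)

Section StarExtension.
Context {R : realType} {A B : banachAlgType R[i]} {T : Type}.
Variables (D : set T) (u : T -> A) (v : T -> B).
Hypotheses (du : dense (u @` D)) (dv : dense (v @` D)).
Hypothesis norm_uv : forall f, D f -> `|v f| = `|u f|.
Hypothesis star_scaleD : forall c f g, D f -> D g -> exists2 h, D h &
  u h = c *: u f + u g /\ v h = (c^*)%C *: v f + v g.
Hypothesis star_bmul : forall f g, D f -> D g -> exists2 h, D h &
  u h = bmul (u f) (u g) /\ v h = bmul (v g) (v f).

(** Only the images u f and v f occur in the hypotheses, so [T] needs no algebraic structure, and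
    the hypotheses keep their form when u and v are exchanged. Hence theta' is obtained exactly as
    theta is. *)
Lemma star_extension : exists theta : A -> B,
  [/\ continuous theta, (forall f, D f -> theta (u f) = v f),
      induces_K0_isomorphism theta & induces_K1_isomorphism theta].
Proof.
have isom f g : D f -> D g -> `|v f - v g| = `|u f - u g|.
  (* Both differences are images of one h, since -1 is its own conjugate, so preservation of norms
     becomes preservation of distances. *)
  move=> Df Dg; have [h Dh [uh vh]] := star_scaleD (-1) Dg Df.
  have e : ((-1 : R[i])^*)%C = -1 by rewrite rmorphN1.
  rewrite e scaleN1r addrC in vh; rewrite scaleN1r addrC in uh.
  by rewrite -vh -uh; exact: norm_uv.
have isom' f g : D f -> D g -> `|u f - u g| = `|v f - v g|.
  by move=> Df Dg; rewrite isom.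
have /choice[theta thetaP] a : exists b, seq_graph D u v a b.
  exact: seq_graph_total.
have /choice[theta' theta'P] b : exists a, seq_graph D v u b a.
  exact: seq_graph_total.
have thetaE a b : seq_graph D u v a b -> theta a = b.
  move=> ab; apply/eqP; rewrite -subr_eq0 -normr_eq0.
  by rewrite (seq_graph_dist isom (thetaP a) ab) subrr normr0.
have theta'E b a : seq_graph D v u b a -> theta' b = a.
  move=> ba; apply/eqP; rewrite -subr_eq0 -normr_eq0.
  by rewrite (seq_graph_dist isom' (theta'P b) ba) subrr normr0.
have scaleD' c f g : D f -> D g -> exists2 h, D h &
    v h = c *: v f + v g /\ u h = (c^*)%C *: u f + u g.
  move=> Df Dg; have [h Dh [uh vh]] := star_scaleD (c^*)%C Df Dg.
  by exists h => //; rewrite conjcK in vh.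
have bmul' f g : D f -> D g -> exists2 h, D h &
    v h = bmul (v f) (v g) /\ u h = bmul (u g) (u f).
  by move=> Df Dg; have [h Dh [uh vh]] := star_bmul Dg Df; exists h.
have thetaL c a a' : theta (c *: a + a') = (c^*)%C *: theta a + theta a'.
  by apply: thetaE; apply: seq_graph_scaleD => // f g; exact: star_scaleD.
have theta'L c b b' : theta' (c *: b + b') = (c^*)%C *: theta' b + theta' b'.
  by apply: theta'E; apply: seq_graph_scaleD => // f g; exact: scaleD'.
have thetaM a a' : theta (bmul a a') = bmul (theta a') (theta a).
  by apply: thetaE; apply: seq_graph_bmul.
have theta'M b b' : theta' (bmul b b') = bmul (theta' b') (theta' b).
  by apply: theta'E; apply: seq_graph_bmul.
have thetaD : {morph theta : x y / x + y}.
  by move=> x y; have := thetaL 1 x y; rewrite rmorph1 !scale1r.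
have theta'D : {morph theta' : x y / x + y}.
  by move=> x y; have := theta'L 1 x y; rewrite rmorph1 !scale1r.
have theta0 : theta 0 = 0 by apply: (addrI (theta 0)); rewrite -thetaD !addr0.
have theta'0 : theta' 0 = 0 by apply: (addrI (theta' 0)); rewrite -theta'D !addr0.
have thetaZ c x : theta (c *: x) = (c^*)%C *: theta x.
  by have := thetaL c x 0; rewrite theta0 !addr0.
have theta'Z c x : theta' (c *: x) = (c^*)%C *: theta' x.
  by have := theta'L c x 0; rewrite theta'0 !addr0.
have thetaK : cancel theta theta'.
  by move=> a; apply: theta'E; exact: seq_graphC.
have theta'K : cancel theta' theta.
  by move=> b; apply: thetaE; exact: seq_graphC.
have theta_cont : continuous theta.
  by apply: isometry_continuous => x y; exact: (seq_graph_dist isom).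
have theta'_cont : continuous theta'.
  by apply: isometry_continuous => x y; exact: (seq_graph_dist isom').
exists theta; split => //.
- by move=> f Df; apply: thetaE; exact: seq_graph_in.
- exact: (star_induces_K0 thetaD thetaZ thetaM theta'D theta'Z theta'M thetaK theta'K).
- exact: (star_induces_K1 thetaD thetaZ thetaM theta_cont theta'D theta'Z theta'M theta'_cont thetaK theta'K).
Qed.

End StarExtension.

Theorem theorem1p1 (R : realType) (G : topGroupType)
    (lcG : locally_compact_group G)
    (mu : {measure set (borel G) -> \bar R}) (haar_mu : left_haar mu)
    (p q : \bar R) (p1 : (1 <= p)%E) (q1 : (1 <= q)%E)
    (pq : (p^-1 + q^-1 = 1)%E)
    (Bp Bq : banachAlgType R[i])
    (iota_p : (G -> R[i]) -> Bp) (iota_q : (G -> R[i]) -> Bq)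
    (Bp_completion : is_Br mu p iota_p) (Bq_completion : is_Br mu q iota_q) :
  exists theta : Bp -> Bq,
    [/\ continuous theta,
        (forall f : G -> R[i], Cc f ->
           theta (iota_p f) = iota_q (involution mu f)),
        induces_K0_isomorphism theta &
        induces_K1_isomorphism theta].
Proof.
have [linp mulp normp densep] := Bp_completion.
have [linq mulq normq denseq] := Bq_completion.
have Cci f : Cc f -> Cc (involution mu f) by exact: involution_Cc.
have iK f : involution mu (involution mu f) = f by exact: involutionK.
have qp : (q^-1 + p^-1 = 1)%E by rewrite addeC.
have normE (V : normedModType R[i]) (x : V) : `|x| = (complex.Re `|x|)%:C%C.
  by rewrite RRe_real ?ger0_real.
have Re0 (V : normedModType R[i]) (x : V) : 0 <= complex.Re `|x|.
  by rewrite -lecR -normE; exact: normr_ge0.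
apply: (@star_extension _ _ _ _ [set f | Cc f] iota_p (fun f => iota_q (involution mu f))).
- exact: densep.
(* The involution maps C_c onto itself, so the image whose density is needed is that of [iota_q]. *)
- rewrite (_ : [set _ | _ in _] = iota_q @` [set f | Cc f]); first exact: denseq.
  apply/seteqP; split => [_ [f /Cci Cf <-]|_ [f Cf <-]]; first by exists (involution mu f).
  by exists (involution mu f); [exact: Cci|rewrite iK].
- move=> f Cf; have Cf' := Cci _ Cf; rewrite normE [RHS]normE; congr (_%:C%C).
  apply/eqP; rewrite eq_le -!lee_fin (normp _ Cf) (normq _ Cf'); apply/andP; split.
    rewrite -(normp _ Cf).
    by apply: (convolution_norm_involution_le lcG haar_mu p1 q1 pq Cf (Re0 _ _)); rewrite normp.
  (* The reverse inequality is the same estimate for the involution of f with p and q exchanged,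
     once f is written as its double involution. *)
  rewrite -(normq _ Cf') -{1}(iK f).
  by apply: (convolution_norm_involution_le lcG haar_mu q1 p1 qp Cf' (Re0 _ _)); rewrite normq.
- move=> c f g Cf Cg; exists (fun x => c * f x + g x); first exact: Cc_linear.
  by rewrite linp// involution_linear linq//; exact: Cci.
- move=> f g Cf Cg; exists (convolution mu f g); first exact: convolution_Cc.
  by rewrite mulp// involution_convolution// mulq//; exact: Cci.
Qed.
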